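(* Let $\theta\in[0,2\pi)$ and let $g(\mathbf{x})=g_1([\mathbf{r}_{-\theta}\mathbf{x}]_1)\,g_2([\mathbf{r}_{-\theta}\mathbf{x}]_2)$ with $g_1,g_2\in L^2(\mathbb{R})$ real-valued. Let $\psi^{++}$ be a hypercomplexing wavelet and $\boldsymbol{\theta}_s=(\theta_{s,1},\theta_{s,2})\in\mathbb{R}^2$. Then for all $\boldsymbol{\xi}=(a,\theta,\mathbf{b})$, $a>0$, $\mathbf{b}\in\mathbb{R}^2$ (with the same $\theta$), $$w^{(++)}_\psi\big(\boldsymbol{\xi};\Lambda^{2D}_{\boldsymbol{\theta}_s,\theta}g\big)=e^{-\mathbf{i}\theta_{s,1}}\,w^{(++)}_\psi(\boldsymbol{\xi};g)\,e^{-\mathbf{j}\theta_{s,2}}.$$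
   Context: $\mathbb{H}$: quaternions with units $\mathbf{i},\mathbf{j},\mathbf{k}$, $\mathbf{i}^2=\mathbf{j}^2=\mathbf{k}^2=\mathbf{i}\mathbf{j}\mathbf{k}=-1$, conjugation $q\mapsto q^*$. $\mathbf{r}_\theta=\begin{pmatrix}\cos\theta&-\sin\theta\\ \sin\theta&\cos\theta\end{pmatrix}$, $R_\theta h(\mathbf{x})=h(\mathbf{r}_{-\theta}\mathbf{x})$. Partial Hilbert transforms $\mathcal{H}_l$, $l=1,2$: Fourier multipliers $-\mathbf{j}\,\mathrm{sgn}(f_l)$ for the Fourier transform $\int h(\mathbf{x})e^{-2\pi\mathbf{j}\mathbf{f}^T\mathbf{x}}d^2\mathbf{x}$. $\theta$-hypercomplex signal of real $h$: $h^{(++)}_\theta=R_\theta h+\mathbf{i}R_\theta\mathcal{H}_1h+\mathbf{j}R_\theta\mathcal{H}_2h+\mathbf{k}R_\theta\mathcal{H}_1\mathcal{H}_2h$. For real $g$, $\widetilde g_{-\theta}(\mathbf{x})=g(\mathbf{r}_\theta\mathbf{x})$, $\widetilde g^{(++)}_{-\theta,\theta}=(\widetilde g_{-\theta})^{(++)}_\theta$. Phase shift: for $g$ separable in the frame rotated by $\theta$ as in the claim, $\widetilde g^{(++)}_{-\theta,\theta}$ has a polar form $\widetilde g^{(++)}_{-\theta,\theta}(\mathbf{x})=|\widetilde g^{(++)}_{-\theta,\theta}(\mathbf{x})|e^{2\pi\mathbf{i}\alpha(\mathbf{x})}e^{2\pi\mathbf{j}\beta(\mathbf{x})}$ with real $\alpha,\beta$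 (no $\mathbf{k}$-phase), and $\Lambda^{2D}_{\boldsymbol{\theta}_s,\theta}g(\mathbf{x})=|\widetilde g^{(++)}_{-\theta,\theta}(\mathbf{x})|\cos(2\pi\alpha(\mathbf{x})-\theta_{s,1})\cos(2\pi\beta(\mathbf{x})-\theta_{s,2})$. Hypercomplexing wavelet: $\psi^{++}=\psi^{(ee)}+\mathbf{i}\mathcal{H}_1\psi^{(ee)}+\mathbf{j}\mathcal{H}_2\psi^{(ee)}-\mathbf{k}\mathcal{H}_2\mathcal{H}_1\psi^{(ee)}$ with $\psi^{(ee)}\in L^2(\mathbb{R}^2)$ real, $\int|\psi^{(ee)}|^2=1$, $0<(2\pi)^2\int|\Psi^{(ee)}(\mathbf{f})|^2/|\mathbf{f}|^2d^2\mathbf{f}<\infty$, $\psi^{(ee)}(x_1,x_2)=\psi^{(ee)}(\pm x_1,\pm x_2)=\psi^{(ee)}(x_2,x_1)$. $\psi_{\boldsymbol{\xi}}(\mathbf{x})=\frac1a\psi(\mathbf{r}_{-\theta}(\mathbf{x}-\mathbf{b})/a)$ and $w^{(++)}_\psi(\boldsymbol{\xi};h)=\int_{\mathbb{R}^2}h(\mathbf{x})[\psi^{++}_{\boldsymbol{\xi}}(\mathbf{x})]^*d^2\mathbf{x}$. *)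

(* Defs.v *)
From HB Require Import structures.
From mathcomp Require Import all_boot all_order all_algebra.
From mathcomp Require Import all_classical all_reals all_analysis.
From mathcomp Require Import ring.

Set Implicit Arguments.
Unset Strict Implicit.
Unset Printing Implicit Defensive.

Import Order.TTheory GRing.Theory Num.Theory.
Import numFieldNormedType.Exports.

Local Open Scope classical_set_scope.
Local Open Scope ring_scope.

(* [Quat a b c d] is a + b i + c j + d k. *)
Record quaternion (R : realType) := Quat { q0 : R; q1 : R; q2 : R; q3 : R }.
Arguments Quat {R} _ _ _ _.
Arguments q0 {R} _.
Arguments q1 {R} _.
Arguments q2 {R} _.
Arguments q3 {R} _.

Section quaternion_ring.
Variable R : realType.
Local Notation H := (quaternion R).
Implicit Types p q r : H.

Definition quat_to_prod q := (q0 q, q1 q, q2 q, q3 q).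
Definition prod_to_quat (x : R * R * R * R) : H :=
  Quat x.1.1.1 x.1.1.2 x.1.2 x.2.

Lemma quat_to_prodK : cancel quat_to_prod prod_to_quat.
Proof. by case. Qed.

HB.instance Definition _ := Choice.copy H (can_type quat_to_prodK).

Definition qadd p q : H :=
  Quat (q0 p + q0 q) (q1 p + q1 q) (q2 p + q2 q) (q3 p + q3 q).
Definition qopp q : H := Quat (- q0 q) (- q1 q) (- q2 q) (- q3 q).
Definition qmul p q : H :=
  Quat (q0 p * q0 q - q1 p * q1 q - q2 p * q2 q - q3 p * q3 q)
       (q0 p * q1 q + q1 p * q0 q + q2 p * q3 q - q3 p * q2 q)
       (q0 p * q2 q - q1 p * q3 q + q2 p * q0 q + q3 p * q1 q)
       (q0 p * q3 q + q1 p * q2 q - q2 p * q1 q + q3 p * q0 q).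

Lemma qaddA : associative qadd.
Proof. by move=> [????] [????] [????]; congr Quat => /=; ring. Qed.
Lemma qaddC : commutative qadd.
Proof. by move=> [????] [????]; congr Quat => /=; ring. Qed.
Lemma qadd0 : left_id (Quat 0 0 0 0) qadd.
Proof. by move=> [????]; congr Quat => /=; ring. Qed.
Lemma qaddN : left_inverse (Quat 0 0 0 0) qopp qadd.
Proof. by move=> [????]; congr Quat => /=; ring. Qed.

HB.instance Definition _ := GRing.isZmodule.Build H qaddA qaddC qadd0 qaddN.

Lemma qmulA : associative qmul.
Proof. by move=> [????] [????] [????]; congr Quat => /=; ring. Qed.
Lemma qmul1q : left_id (Quat 1 0 0 0) qmul.
Proof. by move=> [????]; congr Quat => /=; ring. Qed.
Lemma qmulq1 : right_id (Quat 1 0 0 0) qmul.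
Proof. by move=> [????]; congr Quat => /=; ring. Qed.
Lemma qmulDl : left_distributive qmul +%R.
Proof. by move=> [????] [????] [????]; congr Quat => /=; ring. Qed.
Lemma qmulDr : right_distributive qmul +%R.
Proof. by move=> [????] [????] [????]; congr Quat => /=; ring. Qed.
Lemma qone_neq0 : Quat 1 0 0 0 != 0 :> H.
Proof. by apply/eqP => -[] /eqP; rewrite oner_eq0. Qed.

HB.instance Definition _ := GRing.Zmodule_isNzRing.Build H
  qmulA qmul1q qmulq1 qmulDl qmulDr qone_neq0.

Definition qreal (x : R) : H := Quat x 0 0 0.
Definition qi : H := Quat 0 1 0 0.
Definition qj : H := Quat 0 0 1 0.
Definition qk : H := Quat 0 0 0 1.

Lemma qunitsE :
  [/\ qi * qi = -1, qj * qj = -1, qk * qk = -1 & qi * qj * qk = -1].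
Proof. by split; congr Quat => /=; ring. Qed.

Definition qconj q : H := Quat (q0 q) (- q1 q) (- q2 q) (- q3 q).

Definition qnorm q : R :=
  Num.sqrt (q0 q ^+ 2 + q1 q ^+ 2 + q2 q ^+ 2 + q3 q ^+ 2).

(* The exponential e^(u t), when u is a pure unit quaternion (u ^+ 2 = -1). *)
Definition qexp (u : H) (t : R) : H := qreal (cos t) + u * qreal (sin t).

End quaternion_ring.

Arguments qi {R}.
Arguments qj {R}.
Arguments qk {R}.

Section plane.
Variable R : realType.
Local Notation H := (quaternion R).

Local Notation leb2 := (@lebesgue_measure R \x @lebesgue_measure R)%E.

Definition qintegral (F : R * R -> H) : H :=
  Quat (\int[leb2]_x q0 (F x)) (\int[leb2]_x q1 (F x))
       (\int[leb2]_x q2 (F x)) (\int[leb2]_x q3 (F x)).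

Definition qL2 (F : R * R -> H) : Prop :=
  [/\ q0 \o F \in Lfun leb2 2%:E, q1 \o F \in Lfun leb2 2%:E,
      q2 \o F \in Lfun leb2 2%:E & q3 \o F \in Lfun leb2 2%:E].

Definition rotation (theta : R) (x : R * R) : R * R :=
  (cos theta * x.1 - sin theta * x.2, sin theta * x.1 + cos theta * x.2).

Definition rotate_fun (theta : R) (h : R * R -> R) : R * R -> R :=
  fun x => h (rotation (- theta) x).

Definition fourier_L1 (h : R * R -> R) : R * R -> H :=
  fun f => qintegral (fun x =>
    qreal (h x) * qexp qj (- (2 * pi * (f.1 * x.1 + f.2 * x.2)))).

(* On L2 the Fourier transform is the continuous extension of [fourier_L1]
   from the dense subspace of functions that are both L1 and L2. *)
Definition is_fourier (h : R * R -> R) (F : R * R -> H) : Prop :=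
  [/\ h \in Lfun leb2 2%:E, qL2 F &
    exists u : nat -> R * R -> R,
      [/\ forall n, u n \in Lfun leb2 1%:E,
          forall n, u n \in Lfun leb2 2%:E,
          ('N[leb2]_2%:E[(fun x => (u n x - h x)%:E)])%E @[n --> \oo]
            --> 0%E &
          ('N[leb2]_2%:E[(fun f => (qnorm (fourier_L1 (u n) f - F f))%:E)])%E
            @[n --> \oo] --> 0%E]].

(* The operators below pick a representative of an a.e.-class; their values
   outside L2 are irrelevant. *)
Definition fourier (h : R * R -> R) : R * R -> H :=
  xget (fun=> 0) [set F | is_fourier h F].

(* Fourier multiplier -j sgn(f_l), where [coord] is the projection f |-> f_l *)
Definition is_hilbert (coord : R * R -> R) (h h' : R * R -> R) : Prop :=
  is_fourier h' (fun f => - qj * qreal (Num.sg (coord f)) * fourier h f).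

Definition hilbert (coord : R * R -> R) (h : R * R -> R) : R * R -> R :=
  xget (fun=> 0) [set h' | is_hilbert coord h h'].

Definition hilbert1 := hilbert fst.
Definition hilbert2 := hilbert snd.

Definition hypercomplex (theta : R) (h : R * R -> R) : R * R -> H :=
  fun x => qreal (rotate_fun theta h x)
    + qi * qreal (rotate_fun theta (hilbert1 h) x)
    + qj * qreal (rotate_fun theta (hilbert2 h) x)
    + qk * qreal (rotate_fun theta (hilbert1 (hilbert2 h)) x).

Definition hypercomplex_tilde (theta : R) (g : R * R -> R) : R * R -> H :=
  hypercomplex theta (fun x => g (rotation theta x)).

Definition is_polar (q : H) (ab : R * R) : Prop :=
  q = qreal (qnorm q) * qexp qi (2 * pi * ab.1) * qexp qj (2 * pi * ab.2).

(* The pair is not unique, but two pairs change the product of cosines in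
   [phase_shift] only when q = 0, where it is multiplied by 0.  A quaternion
   without such a form gets (0, 0); for g separable in the rotated frame this
   only concerns a null set of points. *)
Definition polar_angles (q : H) : R * R :=
  xget (0, 0) [set ab | is_polar q ab].

Definition phase_shift (ts : R * R) (theta : R) (g : R * R -> R) :
    R * R -> R :=
  fun x => let q := hypercomplex_tilde theta g x in
    let ab := polar_angles q in
    qnorm q * cos (2 * pi * ab.1 - ts.1) * cos (2 * pi * ab.2 - ts.2).

Definition hypercomplexing_wavelet (psi : R * R -> H) : Prop :=
  exists psiee : R * R -> R,
  [/\ psiee \in Lfun leb2 2%:E,
      (\int[leb2]_x ((psiee x) ^+ 2)%:E = 1)%E,
      (0 < ((2 * pi) ^+ 2)%:E * \int[leb2]_f
        (qnorm (fourier psiee f) ^+ 2 / (f.1 ^+ 2 + f.2 ^+ 2))%:E < +oo)%E,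
      {ae leb2, forall x, [/\ psiee (- x.1, x.2) = psiee x,
        psiee (x.1, - x.2) = psiee x & psiee (x.2, x.1) = psiee x]} &
      forall x, psi x = qreal (psiee x)
        + qi * qreal (hilbert1 psiee x) + qj * qreal (hilbert2 psiee x)
        - qk * qreal (hilbert2 (hilbert1 psiee) x)].

Definition wavelet_atom (psi : R * R -> H) (a theta : R) (b : R * R) :
    R * R -> H :=
  fun x => let y := rotation (- theta) (x.1 - b.1, x.2 - b.2) in
    qreal a^-1 * psi (y.1 / a, y.2 / a).

Definition wavelet_transform (psi : R * R -> H) (a theta : R) (b : R * R)
    (h : R * R -> R) : H :=
  qintegral (fun x => qreal (h x) * qconj (wavelet_atom psi a theta b x)).

End plane.

(* Main.v *)
Require Import Defs.
From HB Require Import structures.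
From mathcomp Require Import all_boot all_order all_algebra.
From mathcomp Require Import all_classical all_reals all_analysis.
From mathcomp Require Import measurable_realfun ring lra.

(* Let cas = cos + sin. The kernel cas(2 pi x y) defines a symmetric isometric
   involution of the real space L2(R); that it is an involution follows from
   damping the kernel by e^(-2 pi |y| / n), whose reproducing kernel is the
   (positive) Poisson kernel. Let W be its tensor square on L2(R^2). Splitting
   W h into its parts even and odd under the reflections of the axes gives the
   real and imaginary parts of the Fourier transform of h, and shows that W
   turns H_l into the operator S_l k = sgn(f_l) k(reflection of the l-th axis).
   The operators S_1 and S_2 commute, are skew-adjoint and square to -1.

   In the frame rotated by theta, g is g1 (x) g2, the polar form of its
   hypercomplex signal is a product of the two analytic phases, and the phase
   shift is the product of cos(ts_l) g_l + sin(ts_l) H g_l for l = 1, 2.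
   Pulled back to the coordinates of the atom, g becomes a tensor product with
   W-transform K, and the phase-shifted signal becomes one with W-transform
   (cos ts_1 + sin ts_1 S_1)(cos ts_2 + sin ts_2 S_2) K. Up to a factor, the
   wavelet transform is the quaternion with components <K, k>, <S_1 K, k>,
   <S_2 K, k>, <S_1 S_2 K, k>, where k is the W-transform of the even wavelet.
   Replacing K by S_1 K multiplies this quaternion by -i on the left, and
   replacing K by S_2 K multiplies it by -j on the right. *)

(** With cas in place of the exponential all the analysis stays in real L2 spaces, and quaternions
    enter only through their components. The L2 transform is not an integral: it is encoded by its
    pairing with functions in both L1 and L2, a form that is closed under limits and symmetric.
    Contractivity is a Schur test: the Poisson kernels are nonnegative, symmetric and of mass at
    most 1, so the damped squares of a transform have integral at most that of the squared function,
    and the damping increases to 1. Inversion is first checked on indicators of intervals, whose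
    Poisson averages are explicit arctangents; symmetry carries it from a separating family to all
    of L2, and symmetry together with involution gives the isometry. The second obstacle is choice:
    [fourier] and [hilbert] are picked representatives, so every identity about them holds only
    almost everywhere, and a phase-shifted signal is known only to agree almost everywhere with a
    measurable function. *)

Set Implicit Arguments.
Unset Strict Implicit.
Unset Printing Implicit Defensive.

Import Order.TTheory GRing.Theory Num.Theory.
Import numFieldNormedType.Exports.

Local Open Scope classical_set_scope.
Local Open Scope ring_scope.

(** * The real space L2 *)

Section L2_space.
Context d (T : measurableType d) (R : realType).
Variable mu : {measure set T -> \bar R}.
Implicit Types f g h : T -> R.

Local Notation int f := (mu.-integrable setT (EFin \o f)).
Local Notation L2 := (Lfun mu 2%:E).
Local Notation L1 := (Lfun mu 1%:E).

Definition ip f g : R := \int[mu]_x (f x * g x).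

Lemma integrable_meas f : int f -> measurable_fun setT f.
Proof. by move=> /(measurable_int mu) /measurable_EFinP. Qed.

Lemma ae_integrable f g : int f -> measurable_fun setT g ->
  {ae mu, forall x, f x = g x} -> int g.
Proof.
move=> /integrableP[mf fi] mg fg; apply/integrableP; split.
  exact/measurable_EFinP.
rewrite (_ : integral _ _ _ = (\int[mu]_x `|(EFin \o f) x|)%E)//.
apply: ge0_ae_eq_integral => //.
- by apply: measurableT_comp => //; exact/measurable_EFinP.
- exact: measurableT_comp.
- by apply: filterS fg => x /= ->.
Qed.

Lemma le_integrable_EFin f g : measurable_fun setT f ->
  (forall x, `|f x| <= g x) -> int g -> int f.
Proof.
move=> mf fg; apply: le_integrable => //; first exact/measurable_EFinP.
by move=> x _ /=; rewrite lee_fin (le_trans (fg x))// ler_norm.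
Qed.

Lemma integrableZl_EFin (a : R) f : int f -> int (fun x => a * f x).
Proof. exact: (@integrableZl _ _ _ mu setT measurableT a (EFin \o f)). Qed.

Lemma integrableD_EFin f g : int f -> int g -> int (fun x => f x + g x).
Proof. exact: (@integrableD _ _ _ mu setT measurableT (EFin \o f) (EFin \o g)). Qed.

Lemma integrableB_EFin f g : int f -> int g -> int (fun x => f x - g x).
Proof. exact: (@integrableB _ _ _ mu setT measurableT (EFin \o f) (EFin \o g)). Qed.

Lemma integrableM_bounded f g (M : R) : measurable_fun setT f ->
  (forall x, `|f x| <= M) -> int g -> int (fun x => f x * g x).
Proof.
move=> mf fM ig; apply: (@le_integrable_EFin _ (fun x => M * `|g x|)).
- by apply: measurable_funM => //; exact: integrable_meas.
- by move=> x; rewrite normrM ler_wpM2r.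
- by apply: integrableZl_EFin; exact: integrable_norm.
Qed.

Lemma ae_eq_Rintegral f g : measurable_fun setT f -> measurable_fun setT g ->
  {ae mu, forall x, f x = g x} -> \int[mu]_x f x = \int[mu]_x g x.
Proof.
move=> mf mg fg; congr fine; apply: ae_eq_integral => //.
- exact/measurable_EFinP.
- exact/measurable_EFinP.
- by apply: filterS fg => x /= ->.
Qed.

Lemma L2P f : (f \in L2) <-> measurable_fun setT f /\ int (fun x => f x ^+ 2).
Proof.
split => [fL|[mf fi]].
  split; last exact: Lfun2_integrable_sqr.
  by move: fL => /sub_Lfun_mfun /set_mem.
apply/andP; split; first exact/mem_set.
apply/mem_set; rewrite /= /finite_norm unlock poweR_lty//.
case/integrableP : fi => _; apply: le_lt_trans.
rewrite le_eqVlt; apply/orP; left; apply/eqP; apply: eq_integral => x _ /=.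
by rewrite normrX powR_mulrn.
Qed.

Lemma L2_meas f : f \in L2 -> measurable_fun setT f.
Proof. by case/L2P. Qed.

Lemma L1P f : (f \in L1) <-> int f.
Proof. exact: Lfun1_integrable. Qed.

Lemma L1_meas f : f \in L1 -> measurable_fun setT f.
Proof. by move/L1P/integrable_meas. Qed.

Lemma integrable_L2M f g : f \in L2 -> g \in L2 -> int (fun x => f x * g x).
Proof. by move=> f2 g2; apply/Lfun1_integrable/Lfun2_mul_Lfun1. Qed.

Lemma L2D f g : f \in L2 -> g \in L2 -> (fun x => f x + g x) \in L2.
Proof. by move=> f2 g2; rewrite [X in X \in _](_ : _ = f + g)// rpredD// lee1n. Qed.

Lemma L2N f : f \in L2 -> (fun x => - f x) \in L2.
Proof. by move=> f2; rewrite [X in X \in _](_ : _ = - f)// rpredN. Qed.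

Lemma L2B f g : f \in L2 -> g \in L2 -> (fun x => f x - g x) \in L2.
Proof. by move=> f2 g2; rewrite [X in X \in _](_ : _ = f - g)// rpredB// lee1n. Qed.

Lemma L2_bounded f g (M : R) : measurable_fun setT f -> (forall x, `|f x| <= M) ->
  g \in L2 -> (fun x => f x * g x) \in L2.
Proof.
move=> mf fM /L2P[mg ig]; apply/L2P; split; first exact: measurable_funM.
rewrite (_ : _ \o _ = EFin \o (fun x => (f x) ^+ 2 * (g x) ^+ 2)); last first.
  by apply/funext => x /=; rewrite exprMn.
apply: (@integrableM_bounded _ _ (M ^+ 2)) => //.
  exact: measurable_funX.
by move=> x; rewrite normrX lerXn2r ?nnegrE// (le_trans _ (fM x)).
Qed.

Lemma L2Z (a : R) f : f \in L2 -> (fun x => a * f x) \in L2.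
Proof. by move=> f2; apply: (@L2_bounded _ _ `|a|). Qed.

Lemma ae_L2 f g : f \in L2 -> measurable_fun setT g -> {ae mu, forall x, f x = g x} ->
  g \in L2.
Proof.
move=> /L2P[mf fi] mg fg; apply/L2P; split => //.
apply: (ae_integrable fi); first exact: measurable_funX.
by apply: filterS fg => x /= ->.
Qed.

Lemma ip_C f g : ip f g = ip g f.
Proof. by apply: eq_Rintegral => x _; rewrite mulrC. Qed.

Lemma ipDl f g h : f \in L2 -> g \in L2 -> h \in L2 ->
  ip (fun x => f x + g x) h = ip f h + ip g h.
Proof.
move=> f2 g2 h2; rewrite -RintegralD//.
- by apply: eq_Rintegral => x _; rewrite mulrDl.
- exact: integrable_L2M.
- exact: integrable_L2M.
Qed.

Lemma ipZl (a : R) f g : f \in L2 -> g \in L2 ->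
  ip (fun x => a * f x) g = a * ip f g.
Proof.
move=> f2 g2; rewrite -RintegralZl//.
- by apply: eq_Rintegral => x _; rewrite mulrA.
- exact: integrable_L2M.
Qed.

Lemma ipNl f g : f \in L2 -> g \in L2 -> ip (fun x => - f x) g = - ip f g.
Proof.
move=> f2 g2; rewrite -mulN1r -ipZl//.
by apply: eq_Rintegral => x _; rewrite mulN1r.
Qed.

Lemma ipBl f g h : f \in L2 -> g \in L2 -> h \in L2 ->
  ip (fun x => f x - g x) h = ip f h - ip g h.
Proof. by move=> f2 g2 h2; rewrite ipDl ?ipNl// L2N. Qed.

Lemma ipDr f g h : f \in L2 -> g \in L2 -> h \in L2 ->
  ip h (fun x => f x + g x) = ip h f + ip h g.
Proof. by move=> *; rewrite ip_C ipDl// ip_C (ip_C g). Qed.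

Lemma ipZr (a : R) f g : f \in L2 -> g \in L2 ->
  ip g (fun x => a * f x) = a * ip g f.
Proof. by move=> *; rewrite ip_C ipZl// ip_C. Qed.

Lemma ipBr f g h : f \in L2 -> g \in L2 -> h \in L2 ->
  ip h (fun x => f x - g x) = ip h f - ip h g.
Proof. by move=> *; rewrite ip_C ipBl// ip_C (ip_C g). Qed.

Lemma ip_ge0 f : 0 <= ip f f.
Proof. by apply: Rintegral_ge0 => x _; rewrite -expr2 sqr_ge0. Qed.

Lemma ip_ae f f' g g' : f \in L2 -> f' \in L2 -> g \in L2 -> g' \in L2 ->
  {ae mu, forall x, f x = f' x} -> {ae mu, forall x, g x = g' x} -> ip f g = ip f' g'.
Proof.
move=> f2 f2' g2 g2' ff gg; apply: ae_eq_Rintegral.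
- by apply: measurable_funM; exact: L2_meas.
- by apply: measurable_funM; exact: L2_meas.
- by apply: filterS2 ff gg => x -> ->.
Qed.

Lemma ip_eq0 f : f \in L2 -> ip f f = 0 -> {ae mu, forall x, f x = 0}.
Proof.
move=> f2; rewrite /ip => f0.
have if2 := integrable_L2M f2 f2.
have := (ae_eq_integral_abs mu measurableT (measurable_int mu if2)).1.
case.
  rewrite (eq_integral (EFin \o (fun x => f x * f x))); last first.
    by move=> x _ /=; rewrite ger0_norm// -expr2 sqr_ge0.
  rewrite -[LHS]fineK; last exact: integrable_fin_num.
  by congr EFin.
move=> N [mN N0 sN]; exists N; split => // x /= h; apply: sN => /= h'.
by apply: h; have /= := h' I => -[] /eqP; rewrite mulf_eq0 orbb => /eqP.
Qed.

(** The nonnegative quadratic [h] in [t] is evaluated at its minimiser [- ip f g / ip g g]; if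
    [ip g g = 0], then [g] vanishes almost everywhere and so does the product. *)
Lemma cauchy_schwarz f g : f \in L2 -> g \in L2 ->
  (ip f g) ^+ 2 <= ip f f * ip g g.
Proof.
move=> f2 g2.
have h (t : R) : 0 <= ip f f + 2 * t * ip f g + t ^+ 2 * ip g g.
  have := ip_ge0 (fun x => f x + t * g x).
  have tg2 := L2Z t g2; have ftg2 := L2D f2 tg2.
  rewrite ipDl// !ipDr// ipZl// !ipZr// ipZl// (ip_C g f).
  rewrite (_ : _ + _ + (_ + _) = ip f f + 2 * t * ip f g + t ^+ 2 * ip g g)//.
  by ring.
have := ip_ge0 g; rewrite le_eqVlt => /orP[/eqP g0|g0].
- have /eqP : ip f g = 0.
    have g0' := ip_eq0 g2 (esym g0).
    have z2 : (fun=> 0 : R) \in L2.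
      apply/L2P; split => //; rewrite (_ : _ \o _ = cst 0%E) ?integrable0//.
      by apply/funext => x /=; rewrite expr0n.
    rewrite (@ip_ae f f g (fun=> 0))//; last exact: aeW.
    by rewrite /ip; under eq_Rintegral do rewrite mulr0; rewrite Rintegral_cst// mul0r.
  by move=> /eqP ->; rewrite expr0n mulr_ge0// ip_ge0.
- have := h (- ip f g / ip g g).
  have -> : ip f f + 2 * (- ip f g / ip g g) * ip f g +
    (- ip f g / ip g g) ^+ 2 * ip g g = (ip f f * ip g g - ip f g ^+ 2) / ip g g.
    by field; rewrite gt_eqF.
  by rewrite pmulr_lge0 ?invr_gt0// subr_ge0.
Qed.


(* Parallelogram-type bound that replaces the triangle inequality. *)
Lemma ipD_le f g : f \in L2 -> g \in L2 ->
  ip (fun x => f x + g x) (fun x => f x + g x) <= 2 * ip f f + 2 * ip g g.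
Proof.
move=> f2 g2; have fg2 := L2D f2 g2; have fNg2 := L2B f2 g2.
have := ip_ge0 (fun x => f x - g x).
rewrite ipBl// !ipBr// ipDl// !ipDr// (ip_C g f).
by set a := ip f f; set b := ip g g; set c := ip f g; lra.
Qed.

(** Squared distances avoid square roots and extended-real norms; [cvg_Lnorm2] makes the link with
    the norms in [is_fourier]. *)
Definition L2cvg (u : (T -> R)^nat) f :=
  ip (fun x => u n x - f x) (fun x => u n x - f x) @[n --> \oo] --> (0 : R).

Lemma L2cvg_ip (u : (T -> R)^nat) f g : (forall n, u n \in L2) -> f \in L2 ->
  g \in L2 -> L2cvg u f -> ip (u n) g @[n --> \oo] --> ip f g.
Proof.
move=> u2 f2 g2 uf.
have h : (ip (fun x => u n x - f x) g) ^+ 2 @[n --> \oo] --> (0 : R).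
  apply: (@squeeze_cvgr _ _ _ _ (cst 0) (fun n =>
    ip (fun x => u n x - f x) (fun x => u n x - f x) * ip g g)).
  - by apply: nearW => n /=; rewrite sqr_ge0 cauchy_schwarz// L2B.
  - exact: cvg_cst.
  - by rewrite -[X in _ --> X](mul0r (ip g g)); apply: cvgM => //; exact: cvg_cst.
have {}h : ip (fun x => u n x - f x) g @[n --> \oo] --> (0 : R).
  apply/norm_cvg0P.
  rewrite -[X in _ --> X]sqrtr0 (_ : (fun n => `|ip (fun x => u n x - f x) g|) = (fun n =>
    Num.sqrt (ip (fun x => u n x - f x) g ^+ 2))); last first.
    by apply/funext => n /=; rewrite sqrtr_sqr.
  by apply: continuous_cvg => //; exact: sqrt_continuous.
have -> : (fun n => ip (u n) g) = (fun n => ip (fun x => u n x - f x) g + ip f g).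
  by apply/funext => n; rewrite ipBl// subrK.
by rewrite -[X in _ --> X]add0r; apply: cvgD => //; exact: cvg_cst.
Qed.

Lemma L2cvg_norm (u : (T -> R)^nat) f : (forall n, u n \in L2) -> f \in L2 ->
  L2cvg u f -> ip (u n) (u n) @[n --> \oo] --> ip f f.
Proof.
move=> u2 f2 uf.
have h := L2cvg_ip u2 f2 f2 uf.
(* [|u|^2 = |u - f|^2 + 2 <u, f> - |f|^2], so that weak convergence suffices for the middle
   terms. *)
have -> : (fun n => ip (u n) (u n)) = (fun n =>
  ip (fun x => u n x - f x) (fun x => u n x - f x) + ip (u n) f + ip (u n) f - ip f f).
  apply/funext => n; have B := L2B (u2 n) f2.
  by rewrite ipBl// !ipBr// (ip_C f (u n)); ring.
rewrite -[X in _ --> X](_ : 0 + ip f f + ip f f - ip f f = _); last by ring.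
by apply: cvgB; [apply: cvgD => //; exact: cvgD|exact: cvg_cst].
Qed.

Lemma L2cvg_unique (u : (T -> R)^nat) f g : (forall n, u n \in L2) ->
  f \in L2 -> g \in L2 -> L2cvg u f -> L2cvg u g ->
  {ae mu, forall x, f x = g x}.
Proof.
move=> u2 f2 g2 uf ug.
have fg2 := L2B f2 g2.
suff /(ip_eq0 fg2) : ip (fun x => f x - g x) (fun x => f x - g x) = 0.
  by apply: filterS => x /eqP; rewrite subr_eq0 => /eqP.
have h1 := L2cvg_ip u2 f2 fg2 uf.
have h2 := L2cvg_ip u2 g2 fg2 ug.
by rewrite ipBl// (cvg_unique _ h1 h2)// subrr.
Qed.

Lemma L2cvg_ae (u v : (T -> R)^nat) f g : (forall n, u n \in L2) ->
  (forall n, v n \in L2) -> f \in L2 -> g \in L2 ->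
  (forall n, {ae mu, forall x, u n x = v n x}) ->
  {ae mu, forall x, f x = g x} -> L2cvg u f -> L2cvg v g.
Proof.
move=> u2 v2 f2 g2 uv fg; rewrite /L2cvg.
suff -> : (fun n => ip (fun x => u n x - f x) (fun x => u n x - f x)) =
    (fun n => ip (fun x => v n x - g x) (fun x => v n x - g x)) by [].
apply/funext => n.
apply: ip_ae; [exact: L2B|exact: L2B|exact: L2B|exact: L2B| |];
  by apply: filterS2 (uv n) fg => x -> ->.
Qed.

Lemma L2cvgB (u v : (T -> R)^nat) f g : (forall n, u n \in L2) ->
  (forall n, v n \in L2) -> f \in L2 -> g \in L2 ->
  L2cvg u f -> L2cvg v g -> L2cvg (fun n x => u n x - v n x) (fun x => f x - g x).
Proof.
move=> u2 v2 f2 g2 uf vg.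
apply: (@squeeze_cvgr _ _ _ _ (cst 0) (fun n =>
  2 * ip (fun x => u n x - f x) (fun x => u n x - f x) +
  2 * ip (fun x => v n x - g x) (fun x => v n x - g x))).
- apply: nearW => n; rewrite ip_ge0/=.
  have a2 := L2B (u2 n) f2; have b2 := L2B (v2 n) g2.
  apply: le_trans (_ : 2 * ip (fun x => u n x - f x) (fun x => u n x - f x) +
    2 * ip (fun x => - (v n x - g x)) (fun x => - (v n x - g x)) <= _).
    apply: le_trans (ipD_le a2 (L2N b2)).
    by rewrite le_eqVlt; apply/orP; left; apply/eqP; congr ip; apply/funext => x; ring.
  by rewrite ipNl ?L2N// ip_C ipNl ?L2N// opprK.
- exact: cvg_cst.
- rewrite -[X in _ --> X](_ : 2 * 0 + 2 * 0 = _); last by ring.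
  by apply: cvgD; apply: cvgM => //; exact: cvg_cst.
Qed.

Lemma L2cvg_bounded (w : T -> R) (M : R) (u : (T -> R)^nat) f :
  measurable_fun setT w -> (forall x, `|w x| <= M) ->
  (forall n, u n \in L2) -> f \in L2 ->
  L2cvg u f -> L2cvg (fun n x => w x * u n x) (fun x => w x * f x).
Proof.
move=> mw wM u2 f2 uf.
apply: (@squeeze_cvgr _ _ _ _ (cst 0) (fun n =>
  M ^+ 2 * ip (fun x => u n x - f x) (fun x => u n x - f x))).
- apply: nearW => n; rewrite ip_ge0/=.
  have a2 := L2B (u2 n) f2.
  have wa2 := L2B (L2_bounded mw wM (u2 n)) (L2_bounded mw wM f2).
  rewrite -RintegralZl//; last exact: integrable_L2M.
  apply: le_Rintegral => //.
  + exact: integrable_L2M.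
  + by apply: integrableZl_EFin; exact: integrable_L2M.
  + move=> x _; rewrite -!expr2 -mulrBr exprMn ler_wpM2r ?sqr_ge0//.
    rewrite -real_normK ?num_real// lerXn2r ?nnegrE//.
    by rewrite (le_trans _ (wM x)).
- exact: cvg_cst.
- by rewrite -[X in _ --> X](mulr0 (M ^+ 2)); apply: cvgM => //; exact: cvg_cst.
Qed.

Lemma L2cvg_cst f : f \in L2 -> L2cvg (fun=> f) f.
Proof.
move=> f2; rewrite /L2cvg; under eq_fun do under eq_fun do rewrite subrr.
rewrite /ip; under eq_fun do under eq_Rintegral do rewrite mulr0.
by under eq_fun do rewrite Rintegral_cst// mul0r; exact: cvg_cst.
Qed.

Lemma dominated_Rintegral (u : (T -> R)^nat) f g :
  (forall n, measurable_fun setT (u n)) -> measurable_fun setT f ->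
  {ae mu, forall x, u n x @[n --> \oo] --> f x} -> int g ->
  (forall n x, `|u n x| <= g x) ->
  \int[mu]_x u n x @[n --> \oo] --> \int[mu]_x f x.
Proof.
move=> mu_ mf uf ig ug.
have uf' : {ae mu, forall x, setT x -> (EFin \o u n) x @[n --> \oo] --> (EFin \o f) x}.
  apply: filterS uf => x H _; apply: cvg_EFin H; exact: nearW.
have ug' : {ae mu, forall x n, setT x -> (`|(EFin \o u n) x| <= (EFin \o g) x)%E}.
  by apply: aeW => x n _; rewrite lee_fin.
have [if_ _ h] := dominated_convergence measurableT
  (fun n => (measurable_EFinP _ _).2 (mu_ n)) ((measurable_EFinP _ _).2 mf) uf' ig ug'.
apply: fine_cvg.
by rewrite fineK //; exact: integrable_fin_num.
Qed.

End L2_space.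

(** * Truncation and completeness of L2 *)

Section L2_complete.
Context d (T : measurableType d) (R : realType).
Variable mu : {measure set T -> \bar R}.
Implicit Types f g h : T -> R.

Local Notation int f := (mu.-integrable setT (EFin \o f)).
Local Notation L2 := (Lfun mu 2%:E).
Local Notation L1 := (Lfun mu 1%:E).

(** Small values are cut off, not large ones: where [|f| > 1/(n+1)] one has [|f| <= (n+1) f^2], so
    the truncation of an L2 function lies in both L1 and L2, where [hat] is a genuine integral. *)
Definition trunc f (n : nat) : T -> R :=
  fun x => if n.+1%:R^-1 < `|f x| then f x else 0.

Lemma measurable_trunc f n : measurable_fun setT f ->
  measurable_fun setT (trunc f n).
Proof.
move=> mf; apply: measurable_fun_ifT => //.
by apply: measurable_fun_ltr => //; exact: measurableT_comp.
Qed.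

Lemma trunc_L2 f n : f \in L2 -> trunc f n \in L2.
Proof.
move=> /L2P[mf if2]; apply/L2P; split; first exact: measurable_trunc.
apply: le_integrable_EFin if2.
  by apply: measurable_funX; exact: measurable_trunc.
move=> x; rewrite /trunc; case: ifPn => _; first by rewrite ger0_norm ?sqr_ge0.
by rewrite expr0n normr0 sqr_ge0.
Qed.

Lemma trunc_L1 f n : f \in L2 -> trunc f n \in L1.
Proof.
move=> /L2P[mf if2]; apply/L1P.
apply: (le_integrable_EFin _ _ (integrableZl_EFin n.+1%:R if2)).
  exact: measurable_trunc.
move=> x; rewrite /trunc; case: ifPn => [h|_].
  rewrite -[X in _ <= _ * X]real_normK ?num_real// expr2 mulrA ler_peMl//.
  by rewrite mulrC -ler_pdivrMr ?ltr0Sn// div1r ltW.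
by rewrite normr0 mulr_ge0// sqr_ge0.
Qed.

Lemma cvg_trunc f x : trunc f n x @[n --> \oo] --> f x.
Proof.
have [fx0|fx0] := eqVneq (f x) 0.
  rewrite /trunc fx0; under eq_fun do rewrite if_same.
  exact: cvg_cst.
apply: (@cvg_trans _ (cst (f x) @ \oo)); last exact: cvg_cst.
apply: near_eq_cvg; near=> n; rewrite /trunc.
suff -> : n.+1%:R^-1 < `|f x| by [].
near: n; apply: near_infty_natSinv_lt (PosNum _); by rewrite normr_gt0.
Unshelve. all: by end_near. Qed.

Lemma L2cvg_trunc f : f \in L2 -> L2cvg mu (trunc f) f.
Proof.
move=> f2; have [mf if2] := (L2P mu f).1 f2.
rewrite /L2cvg /ip -[X in _ --> X](_ : \int[mu]_x cst 0 x = _); last first.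
  by rewrite Rintegral_cst// mul0r.
apply: (dominated_Rintegral _ _ _ if2) => //.
- move=> n; apply: measurable_funM; apply: measurable_funB => //;
  exact: measurable_trunc.
- apply: aeW => x.
  rewrite -[X in _ --> X](_ : (f x - f x) * (f x - f x) = _); last by rewrite subrr mul0r.
  by apply: cvgM; apply: cvgB; (exact: cvg_trunc || exact: cvg_cst).
- move=> n x; rewrite /trunc; case: ifPn => _.
    by rewrite subrr mul0r normr0 sqr_ge0.
  by rewrite sub0r mulrNN -expr2 ger0_norm ?sqr_ge0.
Qed.

(** The Riesz-Fischer argument with the summability built into the hypothesis: the sum [S] of the
    squares of the [D k] weighted by [4 ^+ k] has integral at most [C], hence is finite almost
    everywhere, and there [|D k| <= sqrt S / 2^k]. This geometric bound gives a pointwise limit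
    together with its rate. *)
Lemma L2_complete (u : (T -> R)^nat) (C : R) : (forall n, u n \in L2) ->
  (forall k, 4 ^+ k * ip mu (fun x => u k.+1 x - u k x) (fun x => u k.+1 x - u k x)
     <= C / (2 ^ k.+1)%:R) ->
  exists2 f, f \in L2 & L2cvg mu u f.
Proof.
move=> u2 uC.
have C0 : 0 <= C.
  have := uC 0%N; rewrite expr0 mul1r => /(le_trans (ip_ge0 _ _)).
  by rewrite pmulr_lge0 ?invr_gt0 ?ltr0n.
pose D k x := u k.+1 x - u k x.
have D2 k : D k \in L2 by exact: L2B.
pose S x : \bar R := (\sum_(k <oo) (4 ^+ k * (D k x * D k x))%:E)%E.
have D0 k x : 0 <= 4 ^+ k * (D k x * D k x).
  by rewrite mulr_ge0 ?exprn_ge0// -expr2 sqr_ge0.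
have mD k : measurable_fun setT (fun x => (4 ^+ k * (D k x * D k x))%:E).
  by apply/measurable_EFinP; do 2! apply: measurable_funM => //; exact: (L2_meas (D2 k)).
have mS : measurable_fun setT S.
  by apply: (@ge0_emeasurable_sum _ _ _ _ (fun k x => (4 ^+ k * (D k x * D k x))%:E) xpredT) => // k x _ _; rewrite lee_fin.
have S0 x : (0 <= S x)%E by apply: nneseries_ge0 => k _ _; rewrite lee_fin.
have iS : (\int[mu]_x S x <= C%:E)%E.
  rewrite /S integral_nneseries//; last by move=> n x _; rewrite lee_fin.
  (* The bounds [C / 2^(k+1)] of the hypothesis sum to [C]. *)
  apply: le_trans (epsilon_trick0 xpredT C0).
  apply: lee_nneseries => [k _ _|k _]; first by apply: integral_ge0 => x _; rewrite lee_fin.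
  have iD := integrableZl_EFin (4 ^+ k) (integrable_L2M (D2 k) (D2 k)).
  rewrite -[leLHS]fineK; last exact: integrable_fin_num iD.
  rewrite lee_fin -/(Rintegral _ _ _) (RintegralZl _ measurableT (integrable_L2M (D2 k) (D2 k))).
  exact: uC.
have iS' : mu.-integrable setT S.
  apply/integrableP; split => //; under eq_integral do rewrite gee0_abs//.
  by rewrite (le_lt_trans iS)// ltry.
pose s x := fine (S x).
have s0 x : 0 <= s x by rewrite fine_ge0.
pose E := [set x | S x \is a fin_num].
have mE : measurable E by rewrite -[E]setTI; exact: emeasurable_fin_num.
have ints : int s.
  rewrite (_ : EFin \o s = S \_ E); last first.
    apply/funext => x /=; rewrite patchE; case: ifPn => [/set_mem xE|]; first by rewrite fineK.
    by rewrite notin_setE /E /= fin_numE /s; case: (S x) => //=.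
  by rewrite -integrable_mkcond//; apply: integrableS iS'.
have sqr_half k : (2^-1 ^+ k) ^+ 2 = 4^-1 ^+ k :> R.
  by rewrite -exprM mulnC exprM exprVn -natrX.
have SD x k : E x -> `|D k x| <= Num.sqrt (s x) * 2^-1 ^+ k.
  move=> Ex; rewrite -[X in _ <= X]ger0_norm; last first.
    by rewrite mulr_ge0 ?sqrtr_ge0 ?exprn_ge0.
  rewrite -ler_sqr ?nnegrE// !real_normK ?num_real// exprMn sqr_sqrtr//.
rewrite sqr_half exprVn ler_pdivlMr ?exprn_gt0// mulrC.
  rewrite -lee_fin /s fineK// /S.
  apply: le_trans (@nneseries_lim_ge _ _ xpredT 0 k.+1 _); last by move=> *; rewrite lee_fin.
  rewrite big_mkord big_ord_recr/= -expr2 leeDr// sume_ge0// => i _.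
  by rewrite lee_fin.
(* Setting the sequence to 0 outside [E] makes it converge at every point, so that its limit is
   measurable. *)
pose v n x := if x \in E then u n x else 0.
have mv n : measurable_fun setT (v n).
  apply: measurable_fun_ifT => //; last exact: L2_meas (u2 n).
  by apply: (measurable_fun_bool true); rewrite setTI; rewrite (_ : _ @^-1` _ = E)//;
     apply/seteqP; split => x /=; [move/set_mem|move/mem_set].
(* Telescoping: [2 * 2^-n - 2 * 2^-(n+i)] is the sum of the [2^-k] for [n <= k < n + i]. *)
have vd n i x : `|v (n + i)%N x - v n x| <=
    Num.sqrt (s x) * (2 * 2^-1 ^+ n - 2 * 2^-1 ^+ (n + i)).
  rewrite /v; case: ifPn => [/set_mem xE|_]; last first.
    rewrite subrr normr0 mulr_ge0 ?sqrtr_ge0// subr_ge0 ler_wpM2l//.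
    by rewrite ler_wiXn2l// ?invr_ge0// ?invf_le1 ?ler1n// leq_addr.
  elim: i => [|i IH]; first by rewrite addn0 !subrr normr0 mulr0.
  rewrite addnS.
  have -> : u (n + i).+1 x - u n x = D (n + i)%N x + (u (n + i)%N x - u n x).
    by rewrite /D; ring.
  rewrite (le_trans (ler_normD _ _))//.
  apply: le_trans (lerD (SD x (n + i)%N xE) IH) _.
  by rewrite le_eqVlt; apply/orP; left; apply/eqP; rewrite exprS; field.
have vcvg x : cvgn (v ^~ x).
  pose r := Num.sqrt (s x).
  (* Adding the geometric tail makes the sequence nonincreasing and bounded below. *)
  have -> : v ^~ x = (fun n => v n x + r * 2 * 2^-1 ^+ n) \- (fun n => r * 2 * 2^-1 ^+ n).
    by apply/funext => n /=; rewrite addrK.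
  have hgeo : (fun n : nat => r * 2 * 2^-1 ^+ n) @ \oo --> (0 : R).
    by apply: cvg_geometric; rewrite ger0_norm// invf_lt1 ?ltr1n.
  apply: is_cvgB; last by apply/cvg_ex; exists 0.
  apply: nonincreasing_is_cvgn.
    apply/nonincreasing_seqP => n.
    have := vd n 1%N x; rewrite addn1 => /ler_normlP[_].
    by rewrite -/r exprS; set a := 2^-1 ^+ n; set b := v n.+1 x; set c := v n x; lra.
  exists (v 0%N x - r * 2) => _ [n _ <-].
  have := vd 0%N n x; rewrite add0n expr0 => /ler_normlP[+ _].
  have : 0 <= r * 2 * 2^-1 ^+ n by rewrite !mulr_ge0 ?sqrtr_ge0 ?exprn_ge0.
  rewrite -/r; set a := 2^-1 ^+ n; set b := v n x; set c := v _ x; set e := r * 2 * a.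
  have -> : r * (2 * 1 - 2 * a) = r * 2 - e by rewrite /e; ring.
  by lra.
pose f x := limn (v ^~ x).
have mf : measurable_fun setT f by exact: (measurable_fun_cvg mv).
have fv n x : (v n x - f x) * (v n x - f x) <= 4 * 4^-1 ^+ n * s x.
  have h : `|f x - v n x| <= Num.sqrt (s x) * (2 * 2^-1 ^+ n).
    have hc : `|v (i + n)%N x - v n x| @[i --> \oo] --> `|f x - v n x|.
      apply: cvg_norm; apply: cvgB; last exact: cvg_cst.
      by rewrite (@cvg_shiftn n _ (v ^~ x)); exact: vcvg.
    apply: (cvgr_to_le hc); apply: nearW => i; rewrite addnC.
    apply: (le_trans (vd n i x)); rewrite ler_wpM2l ?sqrtr_ge0// gerBl.
    by rewrite mulr_ge0// exprn_ge0.
  rewrite -expr2 -sqrrN opprB -real_normK ?num_real//.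
  apply: (@le_trans _ _ ((Num.sqrt (s x) * (2 * 2^-1 ^+ n)) ^+ 2)).
    by rewrite lerXn2r ?nnegrE// !mulr_ge0 ?sqrtr_ge0 ?exprn_ge0.
  rewrite !exprMn sqr_sqrtr// sqr_half mulrC.
  by rewrite (_ : 2 ^+ 2 = 4) // -natrX.
have v2 n : v n \in L2.
  apply/L2P; split => //; have [_] := (L2P mu _).1 (u2 n).
  apply: le_integrable_EFin; first exact: measurable_funX.
  move=> x; rewrite /v; case: ifP => _; first by rewrite ger0_norm ?sqr_ge0.
  by rewrite expr0n normr0 sqr_ge0.
have vf2 n : (fun x => v n x - f x) \in L2.
  apply/L2P; split; first exact: measurable_funB.
  apply: (le_integrable_EFin _ _ (integrableZl_EFin (4 * 4^-1 ^+ n) ints)).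
    by apply: measurable_funX; exact: measurable_funB.
  by move=> x; rewrite ger0_norm ?sqr_ge0// expr2.
have f2 : f \in L2.
  rewrite (_ : f = (fun x => v 0%N x - (v 0%N x - f x))); first exact: L2B.
  by apply/funext => x; rewrite subKr.
exists f => //.
apply: (@L2cvg_ae _ _ _ _ v u f f) => //.
- move=> n; have := integrable_ae measurableT iS'.
  by apply: filterS => x /(_ I) xE; rewrite /v mem_set.
- exact: aeW.
- apply: (@squeeze_cvgr _ _ _ _ (cst 0) (fun n => 4 * 4^-1 ^+ n * \int[mu]_x s x)).
  + apply: nearW => n; rewrite ip_ge0/= -RintegralZl//.
    apply: le_Rintegral => //; first exact: integrable_L2M.
    exact: integrableZl_EFin.
  + exact: cvg_cst.
  + rewrite -[X in _ --> X](mul0r (\int[mu]_x s x)); apply: cvgM; last exact: cvg_cst.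
    by apply: cvg_geometric; rewrite ger0_norm// invf_lt1 ?ltr1n.
Qed.

End L2_complete.

(** * Product measures and tensor products *)

Section real_Fubini.
Context d1 d2 (S : measurableType d1) (T : measurableType d2) (R : realType).
Variables (nu : {sigma_finite_measure set S -> \bar R})
  (mu : {sigma_finite_measure set T -> \bar R}).
Implicit Types F : S * T -> R.

Local Notation numu := (nu \x mu)%E.

(** The real integral is [fine] of a difference of two Tonelli integrals, those of the positive and
    the negative part, and each is measurable. *)
Lemma measurable_Rintegral_l F : measurable_fun setT F ->
  measurable_fun setT (fun y => \int[nu]_x F (x, y)).
Proof.
move=> mF; apply: measurableT_comp => //.
rewrite (_ : (fun y => _) = (fun y => \int[nu]_x (EFin \o F)^\+ (x, y)) \-
  (fun y => \int[nu]_x (EFin \o F)^\- (x, y)))%E; last first.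
  by apply/funext => y; rewrite [LHS]integralE; congr (_ - _)%E; apply: eq_integral => x _; rewrite (funepos_comp (EFin \o F), funeneg_comp (EFin \o F)).
have mF' : measurable_fun setT (EFin \o F) by exact/measurable_EFinP.
apply: emeasurable_funB.
- apply: (measurable_fun_fubini_tonelli_G ((EFin \o F)^\+)%E) => //.
  exact: measurable_funepos.
- apply: (measurable_fun_fubini_tonelli_G ((EFin \o F)^\-)%E) => //.
  exact: measurable_funeneg.
Qed.

Lemma measurable_Rintegral_r F : measurable_fun setT F ->
  measurable_fun setT (fun x => \int[mu]_y F (x, y)).
Proof.
move=> mF; apply: measurableT_comp => //.
rewrite (_ : (fun y => _) = (fun x => \int[mu]_y (EFin \o F)^\+ (x, y)) \-
  (fun x => \int[mu]_y (EFin \o F)^\- (x, y)))%E; last first.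
  by apply/funext => y; rewrite [LHS]integralE; congr (_ - _)%E; apply: eq_integral => x _; rewrite (funepos_comp (EFin \o F), funeneg_comp (EFin \o F)).
have mF' : measurable_fun setT (EFin \o F) by exact/measurable_EFinP.
apply: emeasurable_funB.
- apply: (measurable_fun_fubini_tonelli_F ((EFin \o F)^\+)%E) => //.
  exact: measurable_funepos.
- apply: (measurable_fun_fubini_tonelli_F ((EFin \o F)^\-)%E) => //.
  exact: measurable_funeneg.
Qed.

Lemma Rintegral_prod1 F : numu.-integrable setT (EFin \o F) ->
  \int[nu]_x \int[mu]_y F (x, y) = \int[numu]_z F z.
Proof.
move=> iF; congr fine; rewrite -(integral12_prod_meas1 iF).
apply: ae_eq_integral => //.
- apply/measurable_EFinP; apply: measurable_Rintegral_r.
  by move/(measurable_int _) : iF => /measurable_EFinP.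
- exact: (measurable_fubini_F iF).
(* Only almost every section is integrable; on the others [fine] may alter the inner integral. *)
- have := ae_integrable1 iF.
  by apply: filterS => x iFx _; rewrite fineK//; exact: integrable_fin_num iFx.
Qed.

Lemma Rintegral_prod2 F : numu.-integrable setT (EFin \o F) ->
  \int[mu]_y \int[nu]_x F (x, y) = \int[numu]_z F z.
Proof.
move=> iF; congr fine; rewrite -(integral21_prod_meas1 iF).
apply: ae_eq_integral => //.
- apply/measurable_EFinP; apply: measurable_Rintegral_l.
  by move/(measurable_int _) : iF => /measurable_EFinP.
- exact: (measurable_fubini_G iF).
- have := ae_integrable2 iF.
  by apply: filterS => y iFy _; rewrite fineK//; exact: integrable_fin_num iFy.
Qed.

Definition tensor (u : S -> R) (v : T -> R) : S * T -> R :=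
  fun z => u z.1 * v z.2.

Lemma measurable_tensor u v : measurable_fun setT u -> measurable_fun setT v ->
  measurable_fun setT (tensor u v).
Proof.
move=> mu_ mv; apply: measurable_funM.
  exact: (measurableT_comp mu_ measurable_fst).
exact: (measurableT_comp mv measurable_snd).
Qed.

Lemma integrable_tensor u v : nu.-integrable setT (EFin \o u) ->
  mu.-integrable setT (EFin \o v) ->
  numu.-integrable setT (EFin \o tensor u v).
Proof.
move=> iu iv; apply/integrable12ltyP.
  by apply/measurable_EFinP; exact: measurable_tensor (integrable_meas iu) (integrable_meas iv).
have [miu fiu] := integrableP _ _ _ iu.
have [miv fiv] := integrableP _ _ _ iv.
have mabs d (X : measurableType d) (f : X -> R) : measurable_fun setT (EFin \o f) ->
    measurable_fun setT (fun x => `|f x|%:E).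
  by move=> /measurable_EFinP mf; apply/measurable_EFinP; exact: measurableT_comp.
under eq_integral => x _.
  under eq_integral => y _ do rewrite /= /tensor normrM EFinM/=.
  rewrite ge0_integralZl//; last exact: mabs.
  over.
rewrite ge0_integralZr//; last 2 first.
- exact: mabs.
- exact: integral_ge0.
apply: lte_mul_pinfty => //; first exact: integral_ge0.
rewrite ge0_fin_numE//; exact: integral_ge0.
Qed.

Lemma Rintegral_tensor u v : nu.-integrable setT (EFin \o u) ->
  mu.-integrable setT (EFin \o v) ->
  \int[numu]_z tensor u v z = (\int[nu]_x u x) * (\int[mu]_y v y).
Proof.
move=> iu iv; rewrite -Rintegral_prod1; last exact: integrable_tensor.
rewrite -RintegralZr//; apply: eq_Rintegral => x _.
by rewrite -RintegralZl.
Qed.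

(** Fubini for [K] times [tensor u v], integrable because [K] is bounded. The two variables range
    over different spaces so that a pair of points can play the role of the first one in
    [hat_reproducing]. *)
Lemma multiplication_formula (K : S * T -> R) (M : R) u v :
  measurable_fun setT K -> (forall z, `|K z| <= M) ->
  nu.-integrable setT (EFin \o u) -> mu.-integrable setT (EFin \o v) ->
  \int[mu]_y (v y * \int[nu]_x (u x * K (x, y))) =
  \int[nu]_x (u x * \int[mu]_y (v y * K (x, y))).
Proof.
move=> mK KM iu iv.
have iF : numu.-integrable setT (EFin \o (fun z => K z * tensor u v z)).
  by apply: integrableM_bounded KM _ => //; exact: integrable_tensor.
have iK1 x : mu.-integrable setT (EFin \o (fun y => v y * K (x, y))).
  rewrite (_ : _ \o _ = EFin \o (fun y => K (x, y) * v y)); last first.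
    by apply/funext => y /=; rewrite mulrC.
  by apply: integrableM_bounded (fun y => KM (x, y)) iv; exact: measurableT_comp.
have iK2 y : nu.-integrable setT (EFin \o (fun x => u x * K (x, y))).
  rewrite (_ : _ \o _ = EFin \o (fun x => K (x, y) * u x)); last first.
    by apply/funext => x /=; rewrite mulrC.
  by apply: integrableM_bounded (fun x => KM (x, y)) iu; exact: measurableT_comp.
transitivity (\int[mu]_y \int[nu]_x (K (x, y) * tensor u v (x, y))).
  apply: eq_Rintegral => y _; rewrite -RintegralZl//.
  by apply: eq_Rintegral => x _; rewrite /tensor/=; ring.
rewrite (Rintegral_prod2 iF) -(Rintegral_prod1 iF).
apply: eq_Rintegral => x _; rewrite -RintegralZl//.
by apply: eq_Rintegral => y _; rewrite /tensor/=; ring.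
Qed.

End real_Fubini.

Section sigma_finite_product.
Context d1 d2 (S : measurableType d1) (T : measurableType d2) (R : realType).
Variables (nu : {sigma_finite_measure set S -> \bar R})
  (mu : {sigma_finite_measure set T -> \bar R}).

Lemma sigma_finite_product : sigma_finite setT (nu \x mu)%E.
Proof.
have /sigma_finiteP[F [TF ndF Foo]] := sigma_finiteT nu.
have /sigma_finiteP[G [TG ndG Goo]] := sigma_finiteT mu.
exists (fun n => F n `*` G n).
  rewrite -setXTT TF TG predeqE => -[x y]; split; last first.
    by move=> [n _ []/= ? ?]; split; exists n.
  move=> [/= [n _ Fnx] [k _ Gky]]; exists (maxn n k) => //; split.
  - by move: x Fnx; exact/subsetPset/ndF/leq_maxl.
  - by move: y Gky; exact/subsetPset/ndG/leq_maxr.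
move=> k; have [? ?] := Foo k; have [? ?] := Goo k.
split; first exact: measurableX.
by rewrite product_measure1E// lte_mul_pinfty// ge0_fin_numE.
Qed.

(* The library's canonical [sigma_finite_measure] structure on [\x] covers
   subprobability factors only. *)
Definition sfprod : {sigma_finite_measure set (S * T)%type -> \bar R} :=
  HB.pack_for {sigma_finite_measure set (S * T)%type -> \bar R} (nu \x mu)%E
   (@Measure_isSigmaFinite.Build _ _ _ (nu \x mu)%E sigma_finite_product).

End sigma_finite_product.

Section tensor_L2.
Context d1 d2 (S : measurableType d1) (T : measurableType d2) (R : realType).
Variables (nu : {sigma_finite_measure set S -> \bar R})
  (mu : {sigma_finite_measure set T -> \bar R}).
Local Notation L2 m := (Lfun m 2%:E).
Local Notation numu := (nu \x mu)%E.

Lemma tensor_L2 (u : S -> R) (v : T -> R) : u \in L2 nu -> v \in L2 mu ->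
  tensor u v \in L2 numu.
Proof.
move=> /L2P[mu_ iu] /L2P[mv iv]; apply/L2P; split; first exact: measurable_tensor.
rewrite (_ : _ \o _ = EFin \o tensor (fun x => u x ^+ 2) (fun x => v x ^+ 2)).
  exact: integrable_tensor.
by apply/funext => z; rewrite /= /tensor exprMn.
Qed.

Lemma ip_tensor u u' v v' : u \in L2 nu -> u' \in L2 nu ->
  v \in L2 mu -> v' \in L2 mu ->
  ip numu (tensor u v) (tensor u' v') = ip nu u u' * ip mu v v'.
Proof.
move=> u2 u2' v2 v2'; rewrite -Rintegral_tensor; try exact: integrable_L2M.
by apply: eq_Rintegral => z _; rewrite /tensor; ring.
Qed.

Lemma L2cvg_tensor (u_ : (S -> R)^nat) (v_ : (T -> R)^nat) u v :
  (forall n, u_ n \in L2 nu) -> (forall n, v_ n \in L2 mu) ->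
  u \in L2 nu -> v \in L2 mu -> L2cvg nu u_ u -> L2cvg mu v_ v ->
  L2cvg numu (fun n => tensor (u_ n) (v_ n)) (tensor u v).
Proof.
move=> u_2 v_2 u2 v2 uu vv.
(* The squared distance expands into products of one-variable inner products, whose limits
   cancel. *)
rewrite /L2cvg (_ : (fun n => _) = (fun n => ip nu (u_ n) (u_ n) * ip mu (v_ n) (v_ n)
  - 2 * (ip nu (u_ n) u * ip mu (v_ n) v) + ip nu u u * ip mu v v)); last first.
  apply/funext => n.
  have t1 := tensor_L2 (u_2 n) (v_2 n); have t2 := tensor_L2 u2 v2.
  have t3 := L2B t1 t2.
  rewrite ipBl// !ipBr// !ip_tensor// (ip_C nu u (u_ n)) (ip_C mu v (v_ n)).
  ring.
rewrite -[X in _ --> X](_ : ip nu u u * ip mu v v - 2 * (ip nu u u * ip mu v v)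
  + ip nu u u * ip mu v v = _); last by ring.
apply: cvgD; last exact: cvg_cst.
apply: cvgB; [|apply: cvgM; first exact: cvg_cst].
  by apply: cvgM; exact: L2cvg_norm.
by apply: cvgM; exact: L2cvg_ip.
Qed.

End tensor_L2.

(** * Integral transforms with contractive kernels *)

Section transform.
Context d (T : measurableType d) (R : realType).
Variable mu : {sigma_finite_measure set T -> \bar R}.
Implicit Types (f g h u : T -> R) (c : T -> T -> R).

Local Notation int f := (mu.-integrable setT (EFin \o f)).
Local Notation L2 := (Lfun mu 2%:E).
Local Notation L1 := (Lfun mu 1%:E).
Local Notation mumu := (mu \x mu)%E.

Definition hat c u : T -> R := fun y => \int[mu]_x (u x * c x y).

Record bounded_symmetric_kernel c : Prop := BoundedSymmetricKernel {
  ker_meas : measurable_fun setT (fun z : T * T => c z.1 z.2) ;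
  ker_sym : forall x y, c x y = c y x ;
  ker_bounded : exists M, forall x y, `|c x y| <= M }.

Record contractive_kernel c : Prop := ContractiveKernel {
  ker_bs :> bounded_symmetric_kernel c ;
  ker_contract : forall u, u \in L1 -> u \in L2 ->
    hat c u \in L2 /\ ip mu (hat c u) (hat c u) <= ip mu u u }.

Lemma ker_measx c x : bounded_symmetric_kernel c -> measurable_fun setT (c x).
Proof.
move=> ck; have mz : measurable_fun setT (fun y : T => (x, y)).
  exact: measurable_fun_pair.
exact: (measurableT_comp (ker_meas ck) mz).
Qed.

Lemma ker_measy c y : bounded_symmetric_kernel c ->
  measurable_fun setT (c ^~ y).
Proof.
move=> ck; rewrite (_ : c^~ y = c y); first exact: ker_measx.
by apply/funext => x; rewrite (ker_sym ck).
Qed.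

Lemma integrable_hat c u y : bounded_symmetric_kernel c -> u \in L1 ->
  int (fun x => u x * c x y).
Proof.
move=> ck /L1P iu; have [M cM] := ker_bounded ck.
rewrite (_ : _ \o _ = EFin \o (fun x => c x y * u x)); last first.
  by apply/funext => x /=; rewrite mulrC.
by apply: integrableM_bounded iu => //; exact: ker_measy.
Qed.

Lemma measurable_hat c u : bounded_symmetric_kernel c -> measurable_fun setT u ->
  measurable_fun setT (hat c u).
Proof.
move=> ck mu_; apply: (@measurable_Rintegral_l _ _ _ _ _ mu (fun z => u z.1 * c z.1 z.2)).
apply: measurable_funM; last exact: ker_meas.
exact: (measurableT_comp mu_ measurable_fst).
Qed.

Lemma hatB c u v y : bounded_symmetric_kernel c -> u \in L1 -> v \in L1 ->
  hat c (fun x => u x - v x) y = hat c u y - hat c v y.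
Proof.
move=> ck u1 v1; rewrite -RintegralB//; try exact: integrable_hat.
by apply: eq_Rintegral => x _; rewrite mulrBl.
Qed.

(* The kernel is contractive as soon as it admits positive approximations of
   the identity [P n], the reproducing kernels of summability factors [e n]. *)
Section approximation.
Variables (c : T -> T -> R) (e : (T -> R)^nat).
Hypothesis ck : bounded_symmetric_kernel c.
Hypothesis e_int : forall n, int (e n).
Hypothesis e_ge0 : forall n x, 0 <= e n x.
Hypothesis e_nd : forall x, nondecreasing_seq (e ^~ x).
Hypothesis e_cvg : forall x, e n x @[n --> \oo] --> (1 : R).

Definition reproducing n x x' := \int[mu]_y (e n y * (c x y * c x' y)).
Local Notation P := reproducing.

Hypothesis P_ge0 : forall n x x', 0 <= P n x x'.
Hypothesis P_le1 : forall n x, (\int[mu]_x' (P n x x')%:E <= 1)%E.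

Let cc_meas : measurable_fun setT
  (fun w : (T * T) * T => c w.1.1 w.2 * c w.1.2 w.2).
Proof.
have m2 : measurable_fun setT (fun w : (T * T) * T => w.2) by exact: measurable_snd.
have m1 : measurable_fun setT (fun w : (T * T) * T => w.1) by exact: measurable_fst.
apply: measurable_funM.
- apply: (measurableT_comp (ker_meas ck) (measurable_fun_pair _ m2)).
  exact: (measurableT_comp measurable_fst m1).
- apply: (measurableT_comp (ker_meas ck) (measurable_fun_pair _ m2)).
  exact: (measurableT_comp measurable_snd m1).
Qed.

Let cc_bounded : exists M, forall w : (T * T) * T,
  `|c w.1.1 w.2 * c w.1.2 w.2| <= M.
Proof.
have [M cM] := ker_bounded ck; exists (M * M) => w.
by rewrite normrM ler_pM.
Qed.

Lemma measurable_reproducing n : measurable_fun setT (fun z : T * T => P n z.1 z.2).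
Proof.
apply: (@measurable_Rintegral_r _ _ _ _ _ mu
  (fun w : (T * T) * T => e n w.2 * (c w.1.1 w.2 * c w.1.2 w.2))).
apply: measurable_funM => //.
by apply: measurableT_comp; [exact: integrable_meas (e_int n)|exact: measurable_snd].
Qed.

(** Writing [hat c u y * hat c v y] as one integral over pairs turns the claim into the
    multiplication formula between [mu \x mu] and [mu], for the kernel [c x y * c x' y]. *)
Lemma hat_reproducing n u v : u \in L1 -> v \in L1 ->
  \int[mu]_y (e n y * (hat c u y * hat c v y)) =
  \int[mumu]_z (tensor u v z * P n z.1 z.2).
Proof.
move=> u1 v1; have [M ccM] := cc_bounded.
have iu := (L1P mu u).1 u1; have iv := (L1P mu v).1 v1.
have K := @multiplication_formula _ _ _ _ _ (sfprod mu mu) mu _ _ (tensor u v) (e n)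
  cc_meas ccM (integrable_tensor iu iv) (e_int n).
apply: etrans K; apply: eq_Rintegral => y _; congr (_ * _).
rewrite -Rintegral_tensor; try exact: integrable_hat.
by apply: eq_Rintegral => z _; rewrite /tensor/=; ring.
Qed.

(** Tonelli and the mass bound [P_le1]; this is one half of the Schur test in
    [hat_regularized_le]. *)
Lemma integrable_reproducing n u : u \in L2 ->
  mumu.-integrable setT (EFin \o (fun z => u z.1 ^+ 2 * P n z.1 z.2)) /\
  \int[mumu]_z (u z.1 ^+ 2 * P n z.1 z.2) <= ip mu u u.
Proof.
move=> /L2P[mu_ iu].
have mz1 : measurable_fun setT (fun z : T * T => u z.1 ^+ 2).
  apply: measurable_funX; exact: (measurableT_comp mu_ measurable_fst).
have mF : measurable_fun setT (fun z : T * T => u z.1 ^+ 2 * P n z.1 z.2).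
  by apply: measurable_funM => //; exact: measurable_reproducing.
have F0 z : 0 <= u z.1 ^+ 2 * P n z.1 z.2 by rewrite mulr_ge0 ?sqr_ge0.
have mP x : measurable_fun setT (fun y => (P n x y)%:E).
  apply/measurable_EFinP; have mz : measurable_fun setT (fun y : T => (x, y)).
    exact: measurable_fun_pair.
  exact: (measurableT_comp (measurable_reproducing n) mz).
have le : (\int[mumu]_z (u z.1 ^+ 2 * P n z.1 z.2)%:E <= \int[mu]_x (u x ^+ 2)%:E)%E.
  rewrite fubini_tonelli1//; last exact/measurable_EFinP.
  apply: ge0_le_integral => //.
  - by move=> x _; apply: integral_ge0 => y _; rewrite lee_fin; exact: (F0 (x, y)).
  - apply: (measurable_fun_fubini_tonelli_F (EFin \o (fun z => u z.1 ^+ 2 * P n z.1 z.2))) => //.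
    exact/measurable_EFinP.
  - by apply/measurable_EFinP; exact: measurable_funX.
  - move=> x _; rewrite /fubini_F/=; under eq_integral do rewrite EFinM.
    rewrite ge0_integralZl//.
    + by rewrite -[leRHS]mule1 lee_pmul// ?lee_fin ?sqr_ge0// integral_ge0// => y _; rewrite lee_fin.
    + by move=> y _; rewrite lee_fin.
    + by rewrite lee_fin sqr_ge0.
have iu' : (\int[mu]_x (u x ^+ 2)%:E < +oo)%E by exact: integrable_lty.
have iF : mumu.-integrable setT (EFin \o (fun z => u z.1 ^+ 2 * P n z.1 z.2)).
  apply/integrableP; split; first exact/measurable_EFinP.
  under eq_integral do rewrite /= ger0_norm//.
  exact: le_lt_trans iu'.
split=> //; rewrite -lee_fin /ip /Rintegral !fineK.
- by apply: (le_trans le); rewrite le_eqVlt; apply/orP; left; apply/eqP; apply: eq_integral => x _; rewrite expr2.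
- by under eq_integral do rewrite -expr2; exact: integrable_fin_num.
- exact: integrable_fin_num.
Qed.

(** Schur test: [P n] is nonnegative and [|u x * u x'|] is at most half of [u x ^+ 2 + u x' ^+ 2];
    by the symmetry of [P n] both squares contribute the same amount. *)
Lemma hat_regularized_le n u : u \in L1 -> u \in L2 ->
  \int[mu]_y (e n y * (hat c u y * hat c u y)) <= ip mu u u.
Proof.
move=> u1 u2; rewrite hat_reproducing//.
have [iF Fle] := integrable_reproducing n u2.
have iF' : mumu.-integrable setT (EFin \o (fun z => u z.2 ^+ 2 * P n z.1 z.2)) /\
  \int[mumu]_z (u z.2 ^+ 2 * P n z.1 z.2) = \int[mumu]_z (u z.1 ^+ 2 * P n z.1 z.2).
  have Psym x y : P n x y = P n y x by apply: eq_Rintegral => z _; rewrite (mulrC (c x z)).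
  have iG : mumu.-integrable setT (EFin \o (fun z => u z.2 ^+ 2 * P n z.1 z.2)).
    have [mF lF] := integrableP _ _ _ iF.
    have mG : measurable_fun setT (EFin \o (fun z => u z.2 ^+ 2 * P n z.1 z.2)).
      rewrite (_ : _ \o _ = (EFin \o (fun z => u z.1 ^+ 2 * P n z.1 z.2)) \o (fun z => (z.2, z.1))).
        by apply: (measurableT_comp mF); apply: measurable_fun_pair.
      by apply/funext => -[x y] /=; rewrite Psym.
    apply/integrable21ltyP => //.
    have lt := (integrable12ltyP mu mu mF).1 iF.
    apply: le_lt_trans lt; rewrite le_eqVlt; apply/orP; left; apply/eqP.
    apply: eq_integral => x _; apply: eq_integral => y _.
    by rewrite /= Psym.
  split => //; rewrite -(Rintegral_prod2 iG) -(Rintegral_prod1 iF).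
  by apply: eq_Rintegral => x _; apply: eq_Rintegral => y _; rewrite /= Psym.
case: iF' => iG GE.
pose H (z : T * T) := 2^-1 * (u z.1 ^+ 2 * P n z.1 z.2 + u z.2 ^+ 2 * P n z.1 z.2).
have iH : mumu.-integrable setT (EFin \o H).
  by apply: integrableZl_EFin; exact: integrableD_EFin.
apply: (@le_trans _ _ (\int[mumu]_z H z)); last first.
  rewrite RintegralZl//; last exact: integrableD_EFin.
  by rewrite RintegralD// GE; lra.
have iT := @integrable_tensor _ _ _ _ _ mu mu u u ((L1P mu u).1 u1) ((L1P mu u).1 u1).
have uuH z : `|tensor u u z * P n z.1 z.2| <= H z.
  rewrite normrM (ger0_norm (P_ge0 _ _ _)) /H -mulrDl mulrA ler_wpM2r// /tensor.
  rewrite ler_norml; have h1 := sqr_ge0 (u z.1 + u z.2); have h2 := sqr_ge0 (u z.1 - u z.2).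
  by apply/andP; split; [move: h1|move: h2]; rewrite ?sqrrD ?sqrrB; set a := u _; set b := u _; nra.
apply: le_Rintegral => //.
- apply: (le_integrable_EFin _ uuH iH).
  apply: measurable_funM; last exact: measurable_reproducing.
  by apply: measurable_tensor; exact: L2_meas u2.
- by move=> z _; rewrite (le_trans (ler_norm _)).
Qed.

(** The regularized bounds pass to the limit by monotone convergence, since [e n] increases to 1. *)
Lemma contractive_of_approximation : contractive_kernel c.
Proof.
split=> // u u1 u2.
have mh : measurable_fun setT (hat c u) by apply: measurable_hat => //; exact: L2_meas u2.
have [M cM] := ker_bounded ck.
have M0 : 0 <= M by rewrite (le_trans _ (cM point point)).
(* A crude bound by the L1 norm of [u], which makes each damped square integrable before any L2
   bound is known. *)
have hb y : `|hat c u y| <= M * \int[mu]_x `|u x|.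
  have iu := (L1P mu u).1 u1.
  apply: (le_trans (le_normr_Rintegral _ (integrable_hat y ck u1))) => //.
  rewrite -RintegralZl//; last exact: integrable_norm.
  apply: le_Rintegral => //.
  - exact: (integrable_norm (integrable_hat y ck u1)).
  - by apply: integrableZl_EFin; exact: integrable_norm.
  - by move=> x _; rewrite normrM mulrC ler_wpM2r.
have ih n : int (fun y => e n y * (hat c u y * hat c u y)).
  rewrite (_ : _ \o _ = EFin \o (fun y => (hat c u y * hat c u y) * e n y)).
    apply: (@integrableM_bounded _ _ _ _ _ _
      ((M * \int[mu]_x `|u x|) * (M * \int[mu]_x `|u x|))) => //.
    - exact: measurable_funM.
    - by move=> y; rewrite normrM ler_pM.
  by apply/funext => y /=; rewrite mulrC.
have le : (\int[mu]_y (hat c u y ^+ 2)%:E <= (ip mu u u)%:E)%E.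
  have cvge : (fun n => \int[mu]_y (e n y * (hat c u y * hat c u y))%:E)%E @ \oo
      --> (\int[mu]_y (hat c u y ^+ 2)%:E)%E.
    have hE y : (hat c u y ^+ 2)%:E = limn (fun n => (e n y * (hat c u y * hat c u y))%:E).
      apply/esym/cvg_lim => //; apply: cvg_EFin; first exact: nearW.
      rewrite -[X in _ --> X]mul1r expr2.
      by apply: cvgM; [exact: e_cvg|exact: cvg_cst].
    under [X in _ --> X]eq_integral do rewrite hE.
    apply: cvg_monotone_convergence => //.
    - by move=> n; exact: (measurable_int mu (ih n)).
    - by move=> n y _; rewrite lee_fin mulr_ge0// -expr2 sqr_ge0.
    - move=> y _ m n mn; rewrite lee_fin ler_wpM2r ?e_nd//.
      by rewrite -expr2 sqr_ge0.
  apply: (cvge_to_le cvge); apply: nearW => n.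
  rewrite -[leLHS]fineK; last exact: integrable_fin_num (ih n).
  by rewrite lee_fin; exact: hat_regularized_le.
have ih2 : int (fun y => hat c u y ^+ 2).
  apply/integrableP; split; first by apply/measurable_EFinP; exact: measurable_funX.
  under eq_integral do rewrite /= ger0_norm ?sqr_ge0//.
  by rewrite (le_lt_trans le)// ltry.
split; first exact/L2P.
rewrite -lee_fin; apply: le_trans le; rewrite /ip /Rintegral.
under eq_integral do rewrite -expr2.
by rewrite fineK//; exact: integrable_fin_num.
Qed.

End approximation.

End transform.

Section extension.
Context d (T : measurableType d) (R : realType).
Variable mu : {sigma_finite_measure set T -> \bar R}.
Variable c : T -> T -> R.
Hypothesis cK : contractive_kernel mu c.
Implicit Types (f g h k u : T -> R).

Local Notation int f := (mu.-integrable setT (EFin \o f)).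
Local Notation L2 := (Lfun mu 2%:E).
Local Notation L1 := (Lfun mu 1%:E).
Local Notation hat := (hat mu c).

(* [k] is the image of [h] under the continuous extension of [hat] to L2. *)
Definition is_transform h k := [/\ h \in L2, k \in L2 &
  forall p, p \in L1 -> p \in L2 -> ip mu k p = ip mu h (hat p)].

Lemma hat_L2 u : u \in L1 -> u \in L2 -> hat u \in L2.
Proof. by move=> u1 u2; have [] := ker_contract cK u1 u2. Qed.

Lemma is_transform_hat u : u \in L1 -> u \in L2 -> is_transform u (hat u).
Proof.
move=> u1 u2; split => //; first exact: hat_L2.
move=> p p1 p2; have [M cM] := ker_bounded cK.
rewrite ip_C.
have := @multiplication_formula _ _ _ _ _ mu mu _ _ u p (ker_meas cK)
  (fun z => cM z.1 z.2) ((L1P mu u).1 u1) ((L1P mu p).1 p1).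
move=> E; apply: (etrans E); apply: eq_Rintegral => x _; congr (_ * _).
by apply: eq_Rintegral => y _; rewrite (ker_sym cK).
Qed.

(** Both sides of the pairing that defines [is_transform] are continuous for L2 convergence. *)
Lemma is_transform_lim (u v : (T -> R)^nat) h k :
  (forall n, is_transform (u n) (v n)) -> h \in L2 -> k \in L2 ->
  L2cvg mu u h -> L2cvg mu v k -> is_transform h k.
Proof.
move=> uv h2 k2 uh vk; split => // p p1 p2.
have u2 n : u n \in L2 by case: (uv n).
have v2 n : v n \in L2 by case: (uv n).
have h1 := L2cvg_ip v2 k2 p2 vk.
have h3 := L2cvg_ip u2 h2 (hat_L2 p1 p2) uh.
have E : (fun n => ip mu (v n) p) = (fun n => ip mu (u n) (hat p)).
  by apply/funext => n; case: (uv n) => _ _; exact.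
by rewrite E in h1; exact: (cvg_unique _ h1 h3).
Qed.

(** By contractivity, [hat] along well-chosen truncations of [h] is a fast Cauchy sequence; its
    limit is the transform. *)
Lemma is_transform_exists h : h \in L2 -> exists k, is_transform h k.
Proof.
move=> h2.
have tlim := L2cvg_trunc h2.
(* Squared errors [8^-k] beat the weight [4^k] of [L2_complete]: successive differences have squared
   norm at most [(2 + 1/4) / 8^k], which after weighting is [(2 + 1/4) / 2^k <= 8 / 2^(k+1)]. *)
have /choice[N HN] : forall k : nat, exists n : nat,
    ip mu (fun x => trunc h n x - h x) (fun x => trunc h n x - h x) <= (8 ^+ k)^-1.
  move=> k; have e0 : 0 < (8 ^+ k)^-1 :> R by rewrite invr_gt0 exprn_gt0.
  have [n _ Hn] := cvgr_le _ tlim _ e0; exists n; exact: Hn (leqnn n).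
pose t (i : nat) := trunc h (N i).
have t1 i : t i \in L1 by exact: trunc_L1.
have t2 i : t i \in L2 by exact: trunc_L2.
have th2 i := L2B (t2 i) h2.
have ht2 i := hat_L2 (t1 i) (t2 i).
have [k k2 kl] : exists2 k, k \in L2 & L2cvg mu (fun n => hat (t n)) k.
  apply: (@L2_complete _ _ _ _ (fun n => hat (t n)) 8) => // i.
  have dE : (fun x => hat (t i.+1) x - hat (t i) x) = hat (fun x => t i.+1 x - t i x).
    by apply/funext => y; rewrite (hatB y (ker_bs cK) (t1 i.+1) (t1 i)).
  have d1 : (fun x => t i.+1 x - t i x) \in L1.
    by apply/L1P; apply: integrableB_EFin; exact/L1P.
  have d2 := L2B (t2 i.+1) (t2 i).
  have [_ le] := ker_contract cK d1 d2.
  rewrite dE.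
  have le2 : ip mu (fun x => t i.+1 x - t i x) (fun x => t i.+1 x - t i x) <=
      2 * (8 ^+ i.+1)^-1 + 2 * (8 ^+ i)^-1.
    have := ipD_le (th2 i.+1) (L2N (th2 i)).
    rewrite (_ : (fun x => _ + _) = (fun x => t i.+1 x - t i x)); last first.
      by apply/funext => x; ring.
    rewrite ipNl// ?L2N// ip_C ipNl ?L2N// opprK => /le_trans; apply.
    by rewrite lerD// ler_wpM2l// HN.
  apply: (@le_trans _ _ (4 ^+ i * (2 * (8 ^+ i.+1)^-1 + 2 * (8 ^+ i)^-1))).
    by rewrite ler_wpM2l ?exprn_ge0// (le_trans le).
  rewrite natrX exprS (_ : 8 ^+ i = 4 ^+ i * 2 ^+ i); last first.
    by rewrite -exprMn; congr (_ ^+ _); ring.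
  rewrite [in leRHS]exprS.
  have : 0 < 4 ^+ i :> R by rewrite exprn_gt0.
  have : 0 < 2 ^+ i :> R by rewrite exprn_gt0.
  set a := 4 ^+ i; set b := 2 ^+ i => b0 a0.
  have -> : a * (2 * (8 * (a * b))^-1 + 2 * (a * b)^-1) = (2 + 4^-1) / b.
    by field; rewrite !gt_eqF.
  have -> : 8 / (2 * b) = 4 / b by field; rewrite gt_eqF.
  by rewrite ler_wpM2r ?invr_ge0 ?ltW//; lra.
exists k; apply: (@is_transform_lim t (fun n => hat (t n))) => //.
  by move=> n; exact: is_transform_hat.
apply: (@squeeze_cvgr _ _ _ _ (cst 0) (fun i : nat => 8^-1 ^+ i)).
- by apply: nearW => n; rewrite ip_ge0/= exprVn HN.
- exact: cvg_cst.
- by apply: cvg_expr; rewrite ger0_norm// invf_lt1 ?ltr1n.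
Qed.

Lemma is_transformB h h' k k' : is_transform h k -> is_transform h' k' ->
  is_transform (fun x => h x - h' x) (fun x => k x - k' x).
Proof.
move=> [h2 k2 hk] [h2' k2' hk']; split; [exact: L2B|exact: L2B|move=> p p1 p2].
by rewrite !ipBl ?hat_L2// hk// hk'.
Qed.

Lemma is_transformD h h' k k' : is_transform h k -> is_transform h' k' ->
  is_transform (fun x => h x + h' x) (fun x => k x + k' x).
Proof.
move=> [h2 k2 hk] [h2' k2' hk']; split; [exact: L2D|exact: L2D|move=> p p1 p2].
by rewrite !ipDl ?hat_L2// hk// hk'.
Qed.

Lemma is_transformZ (a : R) h k : is_transform h k ->
  is_transform (fun x => a * h x) (fun x => a * k x).
Proof.
move=> [h2 k2 hk]; split; [exact: L2Z|exact: L2Z|move=> p p1 p2].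
by rewrite !ipZl ?hat_L2// hk.
Qed.

Lemma is_transform_ae h h' k k' : is_transform h k ->
  measurable_fun setT h' -> measurable_fun setT k' ->
  {ae mu, forall x, h x = h' x} -> {ae mu, forall x, k x = k' x} ->
  is_transform h' k'.
Proof.
move=> [h2 k2 hk] mh' mk' hh kk.
have h2' := ae_L2 h2 mh' hh; have k2' := ae_L2 k2 mk' kk.
split => // p p1 p2; have hp2 := hat_L2 p1 p2.
rewrite -(ip_ae k2 k2' p2 p2 kk (aeW _ (fun=> erefl))) hk//.
exact: ip_ae (aeW _ (fun=> erefl)).
Qed.

(** Duality: for a truncation [p] of [k] one has [<p, p> = <k, p> = <h, hat p>], and by
    Cauchy-Schwarz and contractivity the square of this is at most [<h, h> <p, p>]. Dividing gives
    [<p, p> <= <h, h>], and [p] tends to [k]. *)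
Lemma is_transform_le h k : is_transform h k -> ip mu k k <= ip mu h h.
Proof.
move=> [h2 k2 hk].
have kt2 n := trunc_L2 n k2; have kt1 n := trunc_L1 n k2.
apply: (cvgr_to_le (L2cvg_norm kt2 k2 (L2cvg_trunc k2))); apply: nearW => n.
set p := trunc k n.
have kp : ip mu k p = ip mu p p.
  apply: eq_Rintegral => x _; rewrite /p /trunc.
  by case: ifPn => // _; rewrite !mulr0.
have [hp2 le] := ker_contract cK (kt1 n) (kt2 n).
have cs := cauchy_schwarz h2 hp2.
rewrite -(hk p (kt1 n) (kt2 n)) kp in cs.
have p0 := ip_ge0 mu p.
have [->|pn0] := eqVneq (ip mu p p) 0; first exact: ip_ge0.
have p_gt0 : 0 < ip mu p p by rewrite lt_neqAle eq_sym pn0.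
rewrite -(ler_pM2r p_gt0) -expr2 (le_trans cs)// ler_wpM2l ?ip_ge0//.
Qed.

Lemma is_transform_unique h h' k k' : is_transform h k -> is_transform h' k' ->
  {ae mu, forall x, h x = h' x} -> {ae mu, forall x, k x = k' x}.
Proof.
move=> hk hk' hh; have D := is_transformB hk hk'.
have [Dh2 Dk2 _] := D.
have z2 : (fun=> 0 : R) \in L2.
  apply/L2P; split => //; rewrite (_ : _ \o _ = cst 0%E) ?integrable0//.
  by apply/funext => x /=; rewrite expr0n.
have h0 : ip mu (fun x => h x - h' x) (fun x => h x - h' x) = 0.
  have hz : {ae mu, forall x, h x - h' x = 0}.
    by apply: filterS hh => x ->; rewrite subrr.
  rewrite (ip_ae Dh2 z2 Dh2 z2 hz hz) /ip.
  by under eq_Rintegral do rewrite mulr0; rewrite Rintegral_cst// mul0r.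
have k0 : ip mu (fun x => k x - k' x) (fun x => k x - k' x) = 0.
  by apply/eqP; rewrite eq_le ip_ge0 andbT -h0; exact: is_transform_le.
apply: filterS (ip_eq0 Dk2 k0) => x /eqP; rewrite subr_eq0 => /eqP //.
Qed.

Lemma is_transform_cvg (u v : (T -> R)^nat) h k :
  (forall n, is_transform (u n) (v n)) -> is_transform h k ->
  L2cvg mu u h -> L2cvg mu v k.
Proof.
move=> uv hk uh; apply: (@squeeze_cvgr _ _ _ _ (cst 0) (fun n =>
  ip mu (fun x => u n x - h x) (fun x => u n x - h x))) => //.
- by apply: nearW => n; rewrite ip_ge0/=; exact: is_transform_le (is_transformB (uv n) hk).
- exact: cvg_cst.
Qed.

(** The definition gives this when [h'] is in both L1 and L2; truncations of [h'] and continuity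
    extend it. *)
Lemma is_transform_sym h h' k k' : is_transform h k -> is_transform h' k' ->
  ip mu k h' = ip mu h k'.
Proof.
move=> hk hk'; have [h2 k2 hkp] := hk; have [h2' k2' _] := hk'.
have t2 n := trunc_L2 n h2'; have t1 n := trunc_L1 n h2'.
have tc := L2cvg_trunc h2'.
have ht2 n := hat_L2 (t1 n) (t2 n).
have hc : L2cvg mu (fun n => hat (trunc h' n)) k'.
  exact: is_transform_cvg (fun n => is_transform_hat (t1 n) (t2 n)) hk' tc.
have c1 := L2cvg_ip t2 h2' k2 tc.
have c2 := L2cvg_ip ht2 k2' h2 hc.
have E : (fun n => ip mu (trunc h' n) k) = (fun n => ip mu (hat (trunc h' n)) h).
  by apply/funext => n; rewrite ip_C hkp// ip_C.
rewrite E in c1.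
by rewrite ip_C (ip_C mu h); exact: (cvg_unique _ c1 c2).
Qed.

(** If [k] is sent to [h'], then for [b] in [B] with image [b'] symmetry gives
    [<h', b> = <k, b'> = <h, b>], and [B] separates functions. *)
Lemma is_transform_involutive (B : set (T -> R)) :
  (forall b, B b -> exists b', is_transform b b' /\ is_transform b' b) ->
  (forall f, f \in L2 -> (forall b, B b -> ip mu f b = 0) ->
    {ae mu, forall x, f x = 0}) ->
  forall h k, is_transform h k -> is_transform k h.
Proof.
move=> Binv Bsep h k hk; have [h2 k2 _] := hk.
have [h' kh'] := is_transform_exists k2; have [_ h2' _] := kh'.
apply: (is_transform_ae kh'); [exact: L2_meas k2|exact: L2_meas h2|exact: aeW|].
have : {ae mu, forall x, h' x - h x = 0}.
  apply: Bsep; first exact: L2B.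
  move=> b /Binv[b' [bb' b'b]]; have [b2 b'2 _] := bb'.
  rewrite ipBl//; apply/eqP; rewrite subr_eq0; apply/eqP.
  by rewrite (is_transform_sym kh' bb') (is_transform_sym hk b'b).
by apply: filterS => x /eqP; rewrite subr_eq0 => /eqP.
Qed.

End extension.

(** * The cas transform on the line *)

Section half_line.
Variable R : realType.
Local Notation leb := (@lebesgue_measure R).

Lemma integralT_half_lines (f : R -> R) : measurable_fun setT f ->
  (forall x, 0 <= f x) ->
  (\int[leb]_x (f x)%:E = \int[leb]_(x in `[0%R, +oo[) (f x)%:E +
    \int[leb]_(x in `[0%R, +oo[) (f (- x))%:E)%E.
Proof.
move=> mf f0.
have mfN : measurable_fun setT (fun x : R => f (- x)) by exact: measurableT_comp.
rewrite (@ge0_integration_by_substitution0 _ (fun x => (f (- x))%:E)); first last.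
- by move=> x; rewrite lee_fin.
- exact/measurable_EFinP.
under [X in (_ = _ + X)%E]eq_integral do rewrite opprK.
rewrite -integral_itv_bndo_bndc; last first.
  by apply/measurable_EFinP; exact: measurable_funTS.
rewrite -ge0_integral_setU//.
- congr integral; apply/seteqP; split => x //= _.
  by rewrite !in_itv/= andbT; case: (leP 0 x) => _; [left|right].
- by apply/measurable_EFinP; exact: measurable_funTS.
- by move=> x _; rewrite lee_fin.
- apply/disj_setPS => x [] /=; rewrite !in_itv/= andbT => x0.
  by rewrite ltNge x0.
Qed.

Lemma integral0y_FTC (f F : R -> R) (l : R) : (forall x, 0 <= x -> 0 <= f x) ->
  continuous f -> (forall x : R, is_derive x 1 F (f x)) -> F x @[x --> +oo] --> l ->
  (\int[leb]_(x in `[0%R, +oo[) (f x)%:E = (l - F 0)%:E)%E.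
Proof.
move=> f0 cf dF Fl; rewrite (ge0_continuous_FTC2y f0 _ Fl)//.
- exact: continuous_subspaceT.
- by apply: cvg_at_right_filter; apply: differentiable_continuous; apply/derivable1_diffP.
- by move=> x _; rewrite derive1E; exact: derive_val.
Qed.

(** The constant 2 keeps the integrand nonnegative, as [integral0y_FTC] requires; it is subtracted
    again in [Rintegral_damped_trig]. Cosine and sine have separate frequencies because a product of
    two cas has the form [cos (A - B) + sin (A + B)]. *)
Lemma damped_antiderivative (a b g : R) : 0 < a ->
  (\int[leb]_(y in `[0%R, +oo[)
     (expR (- (a * y)) * (2 + cos (b * y) + sin (g * y)))%:E
   = (2 / a + a / (a ^+ 2 + b ^+ 2) + g / (a ^+ 2 + g ^+ 2))%:E)%E.
Proof.
move=> a0.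
have an0 : a != 0 by rewrite gt_eqF.
have ab c : a ^+ 2 + c ^+ 2 != 0.
  by rewrite gt_eqF// ltr_pwDl// ?exprn_gt0// sqr_ge0.
pose F y := expR (- (a * y)) * (- (2 / a) +
  (b * sin (b * y) - a * cos (b * y)) / (a ^+ 2 + b ^+ 2) -
  (a * sin (g * y) + g * cos (g * y)) / (a ^+ 2 + g ^+ 2)).
pose f y := expR (- (a * y)) * (2 + cos (b * y) + sin (g * y)).
have f0 (x : R) : 0 <= x -> 0 <= f x.
  move=> _; rewrite mulr_ge0 ?expR_ge0//.
have cf : continuous f.
  move=> x; apply: differentiable_continuous; apply/derivable1_diffP.
  by rewrite /f; apply: ex_derive.
have dF (x : R) : is_derive x 1 F (f x).
  rewrite /F; apply: is_derive_eq.
  rewrite /GRing.scale /f /=.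
  by field; rewrite ?ab ?an0.
have Fl : F x @[x --> +oo] --> (0 : R).
  have el : expR (- (a * x)) @[x --> +oo] --> (0 : R).
    apply: (@cvg_comp _ _ _ (fun y => a * y) (fun y : R => expR (- y)) _ +oo).
      by apply: gt0_cvgMry => //; exact: cvg_id.
    exact: cvgr_expR.
  (* [C] bounds the second factor of [F] in absolute value, so the exponential squeezes [F] to 0. *)
  pose C : R := 2 / a + (`|b| + a) / (a ^+ 2 + b ^+ 2) + (a + `|g|) / (a ^+ 2 + g ^+ 2).
  apply: (@squeeze_cvgr _ _ _ _ (fun x => - (expR (- (a * x)) * C))
    (fun x => expR (- (a * x)) * C)).
  - apply: nearW => x; rewrite -ler_norml normrM ger0_norm ?expR_ge0//.
    rewrite ler_wpM2l ?expR_ge0//.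
    have ab0 c : 0 < a ^+ 2 + c ^+ 2 by rewrite ltr_pwDl// ?exprn_gt0// sqr_ge0.
    have ns y : `|sin y| <= 1 :> R by rewrite ler_norml sin_geN1 sin_le1.
    have nc y : `|cos y| <= 1 :> R by rewrite ler_norml cos_geN1 cos_le1.
    rewrite (le_trans (ler_normB _ _))//; apply: lerD.
      rewrite (le_trans (ler_normD _ _))//; apply: lerD.
        by rewrite normrN ger0_norm// divr_ge0// ltW.
      rewrite normrM normfV (gtr0_norm (ab0 b)) ler_wpM2r ?invr_ge0 ?(ltW (ab0 _))//.
      rewrite (le_trans (ler_normB _ _))// !normrM (gtr0_norm a0).
      by rewrite lerD// ler_piMr// (ltW a0).
    rewrite normrM normfV (gtr0_norm (ab0 g)) ler_wpM2r ?invr_ge0 ?(ltW (ab0 _))//.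
    rewrite (le_trans (ler_normD _ _))// !normrM (gtr0_norm a0).
    by rewrite lerD// ler_piMr// (ltW a0).
  - rewrite -[X in _ --> X]oppr0 -[X in _ --> - X](mul0r C).
    by apply: cvgN; apply: cvgM => //; exact: cvg_cst.
  - by rewrite -[X in _ --> X](mul0r C); apply: cvgM => //; exact: cvg_cst.
have -> := integral0y_FTC f0 cf dF Fl.
rewrite /F !mulr0 oppr0 expR0 sin0 cos0; congr EFin.
by field; rewrite !ab an0.
Qed.

Lemma measurable_damped_trig (a b g : R) :
  measurable_fun setT (fun y : R => expR (- (a * `|y|)) * (2 + cos (b * y) + sin (g * y))).
Proof.
apply: measurable_funM.
    apply: measurableT_comp => //; apply: measurableT_comp => //.
    by apply: measurable_funM => //; exact: measurableT_comp.
  apply: measurable_funD.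
    apply: measurable_funD => //; apply: continuous_measurable_fun => x.
    apply: continuous_comp; last exact: continuous_cos.
    by apply: cvgM; [exact: cvg_cst|exact: cvg_id].
  apply: continuous_measurable_fun => x.
  apply: continuous_comp; last exact: continuous_sin.
  by apply: cvgM; [exact: cvg_cst|exact: cvg_id].
Qed.

Lemma integral_damped_trig (a b g : R) : 0 < a ->
  (\int[leb]_y (expR (- (a * `|y|)) * (2 + cos (b * y) + sin (g * y)))%:E
   = (4 / a + 2 * a / (a ^+ 2 + b ^+ 2))%:E)%E.
Proof.
move=> a0.
have an0 : a != 0 by rewrite gt_eqF.
have ab c : a ^+ 2 + c ^+ 2 != 0.
  by rewrite gt_eqF// ltr_pwDl// ?exprn_gt0// sqr_ge0.
rewrite integralT_half_lines; first last.
- by move=> x; rewrite mulr_ge0 ?expR_ge0.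
- exact: measurable_damped_trig.
(* On the negative half-line the sine frequency changes sign, so the sine terms cancel in the
   sum. *)
transitivity (\int[leb]_(y in `[0%R, +oo[)
    (expR (- (a * y)) * (2 + cos (b * y) + sin (g * y)))%:E +
  \int[leb]_(y in `[0%R, +oo[)
    (expR (- (a * y)) * (2 + cos (b * y) + sin (- g * y)))%:E)%E.
  congr (_ + _)%E; apply: eq_integral => y; rewrite inE/= in_itv/= andbT => y0.
    by rewrite ger0_norm.
  by rewrite normrN ger0_norm// !mulrN mulNr cosN.
rewrite !damped_antiderivative// -EFinD; congr EFin.
by rewrite sqrrN; field; rewrite !ab an0.
Qed.

Lemma integrable_damping (a : R) : 0 < a ->
  leb.-integrable setT (EFin \o (fun y => expR (- (a * `|y|)))) /\
  \int[leb]_y expR (- (a * `|y|)) = 2 / a.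
Proof.
(* With both frequencies 0 the trigonometric factor is the constant 3. *)
move=> a0; have := integral_damped_trig 0 0 a0.
under eq_integral do rewrite !mul0r cos0 sin0 addr0 mulrC EFinM.
have me : measurable_fun setT (EFin \o (fun y : R => expR (- (a * `|y|)))).
  apply/measurable_EFinP; apply: measurableT_comp => //; apply: measurableT_comp => //.
  by apply: measurable_funM => //; exact: measurableT_comp.
rewrite ge0_integralZl//.
rewrite (_ : 4 / a + _ = (2 + 1) * (2 / a)); last first.
  by rewrite expr0n addr0; field; rewrite gt_eqF.
rewrite EFinM => E.
have {}E : (\int[leb]_y (expR (- (a * `|y|)))%:E = (2 / a)%:E)%E.
  have := congr1 (fun z => ((2 + 1)^-1)%:E * z)%E E.
  by rewrite !muleA -!EFinM mulVf ?mul1r ?mul1e// mulVf// mul1r.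
split; last by rewrite /Rintegral E.
apply/integrableP; split => //.
under eq_integral do rewrite /= ger0_norm ?expR_ge0//.
by rewrite E ltry.
Qed.

Lemma Rintegral_damped_trig (a b g : R) : 0 < a ->
  \int[leb]_y (expR (- (a * `|y|)) * (cos (b * y) + sin (g * y))) =
  2 * a / (a ^+ 2 + b ^+ 2).
Proof.
move=> a0; have [ie E] := integrable_damping a0.
have ab : a ^+ 2 + b ^+ 2 != 0.
  by rewrite gt_eqF// ltr_pwDl// ?exprn_gt0// sqr_ge0.
have h := integral_damped_trig b g a0.
set f := fun y => expR (- (a * `|y|)) * (2 + cos (b * y) + sin (g * y)) in h.
have if_ : leb.-integrable setT (EFin \o f).
  have f0 y : 0 <= f y by rewrite mulr_ge0 ?expR_ge0.
  apply/integrableP; split; last first.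
    by under eq_integral do rewrite /= ger0_norm//; rewrite h ltry.
  apply/measurable_EFinP; exact: measurable_damped_trig.
have Rf : \int[leb]_y f y = 4 / a + 2 * a / (a ^+ 2 + b ^+ 2).
  by rewrite /Rintegral h.
rewrite (_ : (fun y => _) = (fun y => f y - 2 * expR (- (a * `|y|)))); last first.
  by apply/funext => y; rewrite /f; ring.
rewrite RintegralB//; last exact: integrableZl_EFin.
by rewrite RintegralZl// Rf E; field; rewrite ab gt_eqF.
Qed.

End half_line.

(** * Inversion by summability *)

Section inversion.
Context d (T : measurableType d) (R : realType).
Variable mu : {sigma_finite_measure set T -> \bar R}.
Variables (c : T -> T -> R) (e : (T -> R)^nat).
Hypothesis cK : contractive_kernel mu c.
Hypothesis e_int : forall n, mu.-integrable setT (EFin \o e n).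
Hypothesis e_ge0 : forall n x, 0 <= e n x.
Hypothesis e_nd : forall x, nondecreasing_seq (e ^~ x).
Hypothesis e_cvg : forall x, e n x @[n --> \oo] --> (1 : R).

Local Notation L2 := (Lfun mu 2%:E).
Local Notation L1 := (Lfun mu 1%:E).
Local Notation P := (reproducing mu c e).
Local Notation hat := (hat mu c).

(** The integral [A n] of [e n * hat u * hat p] has two limits: dominated convergence gives
    [<hat u, hat p>], while [hat_reproducing] rewrites it as the pairing of [p] with the
    [P n]-average of [u], which tends to [<u, p>]. *)
Lemma is_transform_hatK (u : T -> R) (M : R) : u \in L1 -> u \in L2 ->
  (forall n y, `|\int[mu]_x (u x * P n x y)| <= M) ->
  {ae mu, forall y, \int[mu]_x (u x * P n x y) @[n --> \oo] --> u y} ->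
  is_transform mu c (hat u) u.
Proof.
move=> u1 u2 gM gu; have hu2 := hat_L2 cK u1 u2; split => // p p1 p2.
have hp2 := hat_L2 cK p1 p2.
have e_le1 n x : e n x <= 1.
  rewrite -(cvg_lim _ (e_cvg x))//.
  by apply: nondecreasing_cvgn_le (e_nd x) _ n; apply/cvg_ex; exists 1; exact: e_cvg.
have bs := ker_bs cK.
have mP n := measurable_reproducing bs e_int n.
have [C cC] := ker_bounded bs.
have PC n z : `|P n z.1 z.2| <= C * C * \int[mu]_y e n y.
  have C0 : 0 <= C by rewrite (le_trans _ (cC point point)).
  have icc : mu.-integrable setT (EFin \o (fun y => e n y * (c z.1 y * c z.2 y))).
    rewrite (_ : _ \o _ = EFin \o (fun y => (c z.1 y * c z.2 y) * e n y)).
      apply: (@integrableM_bounded _ _ _ _ _ _ (C * C)) => //.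
        by apply: measurable_funM; exact: ker_measx.
      by move=> y; rewrite normrM ler_pM.
    by apply/funext => y /=; rewrite mulrC.
  apply: (le_trans (le_normr_Rintegral _ icc)) => //.
  rewrite -RintegralZl//; apply: le_Rintegral => //.
  - exact: integrable_norm.
  - exact: integrableZl_EFin.
  - move=> y _; rewrite normrM (ger0_norm (e_ge0 _ _)) mulrC ler_wpM2r//.
    by rewrite normrM ler_pM.
pose A n := \int[mu]_y (e n y * (hat u y * hat p y)).
have A1 : A n @[n --> \oo] --> ip mu (hat u) (hat p).
  have ihh := integrable_L2M hu2 hp2.
  apply: (dominated_Rintegral _ _ _ (integrable_norm ihh)) => //.
  - move=> n; apply: measurable_funM; first exact: integrable_meas (e_int n).
    exact: integrable_meas ihh.
  - exact: integrable_meas ihh.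
  - apply: aeW => y; rewrite -[X in _ --> X]mul1r.
    by apply: cvgM; [exact: e_cvg|exact: cvg_cst].
  - by move=> n y /=; rewrite normrM (ger0_norm (e_ge0 _ _)) ler_piMl.
have A2 : A n @[n --> \oo] --> ip mu u p.
  have iu := (L1P mu u).1 u1; have ipp := (L1P mu p).1 p1.
  have AE n : A n = \int[mu]_y ((\int[mu]_x (u x * P n x y)) * p y).
    rewrite /A hat_reproducing//.
    have it : (mu \x mu)%E.-integrable setT (EFin \o (fun z => tensor u p z * P n z.1 z.2)).
      rewrite (_ : _ \o _ = EFin \o (fun z => P n z.1 z.2 * tensor u p z)); last first.
        by apply/funext => z /=; rewrite mulrC.
      by apply: integrableM_bounded (PC n) _ => //; exact: integrable_tensor.
    rewrite -(Rintegral_prod2 it); apply: eq_Rintegral => y _.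
    rewrite -RintegralZr//; first by apply: eq_Rintegral => x _; rewrite /tensor/=; ring.
    rewrite (_ : _ \o _ = EFin \o (fun x => P n x y * u x)); last first.
      by apply/funext => z /=; rewrite mulrC.
    apply: (integrableM_bounded _ (fun x => PC n (x, y)) iu).
    have mz : measurable_fun setT (fun x : T => (x, y)) by exact: measurable_fun_pair.
    exact: (measurableT_comp (mP n) mz).
  rewrite (_ : A = fun n => \int[mu]_y ((\int[mu]_x (u x * P n x y)) * p y)); last first.
    by apply/funext.
  apply: (dominated_Rintegral (g := fun y => M * `|p y|)) => //.
  - move=> n; apply: measurable_funM; last exact: L1_meas p1.
    apply: (@measurable_Rintegral_l _ _ _ _ _ mu (fun z => u z.1 * P n z.1 z.2)).
    apply: measurable_funM => //.
    exact: (measurableT_comp (L1_meas u1) measurable_fst).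
  - by apply: measurable_funM; [exact: L1_meas u1|exact: L1_meas p1].
  - by apply: filterS gu => y gy; apply: cvgM => //; exact: cvg_cst.
  - by apply: integrableZl_EFin; exact: integrable_norm.
  - by move=> n y; rewrite normrM ler_wpM2r.
exact: (cvg_unique _ A2 A1).
Qed.

End inversion.

(** * The cas kernel and the Poisson kernel *)

Section cas_kernel.
Variable R : realType.
Local Notation leb := (@lebesgue_measure R).

Definition cas (t : R) := cos t + sin t.
Definition cas_ker (x y : measurableTypeR R) : R := cas (2 * pi * (x * y)).
Definition damp (n : nat) (y : R) := expR (- ((2 * pi / n.+1%:R) * `|y|)).
(** With [eps = 1/(n+1)] this is [eps / (pi (eps^2 + (x - x')^2))], the Poisson kernel of the upper
    half-plane at height [eps]; the factor [2 pi] in the rate of [damp] produces exactly this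
    height. *)
Definition poisson (n : nat) (x x' : R) :=
  2 * (2 * pi / n.+1%:R) / ((2 * pi / n.+1%:R) ^+ 2 + (2 * pi * (x - x')) ^+ 2).

Lemma damp_rate_gt0 n : 0 < 2 * pi / n.+1%:R :> R.
Proof. by rewrite divr_gt0// mulr_gt0// pi_gt0. Qed.

Lemma measurable_cas : measurable_fun setT cas.
Proof.
by apply: measurable_funD; apply: continuous_measurable_fun;
  [exact: continuous_cos|exact: continuous_sin].
Qed.

Lemma cas_bounded t : `|cas t| <= 2.
Proof.
rewrite (le_trans (ler_normD _ _))// (_ : 2 = 1 + 1)// lerD//.
  by rewrite ler_norml cos_geN1 cos_le1.
by rewrite ler_norml sin_geN1 sin_le1.
Qed.

Lemma cas_kernel_bs : bounded_symmetric_kernel cas_ker.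
Proof.
split.
- apply: measurableT_comp; first exact: measurable_cas.
  by apply: measurable_funM => //; apply: measurable_funM.
- by move=> x y; rewrite /cas_ker (mulrC x).
- by exists 2 => x y; exact: cas_bounded.
Qed.

Lemma damp_int n : leb.-integrable setT (EFin \o damp n).
Proof. by have [] := integrable_damping (damp_rate_gt0 n). Qed.

Lemma damp_ge0 n x : 0 <= damp n x.
Proof. exact: expR_ge0. Qed.

Lemma damp_nd x : nondecreasing_seq (damp ^~ x).
Proof.
move=> m n mn; rewrite ler_expR lerN2 ler_wpM2r// ler_wpM2l ?mulr_ge0 ?pi_ge0//.
by rewrite lef_pV2 ?posrE// ler_nat.
Qed.

Lemma damp_cvg x : damp n x @[n --> \oo] --> (1 : R).
Proof.
rewrite /damp -[X in _ --> X]expR0.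
apply: (@cvg_comp _ _ _ (fun n => - ((2 * pi / n.+1%:R) * `|x|)) (@expR R) _ (nbhs 0)); last exact: continuous_expR.
rewrite -oppr0; apply: cvgN; rewrite -(mul0r `|x|); apply: cvgM; last exact: cvg_cst.
rewrite -(mulr0 (2 * pi)); apply: cvgM; first exact: cvg_cst.
exact: cvg_harmonic.
Qed.

(** [cas A * cas B = cos (A - B) + sin (A + B)], and the sine part, odd in [y], integrates to 0
    against the even damping. *)
Lemma reproducing_poisson n x x' : reproducing leb cas_ker damp n x x' = poisson n x x'.
Proof.
rewrite /poisson -(Rintegral_damped_trig _ (2 * pi * (x + x')) (damp_rate_gt0 n)).
apply: eq_Rintegral => y _; rewrite -/(damp n y); congr (_ * _).
rewrite /cas_ker /cas.
have -> : 2 * pi * (x - x') * y = 2 * pi * (x * y) - 2 * pi * (x' * y) by ring.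
have -> : 2 * pi * (x + x') * y = 2 * pi * (x * y) + 2 * pi * (x' * y) by ring.
by rewrite cosB sinD; ring.
Qed.

Lemma poisson_den n x x' :
  0 < (2 * pi / n.+1%:R) ^+ 2 + (2 * pi * (x - x')) ^+ 2 :> R.
Proof. by rewrite ltr_pwDl ?sqr_ge0// exprn_gt0// damp_rate_gt0. Qed.

Lemma poisson_ge0 n x x' : 0 <= poisson n x x'.
Proof.
rewrite /poisson divr_ge0 ?(ltW (poisson_den _ _ _))// mulr_ge0//.
exact/ltW/damp_rate_gt0.
Qed.

Lemma poissonC n x x' : poisson n x x' = poisson n x' x.
Proof. by rewrite /poisson -(opprB x') mulrN sqrrN. Qed.

Definition poisson_primitive n x (t : R) : R := atan (n.+1%:R * (t - x)) / pi.

Lemma is_derive_poisson_primitive n (x t : R) :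
  is_derive t 1 (poisson_primitive n x) (poisson n x t).
Proof.
have p0 : pi != 0 :> R by rewrite gt_eqF// pi_gt0.
have n0 : n.+1%:R != 0 :> R by rewrite pnatr_eq0.
have h0 := poisson_den n x t.
rewrite /poisson_primitive; apply: is_derive_eq.
rewrite /GRing.scale/= /poisson.
have h1 : 1 + (n.+1%:R * (t - x)) ^+ 2 != 0 :> R.
  by rewrite gt_eqF// ltr_pwDl// sqr_ge0.
have -> : (2 * pi / n.+1%:R) ^+ 2 + (2 * pi * (x - t)) ^+ 2 =
    (2 * pi / n.+1%:R) ^+ 2 * (1 + (n.+1%:R * (t - x)) ^+ 2) :> R by field.
have alg (z q m D : R) : q != 0 -> m != 0 -> D != 0 ->
    z * (- q ^- 2 * 0) + q^-1 * (D^-1 * (m * (1 - 0))) =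
    2 * (2 * q / m) / ((2 * q / m) ^+ 2 * D).
  by move=> q0 m0 D0; field; rewrite q0 m0 D0.
exact: alg.
Qed.

Lemma continuous_poisson n x : continuous (poisson n x).
Proof.
move=> t; apply: cvgM; first exact: cvg_cst.
apply: cvgV; first by rewrite gt_eqF// poisson_den.
apply: cvgD; first exact: cvg_cst.
apply: (@cvg_comp _ _ _ (fun t : R => 2 * pi * (x - t)) (fun z => z ^+ 2)); last exact: exprn_continuous.
by apply: cvgM; [exact: cvg_cst|apply: cvgB; [exact: cvg_cst|exact: cvg_id]].
Qed.

Lemma measurable_poisson n x : measurable_fun setT (poisson n x).
Proof. by apply: continuous_measurable_fun; exact: continuous_poisson. Qed.

Lemma cvgy_affine (a b : R) : 0 < a -> (a * (t - b)) @[t --> +oo] --> +oo.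
Proof.
move=> a0; apply/cvgryPge => A; near=> t.
rewrite -ler_pdivrMl// lerBrDr; near: t; exact: nbhs_pinfty_ge (num_real _).
Unshelve. all: by end_near. Qed.

Lemma integral_poisson n x : (\int[leb]_t (poisson n x t)%:E = 1)%E.
Proof.
have p0 : pi != 0 :> R by rewrite gt_eqF// pi_gt0.
rewrite integralT_half_lines; first last.
- exact: poisson_ge0.
- exact: measurable_poisson.
have lim1 : poisson_primitive n x t @[t --> +oo] --> (2^-1 : R).
  rewrite -[X in _ --> X](_ : (pi / 2) / pi = _); last by rewrite mulrAC divff ?mul1r.
  apply: cvgM; last exact: cvg_cst.
  apply: (@cvg_comp _ _ _ (fun t => n.+1%:R * (t - x)) (@atan R) _ +oo); last exact: cvgy_atan.
  exact: cvgy_affine.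
have lim2 : (- poisson_primitive n x (- t)) @[t --> +oo] --> (2^-1 : R).
  rewrite -[X in _ --> X](_ : (pi / 2) / pi = _); last by rewrite mulrAC divff ?mul1r.
  rewrite (_ : (fun t => _) = (fun t => atan (n.+1%:R * (t - (- x))) / pi)); last first.
    by apply/funext => t; rewrite /poisson_primitive -mulNr -atanN; congr (atan _ / _); ring.
  apply: cvgM; last exact: cvg_cst.
  apply: (@cvg_comp _ _ _ (fun t => n.+1%:R * (t - (- x))) (@atan R) _ +oo); last exact: cvgy_atan.
  exact: cvgy_affine.
have d2 (t : R) : is_derive t 1 (fun t => - poisson_primitive n x (- t)) (poisson n x (- t)).
  have dP := is_derive_poisson_primitive n x (- t).
  have dN : is_derive t 1 (-%R : R -> R) (-1) by apply: is_derive_eq.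
  apply: (@is_derive_eq _ _ _ _ _ _ _ _ (is_deriveN (is_derive1_comp dP dN))).
  by rewrite /= /GRing.scale/=; ring.
have c2 : continuous (fun t => poisson n x (- t)).
  move=> t; apply: (@cvg_comp _ _ _ -%R (poisson n x) _ (nbhs (- t))).
    by apply: cvgN; exact: cvg_id.
  exact: continuous_poisson.
have -> := integral0y_FTC (fun t _ => poisson_ge0 n x t) (@continuous_poisson n x)
  (is_derive_poisson_primitive n x) lim1.
have -> := integral0y_FTC (fun t _ => poisson_ge0 n x (- t)) c2 d2 lim2.
by rewrite -EFinD oppr0; congr EFin; rewrite opprK; field.
Qed.

Lemma Rintegral_poisson_itv n x (s t : R) : s < t ->
  \int[leb]_(y in `]s, t]) poisson n x y =
  poisson_primitive n x t - poisson_primitive n x s.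
Proof.
move=> st; rewrite /Rintegral integral_itv_obnd_cbnd; last first.
  by apply/measurable_EFinP; apply: measurable_funTS; exact: measurable_poisson.
rewrite (continuous_FTC2 (F := poisson_primitive n x) st)//.
- by apply: continuous_subspaceT; exact: continuous_poisson.
- have cp : continuous (poisson_primitive n x).
    move=> z; apply: differentiable_continuous; apply/derivable1_diffP.
    by have [] := is_derive_poisson_primitive n x z.
  split.
  + by move=> z _; have [] := is_derive_poisson_primitive n x z.
  + by apply: cvg_at_right_filter; exact: cp.
  + by apply: cvg_at_left_filter; exact: cp.
- by move=> z _; rewrite derive1E; have [] := is_derive_poisson_primitive n x z.
Qed.

Lemma cas_kernel_contractive : contractive_kernel leb cas_ker.
Proof.
apply: (contractive_of_approximation cas_kernel_bs damp_int damp_ge0 damp_nd damp_cvg).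
- by move=> n x x'; rewrite reproducing_poisson poisson_ge0.
- move=> n x; under eq_integral do rewrite reproducing_poisson.
  by rewrite integral_poisson.
Qed.

Lemma poisson_primitive_cvg x t : t != x ->
  poisson_primitive n x t @[n --> \oo] --> (Num.sg (t - x) / 2 : R).
Proof.
move=> tx; have p0 : pi != 0 :> R by rewrite gt_eqF// pi_gt0.
have h (z : R) : 0 < z -> atan (n.+1%:R * z) @[n --> \oo] --> (pi / 2 : R).
  move=> z0; apply: (@cvg_comp _ _ _ (fun n : nat => n.+1%:R * z) (@atan R) _ +oo); last exact: cvgy_atan.
  apply/cvgryPge => A; near=> n.
  rewrite -ler_pdivrMr// (le_trans (_ : _ <= n%:R))// ?ler_nat//.
  near: n; exact: nbhs_infty_ger.
rewrite -[X in _ --> X](_ : (Num.sg (t - x) * (pi / 2)) / pi = _); last by rewrite -mulrA (mulrAC pi) divff ?mul1r.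
rewrite /poisson_primitive; apply: cvgM; last exact: cvg_cst.
have [xt|xt|] := ltgtP t x; last by move=> E; rewrite E eqxx in tx.
- rewrite ltr0_sg ?subr_lt0// mulN1r.
  rewrite (_ : (fun n => _) = (fun n => - atan (n.+1%:R * (x - t)))); last first.
    by apply/funext => n; rewrite -atanN -mulrN opprB.
  by apply: cvgN; apply: h; rewrite subr_gt0.
- by rewrite gtr0_sg ?subr_gt0// mul1r; apply: h; rewrite subr_gt0.
Unshelve. all: by end_near. Qed.

Lemma poisson_primitive_le x t n : `|poisson_primitive n x t| <= 2^-1.
Proof.
rewrite normrM normfV (gtr0_norm (pi_gt0 R)) ler_pdivrMr ?pi_gt0// (mulrC 2^-1).
by rewrite ler_norml (ltW (atan_gtNpi2 _)) (ltW (atan_ltpi2 _)).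
Qed.

Lemma indic_itv_L12 (s t : R) :
  \1_(`]s, t]) \in Lfun leb 1%:E /\ \1_(`]s, t]) \in Lfun leb 2%:E.
Proof.
have i1 : leb.-integrable setT (EFin \o \1_(`]s, t])).
  exact: integrable_indic_itv.
split; first exact/L1P.
apply/L2P; split; first exact: measurable_indic.
rewrite (_ : (fun x => _) = \1_(`]s, t]))//.
by apply/funext => x; rewrite indicE; case: (_ \in _); rewrite /= ?expr1n ?expr0n.
Qed.

(** The Poisson average of the indicator is a difference of two values of [poisson_primitive]:
    bounded by 1 and tending to the indicator away from the endpoints, as [is_transform_hatK]
    asks. *)
Lemma cas_transform_indic (s t : R) : s < t ->
  exists b, is_transform leb cas_ker (\1_(`]s, t])) b /\
    is_transform leb cas_ker b (\1_(`]s, t])).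
Proof.
move=> st; have [u1 u2] := indic_itv_L12 s t.
exists (hat leb cas_ker (\1_(`]s, t]))); split.
  exact: (is_transform_hat cas_kernel_contractive).
have E n y : \int[leb]_x (\1_(`]s, t]) x * reproducing leb cas_ker damp n x y) =
    poisson_primitive n y t - poisson_primitive n y s.
  rewrite -Rintegral_poisson_itv// [RHS]Rintegral_mkcond; apply: eq_Rintegral => x _.
  rewrite patchE indicE reproducing_poisson poissonC.
  by case: (x \in _); rewrite ?mul1r ?mul0r.
apply: (is_transform_hatK cas_kernel_contractive damp_int damp_ge0 damp_nd damp_cvg (M := 1)) => //.
- move=> n y; rewrite E (le_trans (ler_normB _ _))//.
  by have := poisson_primitive_le y t n; have := poisson_primitive_le y s n; lra.
(* At the two endpoints the averages tend to 1/2, so this null set is excluded. *)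
- have st0 : leb [set s; t] = 0%E.
    apply/eqP; rewrite eq_le measure_ge0 andbT.
    have h := @measureU2 _ _ _ leb _ _ (measurable_set1 s) (measurable_set1 t).
    apply: (le_trans h); rewrite le_eqVlt; apply/orP; left; apply/eqP.
    by rewrite -[RHS]adde0; congr (_ + _)%E; exact: lebesgue_measure_set1.
  exists [set s; t]; split => //; first exact: measurableU.
  move=> y /=; apply: contra_notP => /not_orP[/eqP ys /eqP yt].
  rewrite (_ : (fun n => _) = (fun n => poisson_primitive n y t - poisson_primitive n y s)); last first.
    by apply/funext => n; rewrite E.
  rewrite -[X in _ --> X](_ : Num.sg (t - y) / 2 - Num.sg (s - y) / 2 = _).
    by apply: cvgB; apply: poisson_primitive_cvg; rewrite eq_sym.
  rewrite indicE mem_setE in_itv/=.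
  move: ys yt; rewrite !neq_lt => /orP[ys|ys] /orP[yt|yt].
  - by rewrite !gtr0_sg ?subr_gt0// subrr [s < y]ltNge (ltW ys).
  - by have := lt_trans (lt_trans ys st) yt; rewrite ltxx.
  - rewrite gtr0_sg ?subr_gt0// ltr0_sg ?subr_lt0// ys (ltW yt)/=.
    by rewrite mulN1r opprK; field.
  - by rewrite !ltr0_sg ?subr_lt0// subrr [y <= t]leNgt yt andbF.
Qed.

End cas_kernel.

(** * Separation of functions by pi-systems *)

Lemma indic_L2 d (T : measurableType d) (R : realType)
    (mu : {measure set T -> \bar R}) (A : set T) : measurable A ->
  (mu A < +oo)%E -> (\1_A : T -> R) \in Lfun mu 2%:E.
Proof.
move=> mA muA; apply/L2P; split; first exact: measurable_indic.
rewrite (_ : (fun x => _) = \1_A).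
  apply/integrableP; split; first by apply/measurable_EFinP; exact: measurable_indic.
  by under eq_integral do rewrite /= ger0_norm//; rewrite integral_indic// setIT.
by apply/funext => x; rewrite indicE; case: (_ \in _); rewrite /= ?expr1n ?expr0n.
Qed.

Section separation.
Context d (T : measurableType d) (R : realType).
Variable mu : {measure set T -> \bar R}.
Variable G : set (set T).
Hypothesis mG : @measurable d T = <<s G >>.
Hypothesis GI : setI_closed G.

(** The pi-lambda theorem for the signed measure with density [f]; the vanishing total integral
    makes the class stable under complements. *)
Lemma integral_pi_system_eq0 (f : T -> R) : mu.-integrable setT (EFin \o f) ->
  (\int[mu]_x (f x)%:E = 0)%E ->
  (forall A, G A -> (\int[mu]_(x in A) (f x)%:E = 0)%E) ->
  {ae mu, forall x, f x = 0}.
Proof.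
move=> intf f0 fG.
have ifA A : measurable A -> mu.-integrable A (EFin \o f).
  by move=> mA; apply: integrableS intf.
have h A : measurable A -> (\int[mu]_(x in A) (f x)%:E = 0)%E.
  pose H := [set B | measurable B /\ (\int[mu]_(x in B) (f x)%:E = 0)%E].
  suff GH : <<s G >> `<=` H by move=> mA; have [] // : H A by apply: GH; rewrite -mG.
  apply: lambda_system_subset => //.
  - apply/dynkin_lambda_system; split.
    + by split.
    + move=> B [mB fB]; split; first exact: measurableC.
      have := f0; rewrite -(setvU B) setUC integral_setU //.
      * by rewrite fB add0e.
      * exact: measurableC.
      * by rewrite setUC setvU; exact: (measurable_int mu).
      * by apply/disj_setPS => x [].
    + move=> F tF HF; have mF n : measurable (F n) by case: (HF n).
      split; first exact: bigcupT_measurable.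
      rewrite integral_bigcup//; last by apply: ifA; exact: bigcupT_measurable.
      by apply: eseries0 => n _ _; case: (HF n).
  - by move=> B GB; split; [rewrite mG; exact: sub_sigma_algebra|exact: fG].
have : ae_eq mu setT (EFin \o f) (cst 0%E).
  by apply: integral_ae_eq => // E _ mE; rewrite h// integral0_eq.
case.
move=> N [mN N0 sN]; exists N; split => // x /= fx; apply: sN => /= fx'.
by apply: fx; have /= [] := fx' I.
Qed.

(** An L2 function need not be integrable on the whole space, so [k] is localized to the sets [D n]
    of finite measure; their indicators are in L2, which makes the products integrable. *)
Lemma L2_pi_system_eq0 (D : (set T)^nat) (k : T -> R) : k \in Lfun mu 2%:E ->
  (forall n, G (D n)) -> \bigcup_n D n = setT ->
  (forall n, (mu (D n) < +oo)%E) ->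
  (forall A n, G A -> ip mu k (\1_(A `&` D n)) = 0) ->
  {ae mu, forall x, k x = 0}.
Proof.
move=> k2 GD DT Dfin kG.
have mD n : measurable (D n) by rewrite mG; exact: sub_sigma_algebra.
have D2 n : (\1_(D n) : T -> R) \in Lfun mu 2%:E.
  by apply: indic_L2.
have kD n := integrable_L2M k2 (D2 n).
have E A n : G A -> (\int[mu]_(x in A) (k x * \1_(D n) x)%:E = 0)%E.
  move=> GA; have mA : measurable A by rewrite mG; exact: sub_sigma_algebra.
  have iA : mu.-integrable A (EFin \o (fun x => k x * \1_(D n) x)).
    exact: integrableS (kD n).
  rewrite -[LHS]fineK; last exact: integrable_fin_num iA.
  congr EFin; rewrite -/(Rintegral _ _ _) Rintegral_mkcond -(kG A n GA).
  apply: eq_Rintegral => x _; rewrite patchE !indicE in_setI.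
  by case: (x \in A) => /=; rewrite ?mulr0.
have ae n : {ae mu, forall x, k x * \1_(D n) x = 0}.
  apply: integral_pi_system_eq0 => //; last by move=> A; exact: E.
  apply: etrans (E _ n (GD n)); rewrite [RHS]integral_mkcond; apply: eq_integral => x _.
  by rewrite patchE indicE; case: (_ \in _); rewrite ?mulr0.
have : {ae mu, forall x, forall n, k x * \1_(D n) x = 0} by exact/ae_foralln.
apply: filterS => x kx.
have [n _ Dx] : (\bigcup_n D n) x by rewrite DT.
by have := kx n; rewrite indicE mem_set// mulr1.
Qed.

End separation.

Section cas_involution.
Variable R : realType.
Local Notation leb := (@lebesgue_measure R).

Lemma bigcup_ocitv : \bigcup_n `](- n%:R), n%:R]%classic = setT :> set R.
Proof.
apply/seteqP; split => // x _.
have [n xn] : exists n : nat, `|x| < n%:R.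
  by exists (Num.bound `|x|); exact: archi_boundP (normr_ge0 x).
exists n => //=; move: xn; rewrite in_itv/= ltr_norml => /andP[-> /ltW].
by [].
Qed.

(** The separating family consists of the indicators of half-open intervals, where
    [cas_transform_indic] gives the involution; up to empty intervals these form a generating
    pi-system. *)
Lemma cas_transform_involutive h k : is_transform leb (@cas_ker R) h k ->
  is_transform leb (@cas_ker R) k h.
Proof.
apply: (@is_transform_involutive _ _ _ _ _ (cas_kernel_contractive R)
  [set \1_(`]x.1, x.2]) | x in [set x : R * R | x.1 < x.2]]).
  by move=> _ [[s t] /= st <-]; exact: cas_transform_indic.
move=> f f2 fB.
have fI (A : set R) : ocitv A -> ip leb f (\1_A) = 0.
  move=> [[s t] _ <-] /=; have [st|ts] := ltP s t.
    by apply: fB; exists (s, t).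
  rewrite set_itv_ge ?bnd_simp -?leNgt// indic0 /ip.
  by under eq_Rintegral do rewrite mulr0; rewrite Rintegral_cst// mul0r.
apply: (@L2_pi_system_eq0 _ _ _ leb (@ocitv R) _ _
  (fun n => `](- n%:R), n%:R]%classic)) => //.
- exact: ocitvI.
- by move=> n; exists (- n%:R, n%:R).
- exact: bigcup_ocitv.
- move=> n; apply: (@le_lt_trans _ _ (lebesgue_measure `](- n%:R), (n%:R : R)]%classic)) => //.
  by rewrite lebesgue_measure_itv/=; case: ifP => _; rewrite ?ltry.
- by move=> A n oA; apply: fI; apply: ocitvI => //; exists (- n%:R, n%:R).
Qed.

End cas_involution.

(** * The cas transform on the plane *)

Section square_kernel.
Context d (T : measurableType d) (R : realType).
Variable mu : {sigma_finite_measure set T -> \bar R}.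
Variables (c : T -> T -> R) (e : (T -> R)^nat).
Hypothesis cK : contractive_kernel mu c.
Hypothesis e_int : forall n, mu.-integrable setT (EFin \o e n).
Hypothesis e_ge0 : forall n x, 0 <= e n x.
Hypothesis e_nd : forall x, nondecreasing_seq (e ^~ x).
Hypothesis e_cvg : forall x, e n x @[n --> \oo] --> (1 : R).
Local Notation P := (reproducing mu c e).
Hypothesis P_ge0 : forall n x x', 0 <= P n x x'.
Hypothesis P_le1 : forall n x, (\int[mu]_x' (P n x x')%:E <= 1)%E.

Local Notation mu2 := (sfprod mu mu).
Local Notation L2 := (Lfun mu 2%:E).
Local Notation L1 := (Lfun mu 1%:E).

Definition square_ker (z w : T * T) : R := c z.1 w.1 * c z.2 w.2.

Lemma square_ker_bs : bounded_symmetric_kernel square_ker.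
Proof.
have bs := ker_bs cK; split.
- apply: measurable_funM.
  + apply: (measurableT_comp (ker_meas bs) (_ : measurable_fun setT
      (fun z : (T * T) * (T * T) => (z.1.1, z.2.1)))).
    by apply: measurable_fun_pair; apply: (measurableT_comp measurable_fst).
  + apply: (measurableT_comp (ker_meas bs) (_ : measurable_fun setT
      (fun z : (T * T) * (T * T) => (z.1.2, z.2.2)))).
    by apply: measurable_fun_pair; apply: (measurableT_comp measurable_snd).
- by move=> z w; rewrite /square_ker (ker_sym bs z.1) (ker_sym bs z.2).
- have [M cM] := ker_bounded bs; exists (M * M) => z w.
  by rewrite normrM ler_pM.
Qed.

Lemma square_reproducing n z z' :
  reproducing mu2 square_ker (fun n => tensor (e n) (e n)) n z z' =
  P n z.1 z'.1 * P n z.2 z'.2.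
Proof.
have bs := ker_bs cK; have [M cM] := ker_bounded bs.
have icc x x' : mu.-integrable setT (EFin \o (fun y => e n y * (c x y * c x' y))).
  rewrite (_ : _ \o _ = EFin \o (fun y => (c x y * c x' y) * e n y)).
    apply: (@integrableM_bounded _ _ _ _ _ _ (M * M)) => //.
      by apply: measurable_funM; exact: ker_measx.
    by move=> y; rewrite normrM ler_pM.
  by apply/funext => y /=; rewrite mulrC.
apply: etrans (Rintegral_tensor (icc z.1 z'.1) (icc z.2 z'.2)).
by apply: eq_Rintegral => w _; rewrite /tensor /square_ker; ring.
Qed.

(** The criterion is applied afresh on pairs: the reproducing kernel of the square is a product of
    two copies of [P n], hence nonnegative and of mass at most 1. *)
Lemma square_ker_contractive : contractive_kernel mu2 square_ker.
Proof.
have bs := ker_bs cK.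
apply: (@contractive_of_approximation _ _ _ mu2 _ (fun n => tensor (e n) (e n))).
- exact: square_ker_bs.
- by move=> n; exact: integrable_tensor (e_int n) (e_int n).
- by move=> n x; rewrite mulr_ge0.
- by move=> x m n mn; rewrite /tensor ler_pM// e_nd.
- by move=> x; rewrite -[X in _ --> X]mulr1; apply: cvgM; exact: e_cvg.
- by move=> n x x'; rewrite square_reproducing mulr_ge0.
move=> n x; under eq_integral do rewrite square_reproducing.
have mP y : measurable_fun setT (fun w => (P n y w)%:E).
  apply/measurable_EFinP; have mz : measurable_fun setT (fun w : T => (y, w)).
    exact: measurable_fun_pair.
  exact: (measurableT_comp (measurable_reproducing bs e_int n) mz).
have mPP : measurable_fun setT (EFin \o tensor (P n x.1) (P n x.2)).
  by apply/measurable_EFinP; apply: measurable_tensor; apply/measurable_EFinP; exact: mP.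
apply: (@le_trans _ _ (\int[(mu \x mu)%E]_w (tensor (P n x.1) (P n x.2) w)%:E)%E) => //.
rewrite fubini_tonelli1//; last by move=> w; rewrite lee_fin mulr_ge0.
rewrite /fubini_F.
under eq_integral => w _.
  under eq_integral do rewrite /tensor/= EFinM.
  rewrite ge0_integralZl//; [|by move=> y _; rewrite lee_fin|by rewrite lee_fin].
  over.
rewrite ge0_integralZr//; last 2 first.
- by move=> y _; rewrite lee_fin.
- by apply: integral_ge0 => y _; rewrite lee_fin.
by rewrite -[leRHS]mule1 lee_pmul//; apply: integral_ge0 => y _; rewrite lee_fin.
Qed.

Lemma hat_tensor u v z : u \in L1 -> v \in L1 ->
  hat mu2 square_ker (tensor u v) z = tensor (hat mu c u) (hat mu c v) z.
Proof.
move=> u1 v1; have bs := ker_bs cK.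
apply: etrans (Rintegral_tensor (integrable_hat z.1 bs u1) (integrable_hat z.2 bs v1)).
by apply: eq_Rintegral => w _; rewrite /tensor /square_ker; ring.
Qed.

(** For truncations this is Fubini; the general case follows because tensor products are continuous
    in L2. *)
Lemma is_transform_tensor u u' v v' : is_transform mu c u u' ->
  is_transform mu c v v' ->
  is_transform mu2 square_ker (tensor u v) (tensor u' v').
Proof.
move=> uu' vv'; have [u2 u'2 _] := uu'; have [v2 v'2 _] := vv'.
have tu1 n := trunc_L1 n u2; have tu2 n := trunc_L2 n u2.
have tv1 n := trunc_L1 n v2; have tv2 n := trunc_L2 n v2.
have huc := is_transform_cvg cK (fun n => is_transform_hat cK (tu1 n) (tu2 n)) uu' (L2cvg_trunc u2).
have hvc := is_transform_cvg cK (fun n => is_transform_hat cK (tv1 n) (tv2 n)) vv' (L2cvg_trunc v2).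
have hu2 n := hat_L2 cK (tu1 n) (tu2 n); have hv2 n := hat_L2 cK (tv1 n) (tv2 n).
apply: (@is_transform_lim _ _ _ mu2 square_ker square_ker_contractive
  (fun n => tensor (trunc u n) (trunc v n))
  (fun n => tensor (hat mu c (trunc u n)) (hat mu c (trunc v n)))).
- move=> n; have E : hat mu2 square_ker (tensor (trunc u n) (trunc v n)) =
      tensor (hat mu c (trunc u n)) (hat mu c (trunc v n)).
    by apply/funext => z; exact: hat_tensor.
  rewrite -E; apply: (is_transform_hat square_ker_contractive).
  + apply/(L1P mu2); apply: integrable_tensor; exact/(L1P mu).
  + exact: tensor_L2.
- exact: tensor_L2.
- exact: tensor_L2.
- exact: (L2cvg_tensor tu2 tv2 u2 v2 (L2cvg_trunc u2) (L2cvg_trunc v2)).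
- exact: (L2cvg_tensor hu2 hv2 u'2 v'2 huc hvc).
Qed.

Hypothesis c_inv : forall h k, is_transform mu c h k -> is_transform mu c k h.

(** Tensor products of L2 functions separate, since they include the indicators of rectangles with
    sides of finite measure, and on them the involution is [c_inv] factor by factor. *)
Lemma square_transform_involutive h k : is_transform mu2 square_ker h k ->
  is_transform mu2 square_ker k h.
Proof.
pose G : set (set (T * T)) :=
  [set C | exists A, measurable A /\ exists B, measurable B /\ C = A `*` B].
pose Bs : set (T * T -> R) := [set b | exists u v, [/\ u \in L2, v \in L2 &
  b = tensor u v]].
apply: (@is_transform_involutive _ _ _ mu2 _ square_ker_contractive Bs).
  move=> _ [u [v [u2 v2 ->]]].
  have [u' uu'] := is_transform_exists cK u2.
  have [v' vv'] := is_transform_exists cK v2.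
  exists (tensor u' v'); split; first exact: is_transform_tensor.
  by apply: is_transform_tensor; exact: c_inv.
move=> f f2 fB.
have /sigma_finiteP[F [TF ndF Foo]] := sigma_finiteT mu.
have mF n : measurable (F n) by case: (Foo n).
have Ffin n : (mu (F n) < +oo)%E by case: (Foo n).
apply: (@L2_pi_system_eq0 _ _ _ mu2 G _ _ (fun n => F n `*` F n)) => //.
- rewrite measurable_prod_measurableType //; congr (<<s _ >>).
  rewrite predeqE; split => [[A mA [B mB <-]]|[A [mA [B [mB ->]]]]].
    by exists A; split => //; exists B.
  by exists A => //; exists B.
- move=> /= _ _ [X1 [mX1 [X2 [mX2 ->]]]] [Y1 [mY1 [Y2 [mY2 ->]]]].
  rewrite -setXI; exists (X1 `&` Y1); split; first exact: measurableI.
  by exists (X2 `&` Y2); split => //; exact: measurableI.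
- by move=> n; exists (F n); split => //; exists (F n).
- rewrite -setXTT TF predeqE => -[x y]; split.
    by move=> [n _ []/= ? ?]; split; exists n.
  move=> [/= [n _ Fnx] [m _ Fmy]]; exists (maxn n m) => //; split.
  + by move: x Fnx; exact/subsetPset/ndF/leq_maxl.
  + by move: y Fmy; exact/subsetPset/ndF/leq_maxr.
- move=> n; apply: (@le_lt_trans _ _ ((mu \x mu)%E (F n `*` F n))) => //.
  rewrite (product_measure1E _ _ (mF n) (mF n)).
  by apply: lte_mul_pinfty; rewrite ?ge0_fin_numE// ?measure_ge0 ?Ffin.
- move=> _ n [A [mA [B [mB ->]]]].
  apply: fB; exists (\1_(A `&` F n)), (\1_(B `&` F n)).
  have fin C : measurable C -> (mu (C `&` F n) < +oo)%E.
    by move=> mC; apply: le_lt_trans (Ffin n); apply: le_measure; rewrite ?inE;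
      [exact: measurableI|exact: mF|exact: subIsetr].
  split.
  + by apply: indic_L2; [exact: measurableI|exact: fin].
  + by apply: indic_L2; [exact: measurableI|exact: fin].
  + apply/funext => -[x y]; rewrite -setXI /tensor !indicE/= in_setX.
    by rewrite -mulnb natrM.
Qed.

End square_kernel.

(** * Changes of variables *)

Section scaling_maps.
Context d (T : measurableType d) (R : realType).
Variable mu : {measure set T -> \bar R}.

(** The factor is read off preimages, so [r] is the inverse of the Jacobian of [phi]: composing an
    integrand with [phi] multiplies its integral by [r]. *)
Definition scales_measure (phi : T -> T) (r : R) := [/\ 0 < r,
  measurable_fun setT phi &
  forall A, measurable A -> mu (phi @^-1` A) = (r%:E * mu A)%E].

Variables (phi : T -> T) (r : R).
Hypothesis sc : scales_measure phi r.

Let r0 : 0 < r. Proof. by case: sc. Qed.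

Lemma scales_meas : measurable_fun setT phi. Proof. by case: sc. Qed.

Lemma scales_ge0_integral (f : T -> \bar R) : measurable_fun setT f ->
  (forall x, 0 <= f x)%E ->
  (\int[mu]_x f (phi x) = r%:E * \int[mu]_x f x)%E.
Proof.
move=> mf f0; have [_ mphi muphi] := sc.
have := @ge0_integral_pushforward _ _ _ _ _ _ mphi mu setT f measurableT mf (fun x _ => f0 x).
rewrite preimage_setT => <-.
have r0' : 0 <= r by exact: ltW.
rewrite -(@ge0_integral_mscale _ _ _ mu setT measurableT (NngNum r0'))//.
by apply: eq_measure_integral => A mA _; exact: muphi.
Qed.

Lemma scales_integrable (f : T -> R) : mu.-integrable setT (EFin \o f) ->
  mu.-integrable setT (EFin \o (f \o phi)).
Proof.
move=> /integrableP[mf fi]; apply/integrableP; split.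
  exact: (measurableT_comp mf scales_meas).
rewrite (scales_ge0_integral (f := fun x => `|(EFin \o f) x|%E))//; last first.
  exact: measurableT_comp.
by rewrite lte_mul_pinfty// lee_fin ltW.
Qed.

Lemma scales_Rintegral (f : T -> R) : mu.-integrable setT (EFin \o f) ->
  \int[mu]_x f (phi x) = r * \int[mu]_x f x.
Proof.
move=> intf; have intf' := scales_integrable intf.
have mf := measurable_int _ intf.
rewrite /Rintegral -[X in r * fine X]/(\int[mu]_x (EFin \o f) x)%E integralE [in RHS]integralE.
rewrite (_ : (\int[mu]_x (fun x => (f (phi x))%:E)^\+ x)%E =
  (r%:E * \int[mu]_x (EFin \o f)^\+ x)%E); last first.
  rewrite -scales_ge0_integral//; last exact: measurable_funepos.
  by apply: eq_integral => x _; rewrite (funepos_comp (EFin \o f) phi).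
rewrite (_ : (\int[mu]_x (fun x => (f (phi x))%:E)^\- x)%E =
  (r%:E * \int[mu]_x (EFin \o f)^\- x)%E); last first.
  rewrite -scales_ge0_integral//; last exact: measurable_funeneg.
  by apply: eq_integral => x _; rewrite (funeneg_comp (EFin \o f) phi).
have := integrable_pos_fin_num measurableT intf.
have := integrable_neg_fin_num measurableT intf.
case: (integral _ _ _) => // a _; case: (integral _ _ _) => // b _.
by rewrite -!EFinM -!EFinB /= mulrBr.
Qed.

Lemma scales_ae (P : T -> Prop) : {ae mu, forall x, P x} ->
  {ae mu, forall x, P (phi x)}.
Proof.
move=> [N [mN N0 sN]]; have [_ mphi muphi] := sc.
exists (phi @^-1` N); split.
- by rewrite -[_ @^-1` _]setTI; exact: mphi.
- by rewrite muphi// N0 mule0.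
- by move=> x /= nP; apply: sN.
Qed.

Lemma scales_L2 (f : T -> R) : f \in Lfun mu 2%:E -> f \o phi \in Lfun mu 2%:E.
Proof.
move=> /L2P[mf if2]; apply/L2P; split; first exact: measurableT_comp scales_meas.
exact: (scales_integrable if2).
Qed.

Lemma scales_L1 (f : T -> R) : f \in Lfun mu 1%:E -> f \o phi \in Lfun mu 1%:E.
Proof. by move=> /L1P i1; apply/L1P; exact: scales_integrable. Qed.

Lemma scales_ip (f g : T -> R) : f \in Lfun mu 2%:E -> g \in Lfun mu 2%:E ->
  ip mu (f \o phi) (g \o phi) = r * ip mu f g.
Proof.
by move=> f2 g2; rewrite -scales_Rintegral//; exact: integrable_L2M.
Qed.

End scaling_maps.

Section scaling_maps_product.
Context d (T : measurableType d) (R : realType).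
Variable mu : {sigma_finite_measure set T -> \bar R}.

Lemma scales_comp (m : {measure set T -> \bar R}) (f g : T -> T) (r s : R) :
  scales_measure m f r -> scales_measure m g s ->
  scales_measure m (f \o g) (s * r).
Proof.
move=> [r0 mf fr] [s0 mg gs]; split; [exact: mulr_gt0|exact: measurableT_comp|].
move=> A mA; rewrite comp_preimage gs ?fr ?muleA//.
by rewrite -[_ @^-1` _]setTI; exact: mf.
Qed.

(** The pushforward of the product measure, divided by [r * s], has the product value on rectangles,
    hence is the product measure by uniqueness. *)
Lemma scales_prod (f g : T -> T) (r s : R) :
  scales_measure mu f r -> scales_measure mu g s ->
  scales_measure (mu \x mu)%E (fun z => (f z.1, g z.2)) (r * s).
Proof.
move=> [r0 mf fr] [s0 mg gs].
have mfg : measurable_fun setT (fun z : T * T => (f z.1, g z.2)).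
  by apply: measurable_fun_pair; apply: measurableT_comp.
split; [exact: mulr_gt0|exact: mfg|move=> A mA].
have rs0 : 0 <= (r * s)^-1 by rewrite invr_ge0 mulr_ge0// ltW.
pose m0 := mscale (NngNum rs0)
  (pushforward (mu \x mu)%E (fun z : T * T => (f z.1, g z.2))).
pose m' := m0 mfg.
have E B C : measurable B -> measurable C -> m' (B `*` C) = (mu B * mu C)%E.
  move=> mB mC; rewrite /m' /m0 /= /mscale/= /pushforward/=.
  rewrite (_ : _ @^-1` _ = (f @^-1` B) `*` (g @^-1` C))//.
  rewrite product_measure1E; [|by rewrite -[_ @^-1` _]setTI; exact: mf|by rewrite -[_ @^-1` _]setTI; exact: mg].
  rewrite fr// gs// (muleACA r%:E) -EFinM (muleA ((r * s)^-1)%:E) -EFinM mulVf ?mul1e//.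
  by rewrite mulf_neq0// gt_eqF.
have K := product_measure_unique E mA.
apply/esym; apply: etrans (congr1 (fun x => (r * s)%:E * x)%E K) _.
rewrite /m' /m0 /= /mscale/= /pushforward/= muleA -EFinM mulfV ?mul1e//.
by rewrite mulf_neq0// gt_eqF.
Qed.

End scaling_maps_product.

Section lebesgue_scaling.
Variable R : realType.
Local Notation leb := (@lebesgue_measure R).
Local Notation Rm := (measurableTypeR R).

Lemma scales_opp : scales_measure leb (-%R : Rm -> Rm) 1.
Proof.
split => //.
by move=> A mA; rewrite mul1e; exact: lebesgue_measureN.
Qed.

Lemma scales_id (d : _) (T : measurableType d) (mu : {measure set T -> \bar R}) :
  scales_measure mu (idfun : T -> T) 1.
Proof.
split; [exact: ltr01|exact: measurable_id|].
by move=> A mA; rewrite mul1e preimage_id.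
Qed.

Lemma scales_affine (a b : R) : 0 < a ->
  scales_measure leb (fun t : Rm => a * t + b) a^-1.
Proof.
move=> a0; have mf : measurable_fun setT (fun t : Rm => a * t + b : Rm).
  by apply: measurable_funD => //; exact: measurable_funM.
split; [by rewrite invr_gt0|exact: mf|move=> A mA].
pose m0 := mscale (NngNum (ltW a0)) (pushforward leb (fun t : Rm => a * t + b : Rm)).
pose m' := m0 mf.
have E X : ocitv X -> leb X = m' X.
  move=> [[s t] _ <-]; rewrite /m' /m0 /= /mscale/= /pushforward/=.
  rewrite (_ : _ @^-1` _ = `](s - b) / a, (t - b) / a]%classic); last first.
    apply/seteqP; split => x /=; rewrite !in_itv/= ltr_pdivrMr// ler_pdivlMr//;
      by rewrite ltrBlDr lerBrDr (mulrC x).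
  rewrite !lebesgue_measure_itv/= !lte_fin ltr_pM2r ?invr_gt0// ltrD2r.
  case: ifP => _; last by rewrite mule0.
  by rewrite -!EFinB -EFinM; congr EFin; field; rewrite gt_eqF.
have K := lebesgue_measure_unique E mA.
apply/esym; apply: etrans (congr1 (fun x => a^-1%:E * x)%E K) _.
by rewrite /m' /m0 /= /mscale/= /pushforward/= muleA -EFinM mulVf ?mul1e// gt_eqF.
Qed.

(** On each horizontal line the shear is a translation, so Tonelli reduces the claim to translation
    invariance. *)
Lemma scales_shear (t : R) :
  scales_measure (leb \x leb)%E (fun z : Rm * Rm => (z.1 + t * z.2, z.2)) 1.
Proof.
have mf : measurable_fun setT (fun z : Rm * Rm => (z.1 + t * z.2 : Rm, z.2)).
  apply: measurable_fun_pair => //.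
  by apply: measurable_funD => //; exact: measurable_funM.
split=> // A mA; rewrite mul1e.
have mA' : measurable ((fun z : Rm * Rm => (z.1 + t * z.2 : Rm, z.2)) @^-1` A).
  by rewrite -[_ @^-1` _]setTI; exact: mf.
have ind (B : set (Rm * Rm)) : measurable B ->
    (leb \x leb)%E B = (\int[leb]_y \int[leb]_x (\1_B (x, y))%:E)%E.
  move=> mB; rewrite -[in LHS](setIT B) -integral_indic//.
  rewrite fubini_tonelli2//.
  by apply/measurable_EFinP; exact: measurable_indic.
apply: etrans (ind _ mA') _; apply: etrans (esym (ind _ mA)); apply: eq_integral => y _.
have sc : scales_measure leb (fun x : Rm => 1 * x + t * y) 1.
  by have := scales_affine (t * y) (@ltr01 R); rewrite invr1.
have := scales_ge0_integral sc (f := fun x : Rm => (\1_A (x, y))%:E).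
rewrite mul1e => <-.
- by apply: eq_integral => x _; rewrite mul1r.
- apply/measurable_EFinP; have mz : measurable_fun setT (fun x : Rm => (x, y)).
    exact: measurable_fun_pair.
  have mi : measurable_fun setT (\1_A : Rm * Rm -> R) by exact: measurable_indic.
  exact: (measurableT_comp mi mz).
- by move=> x; rewrite lee_fin.
Qed.

Lemma scales_shear_snd (t : R) :
  scales_measure (leb \x leb)%E (fun z : Rm * Rm => (z.1, z.2 + t * z.1)) 1.
Proof.
have mf : measurable_fun setT (fun z : Rm * Rm => (z.1, z.2 + t * z.1 : Rm)).
  apply: measurable_fun_pair => //.
  by apply: measurable_funD => //; exact: measurable_funM.
split=> // A mA; rewrite mul1e.
have mA' : measurable ((fun z : Rm * Rm => (z.1, z.2 + t * z.1 : Rm)) @^-1` A).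
  by rewrite -[_ @^-1` _]setTI; exact: mf.
have ind (B : set (Rm * Rm)) : measurable B ->
    (leb \x leb)%E B = (\int[leb]_x \int[leb]_y (\1_B (x, y))%:E)%E.
  move=> mB; rewrite -[in LHS](setIT B) -integral_indic//.
  rewrite fubini_tonelli1//.
  by apply/measurable_EFinP; exact: measurable_indic.
apply: etrans (ind _ mA') _; apply: etrans (esym (ind _ mA)); apply: eq_integral => x _.
have sc : scales_measure leb (fun y : Rm => 1 * y + t * x) 1.
  by have := scales_affine (t * x) (@ltr01 R); rewrite invr1.
have := scales_ge0_integral sc (f := fun y : Rm => (\1_A (x, y))%:E).
rewrite mul1e => <-.
- by apply: eq_integral => y _; rewrite mul1r.
- apply/measurable_EFinP; have mz : measurable_fun setT (fun y : Rm => (x, y)).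
    exact: measurable_fun_pair.
  have mi : measurable_fun setT (\1_A : Rm * Rm -> R) by exact: measurable_indic.
  exact: (measurableT_comp mi mz).
- by move=> y; rewrite lee_fin.
Qed.

(* A rotation is a product of three shears unless its angle is pi mod 2 pi. *)
Lemma scales_rotation_shears (p : R) : cos (p / 2) != 0 ->
  scales_measure (leb \x leb)%E (rotation p : Rm * Rm -> Rm * Rm) 1.
Proof.
move=> c0; set t := tan (p / 2).
have := scales_comp (scales_shear (- t)) (scales_comp (scales_shear_snd (sin p)) (scales_shear (- t))).
rewrite !mulr1; congr (scales_measure _ _ _).
apply/funext => -[x y]; rewrite /rotation /=.
have pE : p = p / 2 + p / 2 by rewrite -splitr.
have sE : sin p = 2 * sin (p / 2) * cos (p / 2).
  by rewrite [in LHS]pE sinD; ring.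
have cE : cos p = cos (p / 2) ^+ 2 - sin (p / 2) ^+ 2.
  by rewrite [in LHS]pE cosD -!expr2.
have st : sin (p / 2) = t * cos (p / 2) by rewrite /t /tan divfK.
have t1 : 1 + t ^+ 2 != 0 by rewrite gt_eqF// ltr_pwDl// sqr_ge0.
have cc : cos (p / 2) ^+ 2 = (1 + t ^+ 2)^-1.
  apply: (mulIf t1); rewrite mulVf//.
  by rewrite mulrDr mulr1 -exprMn (mulrC _ t) -st cos2Dsin2.
have {}sE : sin p = 2 * t / (1 + t ^+ 2) by rewrite sE st -cc; ring.
have {}cE : cos p = (1 - t ^+ 2) / (1 + t ^+ 2) by rewrite cE st -cc; ring.
by congr pair; rewrite sE cE; field.
Qed.

Lemma rotationD (p q : R) (x : R * R) :
  rotation p (rotation q x) = rotation (p + q) x.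
Proof. by rewrite /rotation/= sinD cosD; congr pair; ring. Qed.

(** In the case left out by [scales_rotation_shears] the rotation is split into two of half the
    angle: if [cos (p / 2) = 0], the duplication formula forbids [cos (p / 4) = 0]. *)
Lemma scales_rotation (p : R) :
  scales_measure (leb \x leb)%E (rotation p : Rm * Rm -> Rm * Rm) 1.
Proof.
have [c0|c0] := eqVneq (cos (p / 2)) 0; last exact: scales_rotation_shears.
have c4 : cos (p / 2 / 2) != 0.
  apply/eqP => c40; have := c0; rewrite (splitr (p / 2)) cosD c40 mul0r sub0r.
  have := cos2Dsin2 (p / 2 / 2); rewrite c40 expr0n add0r expr2 => ->.
  by move=> /eqP; rewrite oppr_eq0 oner_eq0.
have h := scales_rotation_shears c4.
have := scales_comp h h; rewrite mulr1; congr (scales_measure _ _ _).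
by apply/funext => x; rewrite /= rotationD -splitr.
Qed.

End lebesgue_scaling.

(** * Fourier and Hilbert transforms on the plane *)

Section quaternion_components.
Variable R : realType.
Implicit Types p q : quaternion R.

Lemma quatM p q : p * q =
  Quat (q0 p * q0 q - q1 p * q1 q - q2 p * q2 q - q3 p * q3 q)
       (q0 p * q1 q + q1 p * q0 q + q2 p * q3 q - q3 p * q2 q)
       (q0 p * q2 q - q1 p * q3 q + q2 p * q0 q + q3 p * q1 q)
       (q0 p * q3 q + q1 p * q2 q - q2 p * q1 q + q3 p * q0 q).
Proof. by []. Qed.

Lemma quatD p q :
  p + q = Quat (q0 p + q0 q) (q1 p + q1 q) (q2 p + q2 q) (q3 p + q3 q).
Proof. by []. Qed.

Lemma quatN p : - p = Quat (- q0 p) (- q1 p) (- q2 p) (- q3 p).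
Proof. by []. Qed.

Definition quatE := (quatM, quatD, quatN).

End quaternion_components.

Lemma ipNN d (T : measurableType d) (R : realType) (mu : {measure set T -> \bar R})
    (f : T -> R) : f \in Lfun mu 2%:E ->
  ip mu (fun x => - f x) (fun x => - f x) = ip mu f f.
Proof. by move=> f2; rewrite ipNl ?L2N// ip_C ipNl ?L2N// opprK. Qed.

Lemma le_sum4 (R : realType) (a b c d : R) : 0 <= a -> 0 <= b -> 0 <= c -> 0 <= d ->
  [/\ a <= a + b + c + d, b <= a + b + c + d, c <= a + b + c + d
    & d <= a + b + c + d].
Proof. by move=> *; split; lra. Qed.

Section Lnorm2.
Context d (T : measurableType d) (R : realType).
Variable mu : {measure set T -> \bar R}.

Lemma Lnorm2E (w : T -> R) : w \in Lfun mu 2%:E ->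
  ('N[mu]_2%:E[(fun x => (w x)%:E)])%E = (Num.sqrt (ip mu w w))%:E.
Proof.
move=> w2; have iw := integrable_L2M w2 w2.
rewrite unlock /= (eq_integral (EFin \o (fun x => w x * w x))); last first.
  by move=> x _ /=; rewrite powR_mulrn// real_normK ?num_real// expr2.
rewrite -[X in poweR X _]fineK; last exact: integrable_fin_num.
by rewrite -/(Rintegral _ _ _) poweR_EFin powR12_sqrt// ip_ge0.
Qed.

Lemma cvg_Lnorm2 (w : (T -> R)^nat) : (forall n, w n \in Lfun mu 2%:E) ->
  ('N[mu]_2%:E[(fun x => (w n x)%:E)])%E @[n --> \oo] --> 0%E <->
  ip mu (w n) (w n) @[n --> \oo] --> (0 : R).
Proof.
move=> w2; rewrite (_ : (fun n => _) = (fun n => (Num.sqrt (ip mu (w n) (w n)))%:E)); last first.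
  by apply/funext => n; rewrite Lnorm2E.
split=> [h|h].
- have {}h : Num.sqrt (ip mu (w n) (w n)) @[n --> \oo] --> (0 : R) by exact: fine_cvg h.
  rewrite (_ : (fun n => _) = (fun n => Num.sqrt (ip mu (w n) (w n)) * Num.sqrt (ip mu (w n) (w n)))).
    by have := cvgM h h; rewrite mulr0; exact.
  by apply/funext => n; rewrite -expr2 sqr_sqrtr// ip_ge0.
- apply: cvg_EFin; first exact: nearW.
  by rewrite -(@sqrtr0 R); apply: continuous_cvg => //; exact: sqrt_continuous.
Qed.

Definition qL2_components (F : T -> quaternion R) :=
  [/\ q0 \o F \in Lfun mu 2%:E, q1 \o F \in Lfun mu 2%:E,
      q2 \o F \in Lfun mu 2%:E & q3 \o F \in Lfun mu 2%:E].

Lemma qnorm_ip (F : T -> quaternion R) : qL2_components F ->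
  (fun x => qnorm (F x)) \in Lfun mu 2%:E /\
  ip mu (fun x => qnorm (F x)) (fun x => qnorm (F x)) =
  ip mu (q0 \o F) (q0 \o F) + ip mu (q1 \o F) (q1 \o F) +
  ip mu (q2 \o F) (q2 \o F) + ip mu (q3 \o F) (q3 \o F).
Proof.
move=> [F0 F1 F2 F3].
have i0 := integrable_L2M F0 F0; have i1 := integrable_L2M F1 F1.
have i2 := integrable_L2M F2 F2; have i3 := integrable_L2M F3 F3.
have E x : qnorm (F x) * qnorm (F x) = q0 (F x) * q0 (F x) + q1 (F x) * q1 (F x)
    + q2 (F x) * q2 (F x) + q3 (F x) * q3 (F x).
  rewrite -expr2 /qnorm sqr_sqrtr; first by rewrite !expr2.
  by rewrite !addr_ge0 ?sqr_ge0.
have i01 := integrableD_EFin i0 i1.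
have i02 := integrableD_EFin i01 i2.
have i03 := integrableD_EFin i02 i3.
split.
  apply/L2P; split.
    apply: measurableT_comp; first exact: (continuous_measurable_fun (@sqrt_continuous R)).
    have m0 := L2_meas F0; have m1 := L2_meas F1.
    have m2 := L2_meas F2; have m3 := L2_meas F3.
    do 2! (apply: measurable_funD; last exact: measurable_funX).
    by apply: measurable_funD; exact: measurable_funX.
  rewrite (_ : (fun x => _) = fun x => q0 (F x) * q0 (F x) + q1 (F x) * q1 (F x)
    + q2 (F x) * q2 (F x) + q3 (F x) * q3 (F x))//.
  by apply/funext => x; rewrite expr2 E.
transitivity (\int[mu]_x (q0 (F x) * q0 (F x) + q1 (F x) * q1 (F x)
    + q2 (F x) * q2 (F x) + q3 (F x) * q3 (F x))).
  by apply: eq_Rintegral => x _; exact: E.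
by rewrite RintegralD// RintegralD// RintegralD.
Qed.

End Lnorm2.

Section fourier_transform.
Variable R : realType.
Local Notation leb := (@lebesgue_measure R).
Local Notation leb2 := (leb \x leb)%E.
Local Notation mu2 := (sfprod leb leb).
Local Notation L2 := (Lfun leb2 2%:E).
Local Notation L1 := (Lfun leb2 1%:E).
Local Notation cas2 := (square_ker (@cas_ker R)).
Local Notation Rm := (measurableTypeR R).
Implicit Types (h k : Rm * Rm -> R).

Definition is_W h k := is_transform mu2 cas2 h k.

Lemma cas2_contractive : contractive_kernel mu2 cas2.
Proof.
apply: (square_ker_contractive (cas_kernel_contractive R) (@damp_int R)
  (@damp_ge0 R) (@damp_nd R) (@damp_cvg R)).
- by move=> n x x'; rewrite reproducing_poisson poisson_ge0.
- move=> n x; under eq_integral do rewrite reproducing_poisson.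
  by rewrite integral_poisson.
Qed.

Lemma is_W_inv h k : is_W h k -> is_W k h.
Proof.
apply: (square_transform_involutive (cas_kernel_contractive R) (@damp_int R)
  (@damp_ge0 R) (@damp_nd R) (@damp_cvg R)).
- by move=> n x x'; rewrite reproducing_poisson poisson_ge0.
- move=> n x; under eq_integral do rewrite reproducing_poisson.
  by rewrite integral_poisson.
- exact: cas_transform_involutive.
Qed.

Lemma is_W_tensor u u' v v' : is_transform leb (@cas_ker R) u u' ->
  is_transform leb (@cas_ker R) v v' -> is_W (tensor u v) (tensor u' v').
Proof.
apply: (is_transform_tensor (cas_kernel_contractive R) (@damp_int R)
  (@damp_ge0 R) (@damp_nd R) (@damp_cvg R)).
- by move=> n x x'; rewrite reproducing_poisson poisson_ge0.
- move=> n x; under eq_integral do rewrite reproducing_poisson.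
  by rewrite integral_poisson.
Qed.

Definition reflect_coord (l : bool) (z : R * R) : R * R :=
  if l then (- z.1, z.2) else (z.1, - z.2).
Local Notation refl := reflect_coord.

Lemma scales_refl l : scales_measure leb2 (refl l : Rm * Rm -> Rm * Rm) 1.
Proof.
have := scales_prod (scales_opp R) (scales_id leb).
have := scales_prod (scales_id leb) (scales_opp R).
by rewrite mulr1; case: l.
Qed.

Lemma reflK l z : refl l (refl l z) = z.
Proof. by case: l z => -[x y]; rewrite /refl/= opprK. Qed.

Definition fourier_re h (f : R * R) := (h (refl true f) + h (refl false f)) / 2.
Definition fourier_im h (f : R * R) := - ((h f - h (refl true (refl false f))) / 2).
(* The Fourier transform of [h] in terms of the transform [k] of [h] with
   the kernel [cas (2 pi x_1 f_1) cas (2 pi x_2 f_2)]. *)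
Definition fourier_of k (f : R * R) : quaternion R :=
  Quat (fourier_re k f) 0 (fourier_im k f) 0.

Lemma fourier_re_L2 h : h \in L2 -> fourier_re h \in L2.
Proof.
move=> h2; rewrite (_ : fourier_re h = fun f => 2^-1 * ((h \o refl true) f + (h \o refl false) f)).
  by apply: L2Z; apply: L2D; exact: scales_L2 (scales_refl _) _ _.
by apply/funext => f; rewrite /fourier_re mulrC.
Qed.

Lemma fourier_im_L2 h : h \in L2 -> fourier_im h \in L2.
Proof.
move=> h2; rewrite (_ : fourier_im h = fun f => - (2^-1 * (h f - (h \o refl true \o refl false) f))).
  apply: L2N; apply: L2Z; apply: L2B => //.
  by do 2! apply: (scales_L2 (scales_refl _)).
by apply/funext => f; rewrite /fourier_im mulrC.
Qed.

Lemma L2_zero : (fun=> 0 : R) \in L2.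
Proof.
apply/L2P; split => //; rewrite (_ : _ \o _ = cst 0%E) ?integrable0//.
by apply/funext => x /=; rewrite expr0n.
Qed.

Lemma fourier_of_L2 h : h \in L2 -> qL2 (fourier_of h).
Proof.
move=> h2; by split; [exact: fourier_re_L2|exact: L2_zero|exact: fourier_im_L2|exact: L2_zero].
Qed.

(** [cos (a + b)] is half of [cas (- a) * cas b + cas a * cas (- b)], and [sin (a + b)] is half of
    [cas a * cas b - cas (- a) * cas (- b)]: single reflections give the cosine part, the identity
    and the double reflection the sine part. The minus sign of [fourier_im] comes from the negative
    exponent of the Fourier kernel. *)
Lemma fourier_L1E h : h \in L1 -> fourier_L1 h = fourier_of (hat mu2 cas2 h).
Proof.
move=> h1; apply/funext => f.
have ih z := @integrable_hat _ _ _ mu2 cas2 h z (ker_bs cas2_contractive) h1.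
have R0 : \int[leb2]_x (0 : R) = 0 by rewrite Rintegral_cst// mul0r.
have casc (a b : R) : cos (a + b) = 2^-1 * (cas (- a) * cas b + cas a * cas (- b)).
  by rewrite cosD /cas !cosN !sinN; field.
have cass (a b : R) : sin (a + b) = 2^-1 * (cas a * cas b - cas (- a) * cas (- b)).
  by rewrite sinD /cas !cosN !sinN; field.
rewrite /fourier_L1 /qintegral /fourier_of; congr Quat.
- transitivity (\int[leb2]_x (2^-1 * (h x * cas2 x (refl true f) + h x * cas2 x (refl false f)))).
    apply: eq_Rintegral => x _.
    rewrite quatE/= !(mul0r, mulr0, addr0, subr0).
    rewrite cosN (mulrDr (2 * pi)) casc /square_ker /cas_ker/=.
    rewrite !(mulNr, mulrN) !(mulrC x.1) !(mulrC x.2); ring.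
  rewrite RintegralZl//; last by apply: integrableD_EFin; exact: ih.
  by rewrite RintegralD//; try exact: ih; rewrite mulrC.
- rewrite -[RHS]R0; apply: eq_Rintegral => x _.
  by rewrite quatE/= !(mul0r, mulr0, addr0, subr0).
- transitivity (\int[leb2]_x (- 2^-1 * (h x * cas2 x f - h x * cas2 x (refl true (refl false f))))).
    apply: eq_Rintegral => x _.
    rewrite quatE/= !(mul0r, mulr0, addr0, subr0, add0r).
    rewrite sinN (mulrDr (2 * pi)) cass /square_ker /cas_ker/=.
    rewrite !(mulNr, mulrN) !(mulrC x.1) !(mulrC x.2); ring.
  rewrite RintegralZl//; last by apply: integrableB_EFin; exact: ih.
  by rewrite RintegralB//; try exact: ih; rewrite mulNr mulrC.
- rewrite -[RHS]R0; apply: eq_Rintegral => x _.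
  by rewrite quatE/= !(mul0r, mulr0, addr0, subr0).
Qed.

Lemma fourier_re_le h : h \in L2 ->
  ip leb2 (fourier_re h) (fourier_re h) <= ip leb2 h h.
Proof.
move=> h2; have r1 := scales_L2 (scales_refl true) h2.
have r2 := scales_L2 (scales_refl false) h2; have r12 := L2D r1 r2.
rewrite (_ : fourier_re h = fun f => 2^-1 * ((h \o refl true) f + (h \o refl false) f)); last first.
  by apply/funext => f; rewrite /fourier_re mulrC.
rewrite ipZl ?ipZr//; last exact: L2Z.
have := ipD_le r1 r2.
rewrite (scales_ip (scales_refl true) h2 h2) (scales_ip (scales_refl false) h2 h2).
by rewrite !mul1r; lra.
Qed.

Lemma fourier_im_le h : h \in L2 ->
  ip leb2 (fourier_im h) (fourier_im h) <= ip leb2 h h.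
Proof.
move=> h2; have r1 := scales_L2 (scales_refl true) h2.
have r2 := L2N (scales_L2 (scales_refl false) r1); have r12 := L2D h2 r2.
rewrite (_ : fourier_im h = fun f => (- 2^-1) *
    (h f + - (h \o refl true \o refl false) f)); last first.
  by apply/funext => f; rewrite /fourier_im mulrC mulNr.
rewrite ipZl ?ipZr//; last exact: L2Z.
have := ipD_le h2 r2; rewrite ipNN; last exact: (scales_L2 (scales_refl false) r1).
rewrite (scales_ip (scales_refl false) r1 r1) (scales_ip (scales_refl true) h2 h2).
by rewrite !mul1r; lra.
Qed.

Lemma fourier_ofB h k f :
  fourier_of h f - fourier_of k f = fourier_of (fun x => h x - k x) f.
Proof.
by rewrite /fourier_of quatE/= /fourier_re /fourier_im !(subr0, oppr0, addr0); congr Quat; field.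
Qed.

Lemma ip_zero : ip leb2 (fun=> 0) (fun=> 0) = 0.
Proof. by rewrite /ip; under eq_Rintegral do rewrite mulr0; rewrite Rintegral_cst// mul0r. Qed.

Lemma qnorm_fourier_of h : h \in L2 ->
  (fun f => qnorm (fourier_of h f)) \in L2 /\
  ip leb2 (fun f => qnorm (fourier_of h f)) (fun f => qnorm (fourier_of h f)) <=
    2 * ip leb2 h h.
Proof.
move=> h2; have [n2 ->] := @qnorm_ip _ _ _ leb2 _ (fourier_of_L2 h2).
split=> //; have := fourier_re_le h2; have := fourier_im_le h2.
by rewrite !ip_zero/= => *; lra.
Qed.

(** Truncations of [h] serve as the approximating sequence: [fourier_of] at most doubles squared
    norms, so the L2 convergence of their cas transforms carries over. *)
Lemma is_fourier_of h k : is_W h k -> is_fourier h (fourier_of k).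
Proof.
move=> hk; have [h2 k2 _] := hk; split; [exact: h2|exact: fourier_of_L2|].
have t1 n := trunc_L1 n h2; have t2 n := trunc_L2 n h2.
exists (trunc h); split=> //.
- apply/cvg_Lnorm2; last exact: (L2cvg_trunc h2).
  by move=> n; exact: L2B.
- have hc := is_transform_cvg cas2_contractive
    (fun n => is_transform_hat cas2_contractive (t1 n) (t2 n)) hk (L2cvg_trunc h2).
  have hh2 n : hat mu2 cas2 (trunc h n) \in L2 by exact: (hat_L2 cas2_contractive).
  have dL2 n := L2B (hh2 n) k2.
  have E n : (fun f => qnorm (fourier_L1 (trunc h n) f - fourier_of k f)) =
      (fun f => qnorm (fourier_of (fun x => hat mu2 cas2 (trunc h n) x - k x) f)).
    by apply/funext => f; rewrite fourier_L1E// fourier_ofB.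
  apply/cvg_Lnorm2 => [n|].
    by rewrite E; have [] := qnorm_fourier_of (dL2 n).
  apply: (@squeeze_cvgr _ _ _ _ (cst 0) (fun n => 2 *
    ip leb2 (fun x => hat mu2 cas2 (trunc h n) x - k x) (fun x => hat mu2 cas2 (trunc h n) x - k x))).
  + by apply: nearW => n; rewrite ip_ge0/= E; have [] := qnorm_fourier_of (dL2 n).
  + exact: cvg_cst.
  + by rewrite -[X in _ --> X](mulr0 2); apply: cvgM; [exact: cvg_cst|exact: hc].
Qed.

(** The approximants given by [is_fourier] are arbitrary, but contractivity forces their cas
    transforms to converge to [k]; each component of [F] is then an L2 limit of the same sequence as
    that component of [fourier_of k]. *)
Lemma is_fourier_unique h k F : is_W h k -> is_fourier h F ->
  {ae leb2, forall f, F f = fourier_of k f}.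
Proof.
move=> hk [_ F2 [u [u1 u2 /cvg_Lnorm2 uh uF]]]; have [h2 k2 _] := hk.
have {}uh := uh (fun n => L2B (u2 n) h2).
have hc := is_transform_cvg cas2_contractive
    (fun n => is_transform_hat cas2_contractive (u1 n) (u2 n)) hk uh.
pose v n := hat mu2 cas2 (u n).
have v2 n : v n \in L2 by exact: (hat_L2 cas2_contractive).
have dq n : qL2_components leb2 (fun f => fourier_of (v n) f - F f).
  have [a0 a1 a2 a3] := fourier_of_L2 (v2 n); have [b0 b1 b2 b3] := F2.
  by split; exact: L2B.
have E : (fun n => 'N[leb2]_2%:E[(fun f => (qnorm (fourier_L1 (u n) f - F f))%:E)])%E =
    (fun n => 'N[leb2]_2%:E[(fun f => (qnorm (fourier_of (v n) f - F f))%:E)])%E.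
  by apply/funext => n; rewrite fourier_L1E.
have {}uF : ip leb2 (fun f => qnorm (fourier_of (v n) f - F f))
    (fun f => qnorm (fourier_of (v n) f - F f)) @[n --> \oo] --> (0 : R).
  apply/cvg_Lnorm2; first by move=> n; have [] := qnorm_ip (dq n).
  by rewrite -E.
have comp (q : quaternion R -> R) :
    (forall n, ip leb2 (fun f => q (fourier_of (v n) f - F f)) (fun f => q (fourier_of (v n) f - F f)) <=
     ip leb2 (fun f => qnorm (fourier_of (v n) f - F f)) (fun f => qnorm (fourier_of (v n) f - F f))) ->
    (forall x y, q (x - y) = q x - q y) ->
    L2cvg leb2 (fun n => q \o fourier_of (v n)) (q \o F).
  move=> qle qB; rewrite /L2cvg.
  apply: (@squeeze_cvgr _ _ _ _ (cst 0) _) uF; last exact: cvg_cst.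
  apply: nearW => n; rewrite ip_ge0/=.
  by apply: le_trans (qle n); under eq_fun do rewrite -qB.
pose D n := fun f => fourier_of (v n) f - F f.
pose N n := ip leb2 (fun f => qnorm (D n f)) (fun f => qnorm (D n f)).
have le4 (n : nat) : [/\ ip leb2 (q0 \o D n) (q0 \o D n) <= N n,
    ip leb2 (q1 \o D n) (q1 \o D n) <= N n,
    ip leb2 (q2 \o D n) (q2 \o D n) <= N n &
    ip leb2 (q3 \o D n) (q3 \o D n) <= N n].
  have [_ NE] := qnorm_ip (dq n).
  rewrite /N NE -/(D n).
  exact: le_sum4 (ip_ge0 _ _) (ip_ge0 _ _) (ip_ge0 _ _) (ip_ge0 _ _).
have [F0 F1 F2' F3] := F2.
have reC : L2cvg leb2 (fun n => fourier_re (v n)) (fourier_re k).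
  apply: (@squeeze_cvgr _ _ _ _ (cst 0) _) hc; last exact: cvg_cst.
  apply: nearW => n; rewrite ip_ge0/=.
  apply: le_trans (fourier_re_le (L2B (v2 n) k2)).
  rewrite le_eqVlt; apply/orP; left; apply/eqP.
  by congr ip; apply/funext => f; rewrite /fourier_re; ring.
have imC : L2cvg leb2 (fun n => fourier_im (v n)) (fourier_im k).
  apply: (@squeeze_cvgr _ _ _ _ (cst 0) _) hc; last exact: cvg_cst.
  apply: nearW => n; rewrite ip_ge0/=.
  apply: le_trans (fourier_im_le (L2B (v2 n) k2)).
  rewrite le_eqVlt; apply/orP; left; apply/eqP.
  by congr ip; apply/funext => f; rewrite /fourier_im; ring.
have a0 := L2cvg_unique (fun n => fourier_re_L2 (v2 n)) F0 (fourier_re_L2 k2)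
  (comp q0 (fun n => let: And4 a _ _ _ := le4 n in a) (fun _ _ => erefl)) reC.
have a1 := L2cvg_unique (fun n => L2_zero) F1 L2_zero
  (comp q1 (fun n => let: And4 _ a _ _ := le4 n in a) (fun _ _ => erefl)) (L2cvg_cst L2_zero).
have a2 := L2cvg_unique (fun n => fourier_im_L2 (v2 n)) F2' (fourier_im_L2 k2)
  (comp q2 (fun n => let: And4 _ _ a _ := le4 n in a) (fun _ _ => erefl)) imC.
have a3 := L2cvg_unique (fun n => L2_zero) F3 L2_zero
  (comp q3 (fun n => let: And4 _ _ _ a := le4 n in a) (fun _ _ => erefl)) (L2cvg_cst L2_zero).
apply: filterS2 (filterI a0 a1) (filterI a2 a3) => f [/= e0 e1] [e2 e3].
by move: e0 e1 e2 e3; case: (F f) => ? ? ? ? /= -> -> -> ->.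
Qed.

End fourier_transform.

Lemma ae_filter_leb2 (R : realType) :
  Filter (almost_everywhere (@lebesgue_measure R \x @lebesgue_measure R)%E).
Proof.
exact: (@ae_filter_ringOfSetsType _ _ _ (@lebesgue_measure R \x @lebesgue_measure R)%E).
Qed.
#[local] Hint Extern 0 (Filter (nbhs (almost_everywhere _))) =>
  (exact: ae_filter_leb2) : typeclass_instances.

Section hilbert_transform.
Variable R : realType.
Local Notation leb := (@lebesgue_measure R).
Local Notation leb2 := (leb \x leb)%E.
Local Notation mu2 := (sfprod leb leb).
Local Notation L2 := (Lfun leb2 2%:E).
Local Notation Rm := (measurableTypeR R).
Local Notation refl := (@reflect_coord R).
Implicit Types (h k : Rm * Rm -> R).

Definition axis (l : bool) : R * R -> R := if l then fst else snd.

Definition sgn_reflect l h (f : Rm * Rm) := Num.sg (axis l f) * h (refl l f).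

Lemma measurable_sgr : measurable_fun setT (Num.sg : Rm -> Rm).
Proof.
rewrite (_ : Num.sg = fun x : R => if 0 < x then 1 else if x < 0 then -1 else 0).
  by apply: measurable_fun_ifT => //; [exact: measurable_fun_ltr|];
     apply: measurable_fun_ifT => //; exact: measurable_fun_ltr.
by apply/funext => x; case: (ltrgtP x 0) => [/ltr0_sg|/gtr0_sg|->] //; rewrite ?sgr0.
Qed.

Lemma measurable_axis l : measurable_fun setT (axis l : Rm * Rm -> Rm).
Proof. by case: l; [exact: measurable_fst|exact: measurable_snd]. Qed.

Lemma sgr_le1 (x : R) : `|Num.sg x| <= 1.
Proof. by rewrite normr_sg; case: (x != 0); rewrite ?ler01. Qed.

Lemma sgn_reflect_L2 l h : h \in L2 -> sgn_reflect l h \in L2.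
Proof.
move=> h2; apply: (@L2_bounded _ _ _ leb2 (fun f => Num.sg (axis l f)) (h \o refl l) 1).
- exact: (measurableT_comp measurable_sgr (measurable_axis l)).
- by move=> f; exact: sgr_le1.
- exact: (scales_L2 (scales_refl R l)).
Qed.

(** Reflecting one axis exchanges the points used by [fourier_re] and [fourier_im], just as
    multiplication by [- qj] exchanges the two parts; the oddness of the sign supplies the signs. *)
Lemma fourier_of_sgn_reflect l k f : fourier_of (sgn_reflect l k) f =
  - qj * qreal (Num.sg (axis l f)) * fourier_of k f.
Proof.
rewrite /fourier_of /fourier_re /fourier_im /sgn_reflect !quatE/=.
by case: l => /=; rewrite ?sgrN ?opprK; case: f => x y /=; congr Quat; field.
Qed.

(** A value of [h] is recovered from the sine part at the point and the cosine part at its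
    reflection, so the hypothesis is used at both. *)
Lemma fourier_of_inj h k : {ae leb2, forall f, fourier_of h f = fourier_of k f} ->
  {ae leb2, forall f, h f = k f}.
Proof.
move=> hk; have hk1 : {ae leb2, forall f, fourier_of h (refl true f) = fourier_of k (refl true f)}.
  exact: (scales_ae (scales_refl R true) hk).
apply: filterS2 hk hk1 => -[x y] [e0 e2] [e1 e3].
have inv g : g (x, y) = - fourier_im g (x, y) + fourier_re g (refl true (x, y)).
  by rewrite /fourier_im /fourier_re /= !opprK; field.
by rewrite (inv h) (inv k) e2 e1.
Qed.

Lemma fourierP h : h \in L2 -> is_fourier h (fourier h).
Proof.
move=> h2; have [k hk] := is_transform_exists (cas2_contractive R) h2.
rewrite /fourier; case: xgetP => [F -> //|]; move=> /(_ (fourier_of k)).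
by case; exact: is_fourier_of.
Qed.

Lemma is_fourier_ae h F G : is_fourier h F -> qL2 G ->
  {ae leb2, forall f, F f = G f} -> is_fourier h G.
Proof.
move=> [h2 F2 [u [u1 u2 uh uF]]] G2 FG; split => //; exists u; split => //.
suff E : (fun n => 'N[leb2]_2%:E[(fun f => (qnorm (fourier_L1 (u n) f - G f))%:E)])%E =
    (fun n => 'N[leb2]_2%:E[(fun f => (qnorm (fourier_L1 (u n) f - F f))%:E)])%E.
  by rewrite E.
apply/funext => n; have K := cas2_contractive R.
have hu2 : hat mu2 (square_ker (@cas_ker R)) (u n) \in L2 by exact: (hat_L2 K).
have q (H : R * R -> quaternion R) : qL2 H ->
    qL2_components leb2 (fun f => fourier_L1 (u n) f - H f).
  move=> [b0 b1 b2 b3]; rewrite fourier_L1E//.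
  by have [a0 a1 a2 a3] := fourier_of_L2 hu2; split; exact: L2B.
have [nF _] := qnorm_ip (q F F2); have [nG _] := qnorm_ip (q G G2).
rewrite !Lnorm2E//; congr (Num.sqrt _)%:E; apply: ip_ae => //.
  by apply: filterS FG => f ->.
by apply: filterS FG => f ->.
Qed.

(** The set from which [hilbert] picks is first shown inhabited, the witness being the inverse
    transform of [sgn_reflect l k]. Uniqueness of Fourier transforms and injectivity of [fourier_of]
    then identify the transform of whatever was picked. *)
Lemma hilbert_W l h k : is_W h k -> is_W (hilbert (axis l) h) (sgn_reflect l k).
Proof.
move=> hk; have [h2 k2 _] := hk.
have FE := is_fourier_unique hk (fourierP h2).
pose G f := - qj * qreal (Num.sg (axis l f)) * fourier h f.
have s2 := sgn_reflect_L2 l k2.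
have GE : {ae leb2, forall f, fourier_of (sgn_reflect l k) f = G f}.
  by apply: filterS FE => f Ff; rewrite fourier_of_sgn_reflect /G Ff.
have G2 : qL2 G.
  have [_ [a0 a1 a2 a3] _] := fourierP h2.
  have bd (p : R * R -> R) : p \in L2 -> (fun f => Num.sg (axis l f) * p f) \in L2.
    apply: (@L2_bounded _ _ _ leb2 (fun f => Num.sg (axis l f)) p 1).
      exact: (measurableT_comp measurable_sgr (measurable_axis l)).
    by move=> f; exact: sgr_le1.
  have GC f : G f = Quat (Num.sg (axis l f) * q2 (fourier h f))
    (- (Num.sg (axis l f) * q3 (fourier h f)))
    (- (Num.sg (axis l f) * q0 (fourier h f)))
    (Num.sg (axis l f) * q1 (fourier h f)).
    by rewrite /G !quatE/=; congr Quat; ring.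
  split.
  - by rewrite (_ : _ \o _ = fun f => Num.sg (axis l f) * (q2 \o fourier h) f); [exact: bd|apply/funext => f; exact: (congr1 q0 (GC f))].
  - by rewrite (_ : _ \o _ = fun f => - (Num.sg (axis l f) * (q3 \o fourier h) f)); [apply: L2N; exact: bd|apply/funext => f; exact: (congr1 q1 (GC f))].
  - by rewrite (_ : _ \o _ = fun f => - (Num.sg (axis l f) * (q0 \o fourier h) f)); [apply: L2N; exact: bd|apply/funext => f; exact: (congr1 q2 (GC f))].
  - by rewrite (_ : _ \o _ = fun f => Num.sg (axis l f) * (q1 \o fourier h) f); [exact: bd|apply/funext => f; exact: (congr1 q3 (GC f))].
have [h' sh'] := is_transform_exists (cas2_contractive R) s2.
have h's := is_W_inv sh'.
have hil : is_hilbert (axis l) h (hilbert (axis l) h).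
  rewrite /hilbert; case: xgetP => [g -> //|]; move=> /(_ h'); case.
  exact: is_fourier_ae (is_fourier_of h's) G2 GE.
have [hil2 _ _] := hil.
have [k' hk'] := is_transform_exists (cas2_contractive R) hil2.
have E := is_fourier_unique hk' hil.
have [_ k'2 _] := hk'.
apply: (is_transform_ae (cas2_contractive R) hk').
- exact: L2_meas hil2.
- exact: L2_meas s2.
- exact: aeW.
- by apply: fourier_of_inj; apply: filterS2 E GE => f <- ->.
Qed.

End hilbert_transform.

(** * Dilations, translations and polar forms *)

Lemma L2cvg_scales d (T : measurableType d) (R : realType)
    (mu : {measure set T -> \bar R}) (phi : T -> T) (r : R)
    (u : (T -> R)^nat) (f : T -> R) : scales_measure mu phi r ->
  (forall n, u n \in Lfun mu 2%:E) -> f \in Lfun mu 2%:E -> L2cvg mu u f ->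
  L2cvg mu (fun n => u n \o phi) (f \o phi).
Proof.
move=> sc u2 f2 uf; rewrite /L2cvg.
rewrite (_ : (fun n => _) = (fun n => r * ip mu (fun x => u n x - f x) (fun x => u n x - f x))).
  by rewrite -[X in _ --> X](mulr0 r); apply: cvgM; [exact: cvg_cst|exact: uf].
by apply/funext => n; rewrite -(scales_ip sc (L2B (u2 n) f2) (L2B (u2 n) f2)).
Qed.

Section affine_covariance.
Variable R : realType.
Local Notation leb := (@lebesgue_measure R).
Local Notation Rm := (measurableTypeR R).
Local Notation L2 := (Lfun leb 2%:E).
Local Notation V := (is_transform leb (@cas_ker R)).
Implicit Types (h k u : Rm -> R).

Variables (a b : R).
Hypothesis a0 : 0 < a.

Let aff (t : Rm) : Rm := a * t + b.
Let dil (t : Rm) : Rm := a^-1 * t + 0.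

(* The transform of [h \o aff] in terms of the transform [k] of [h]. *)
Definition affine_transform k (y : Rm) : R := a^-1 *
  (cos (2 * pi * b * (a^-1 * y)) * k (a^-1 * y) -
   sin (2 * pi * b * (a^-1 * y)) * k (- (a^-1 * y))).

Let scA : scales_measure leb aff a^-1. Proof. exact: scales_affine. Qed.
Let scD : scales_measure leb dil (a^-1)^-1.
Proof. by apply: scales_affine; rewrite invr_gt0. Qed.
Let scO : scales_measure leb (-%R \o dil : Rm -> Rm) ((a^-1)^-1 * 1).
Proof. exact: scales_comp (scales_opp R) scD. Qed.

Let mtrig (f : R -> R) : continuous f ->
  measurable_fun setT (fun y : Rm => f (2 * pi * b * (a^-1 * y))).
Proof.
move=> cf; apply: measurableT_comp; first exact: continuous_measurable_fun.
by do 2! apply: measurable_funM => //.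
Qed.

Let cos_bd (y : Rm) : `|cos (2 * pi * b * (a^-1 * y))| <= 1 :> R.
Proof. by rewrite ler_norml cos_geN1 cos_le1. Qed.
Let sin_bd (y : Rm) : `|sin (2 * pi * b * (a^-1 * y))| <= 1 :> R.
Proof. by rewrite ler_norml sin_geN1 sin_le1. Qed.
Let mcos := mtrig (@continuous_cos R).
Let msin := mtrig (@continuous_sin R).

Let affine_transformE k : affine_transform k = fun y => a^-1 *
  (cos (2 * pi * b * (a^-1 * y)) * (k \o dil) y -
   sin (2 * pi * b * (a^-1 * y)) * (k \o (-%R \o dil)) y).
Proof. by apply/funext => y; rewrite /affine_transform /= /dil addr0. Qed.

Lemma affine_transform_L2 k : k \in L2 -> affine_transform k \in L2.
Proof.
move=> k2; rewrite affine_transformE; apply: L2Z; apply: L2B.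
- by apply: (L2_bounded mcos cos_bd); exact: (scales_L2 scD).
- by apply: (L2_bounded msin sin_bd); exact: (scales_L2 scO).
Qed.

Lemma affine_transform_cvg (v : (Rm -> R)^nat) k : (forall n, v n \in L2) ->
  k \in L2 -> L2cvg leb v k ->
  L2cvg leb (fun n => affine_transform (v n)) (affine_transform k).
Proof.
move=> v2 k2 vk; rewrite affine_transformE.
rewrite (_ : (fun n => affine_transform (v n)) = (fun n y => a^-1 *
  (cos (2 * pi * b * (a^-1 * y)) * (v n \o dil) y -
   sin (2 * pi * b * (a^-1 * y)) * (v n \o (-%R \o dil)) y))); last first.
  by apply/funext => n; rewrite affine_transformE.
have vD2 n : v n \o dil \in L2 by exact: (scales_L2 scD).
have vO2 n : v n \o (-%R \o dil) \in L2 by exact: (scales_L2 scO).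
have kD2 : k \o dil \in L2 by exact: (scales_L2 scD).
have kO2 : k \o (-%R \o dil) \in L2 by exact: (scales_L2 scO).
apply: (@L2cvg_bounded _ _ _ leb (fun=> a^-1) `|a^-1|) => //.
- by move=> n; apply: L2B; [exact: (L2_bounded mcos cos_bd)|exact: (L2_bounded msin sin_bd)].
- by apply: L2B; [exact: (L2_bounded mcos cos_bd)|exact: (L2_bounded msin sin_bd)].
apply: L2cvgB.
- by move=> n; exact: (L2_bounded mcos cos_bd).
- by move=> n; exact: (L2_bounded msin sin_bd).
- exact: (L2_bounded mcos cos_bd).
- exact: (L2_bounded msin sin_bd).
- by apply: (L2cvg_bounded mcos cos_bd) => //; exact: L2cvg_scales scD v2 k2 vk.
- by apply: (L2cvg_bounded msin sin_bd) => //; exact: L2cvg_scales scO v2 k2 vk.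
Qed.

(** [x * y = (a * x + b) * (y / a) - b * (y / a)], and [cas (A - B) = cos B * cas A - sin B * cas (-
    A)]. *)
Lemma hat_affine u : u \in Lfun leb 1%:E ->
  hat leb (@cas_ker R) (u \o aff) = affine_transform (hat leb (@cas_ker R) u).
Proof.
move=> u1; apply/funext => y.
have bs := @cas_kernel_bs R.
have iu z := @integrable_hat _ _ _ leb (@cas_ker R) u z bs u1.
have an0 : a != 0 by rewrite gt_eqF.
pose B := 2 * pi * b * (a^-1 * y).
pose f (z : Rm) := cos B * (u z * cas_ker z (a^-1 * y)) - sin B * (u z * cas_ker z (- (a^-1 * y))).
have if_ : leb.-integrable setT (EFin \o f).
  by apply: integrableB_EFin; apply: integrableZl_EFin; exact: iu.
transitivity (\int[leb]_x f (aff x)).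
  apply: eq_Rintegral => x _; rewrite /f /= /cas_ker mulrN mulrN.
  rewrite (_ : x * y = aff x * (a^-1 * y) - b * (a^-1 * y)); last by rewrite /aff; field.
  rewrite mulrBr [2 * pi * (b * _)]mulrA -/B /cas cosB sinB cosN sinN; ring.
rewrite (scales_Rintegral scA if_) /affine_transform; congr (_ * _).
by rewrite RintegralB//; try (by apply: integrableZl_EFin; exact: iu); rewrite !RintegralZl//; exact: iu.
Qed.

Lemma is_transform_affine h k : V h k -> V (h \o aff) (affine_transform k).
Proof.
move=> hk; have [h2 k2 _] := hk; have K := cas_kernel_contractive R.
have t1 n := trunc_L1 n h2; have t2 n := trunc_L2 n h2.
have hc := is_transform_cvg K (fun n => is_transform_hat K (t1 n) (t2 n)) hk (L2cvg_trunc h2).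
have hh2 n := hat_L2 K (t1 n) (t2 n).
apply: (@is_transform_lim _ _ _ leb _ K (fun n => trunc h n \o aff)
  (fun n => affine_transform (hat leb (@cas_ker R) (trunc h n)))).
- move=> n; rewrite -hat_affine//; apply: (is_transform_hat K).
  + exact: (scales_L1 scA).
  + exact: (scales_L2 scA).
- exact: (scales_L2 scA).
- exact: affine_transform_L2.
- exact: L2cvg_scales scA t2 h2 (L2cvg_trunc h2).
- exact: affine_transform_cvg.
Qed.

(** On the transform side, this is the commutation of the one-dimensional Hilbert transform with
    translations and positive dilations: [a > 0] preserves signs, and the oddness of the sign
    matches that of the sine. *)
Lemma affine_transform_sgn k :
  affine_transform (fun y => Num.sg y * k (- y)) =
  (fun y => Num.sg y * affine_transform k (- y)).
Proof.
apply/funext => y; rewrite /affine_transform.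
have sE : Num.sg (a^-1 * y) = Num.sg y by rewrite sgrM gtr0_sg ?invr_gt0// mul1r.
rewrite sgrN sE !opprK !mulrN cosN sinN opprK; ring.
Qed.

End affine_covariance.

(** * Polar forms of product quaternions *)

Section polar.
Variable R : realType.

Lemma polar_coordinates (x y : R) : exists t,
  x = Num.sqrt (x ^+ 2 + y ^+ 2) * cos (2 * pi * t) /\
  y = Num.sqrt (x ^+ 2 + y ^+ 2) * sin (2 * pi * t).
Proof.
set r := Num.sqrt _; have p2 : 2 * pi != 0 :> R by rewrite mulf_neq0// gt_eqF// pi_gt0.
have r2 : r ^+ 2 = x ^+ 2 + y ^+ 2 by rewrite sqr_sqrtr// addr_ge0// sqr_ge0.
suff [t [xt yt]] : exists t, x = r * cos t /\ y = r * sin t.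
  by exists (t / (2 * pi)); rewrite (mulrC (2 * pi)) divfK.
have [r0|r0] := eqVneq r 0.
  exists 0; rewrite r0 !mul0r; move: r2; rewrite r0 expr0n => /esym/eqP.
  by rewrite paddr_eq0 ?sqr_ge0// !sqrf_eq0 => /andP[/eqP -> /eqP ->].
have rp : 0 < r by rewrite lt_neqAle eq_sym r0 sqrtr_ge0.
have xr : -1 <= x / r <= 1.
  rewrite -ler_norml normrM normfV (gtr0_norm rp) ler_pdivrMr// mul1r.
  by rewrite -sqrtr_sqr ler_sqrt ?addr_ge0 ?sqr_ge0// lerDl sqr_ge0.
have xc : x = r * cos (acos (x / r)).
  by rewrite acosK ?in_itv//= mulrC divfK.
have ys : `|y| = r * sin (acos (x / r)).
  rewrite sin_acos//; apply/eqP; rewrite -(@eqrXn2 _ 2)// ?mulr_ge0 ?sqrtr_ge0//.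
  have h : 0 <= 1 - (x / r) ^+ 2.
    by rewrite subr_ge0 -real_normK ?num_real// expr_le1// ler_norml.
  rewrite real_normK ?num_real// exprMn (sqr_sqrtr h).
  by rewrite mulrBr mulr1 -exprMn (mulrC r) divfK// r2; apply/eqP; ring.
have [y0|y0] := leP 0 y.
  by exists (acos (x / r)); split => //; rewrite -ys ger0_norm.
exists (- acos (x / r)); rewrite cosN sinN mulrN -ys ltr0_norm// opprK.
by split.
Qed.

(** After expansion the left-hand side depends on the angles only through the four products of [n]
    with a cosine or sine of each angle, which are the components of [q]; so it does not matter
    which pair [polar_angles] picks. That a pair exists follows from polar coordinates of the two
    planar factors. *)
Lemma phase_of_product (x y x' y' s t : R) :
  let q := Quat (x * x') (y * x') (x * y') (y * y') in
  let ab := polar_angles q in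
  qnorm q * cos (2 * pi * ab.1 - s) * cos (2 * pi * ab.2 - t) =
  (cos s * x + sin s * y) * (cos t * x' + sin t * y').
Proof.
move=> q ab.
have [al [xa ya]] := polar_coordinates x y.
have [be [xb yb]] := polar_coordinates x' y'.
have qn : qnorm q = Num.sqrt (x ^+ 2 + y ^+ 2) * Num.sqrt (x' ^+ 2 + y' ^+ 2).
  rewrite -sqrtrM; last by rewrite addr_ge0// sqr_ge0.
  by rewrite /qnorm /=; congr Num.sqrt; ring.
have pol : is_polar q (al, be).
  rewrite /is_polar qn /= /q /qexp !quatE/=; set r := Num.sqrt _; set r' := Num.sqrt _.
  rewrite -/r -/r' in xa ya xb yb.
  rewrite [in LHS]xa [in LHS]ya [in LHS]xb [in LHS]yb.
  by congr Quat; ring.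
have : is_polar q ab.
  by rewrite /ab /polar_angles; case: xgetP => [z -> //|/(_ (al, be))].
rewrite /is_polar /qexp !quatE/= => -[e0 e1 e2 e3].
rewrite !cosB; move: e0 e1 e2 e3; set n := qnorm q.
set A := cos (2 * pi * ab.1); set A' := sin (2 * pi * ab.1).
set B := cos (2 * pi * ab.2); set B' := sin (2 * pi * ab.2) => e0 e1 e2 e3.
have -> : n * (A * cos s + A' * sin s) * (B * cos t + B' * sin t) =
  cos s * cos t * (n * A * B) + sin s * cos t * (n * A' * B) +
  cos s * sin t * (n * A * B') + sin s * sin t * (n * A' * B') by ring.
have {}e0 : n * A * B = x * x' by rewrite e0; ring.
have {}e1 : n * A' * B = y * x' by rewrite e1; ring.
have {}e2 : n * A * B' = x * y' by rewrite e2; ring.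
have {}e3 : n * A' * B' = y * y' by rewrite e3; ring.
by rewrite e0 e1 e2 e3; ring.
Qed.

End polar.

(** * Skewness of the Hilbert transforms *)

Section ae_integral.
Context d (T : measurableType d) (R : realType).
Variable mu : {measure set T -> \bar R}.

Import HBNNSimple.

(** A simple function below [f], set to 0 on the null set [N], lies below [g] and keeps its
    integral. *)
Let ge0_ae_le_integral_nomeas (f g : T -> \bar R) : (forall x, 0 <= f x)%E ->
  (forall x, 0 <= g x)%E -> {ae mu, forall x, f x = g x} ->
  (\int[mu]_x f x <= \int[mu]_x g x)%E.
Proof.
move=> f0 g0 [N [mN N0 sN]]; rewrite !ge0_integralTE//.
apply/ge_ereal_sup => /= _ [h /= hf <-].
have mNC : measurable (~` N) by exact: measurableC.
apply: ereal_sup_ubound; exists (proj_nnsfun h mNC).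
  move=> x; rewrite /= mindicE; case: (boolP (x \in ~` N)) => [|_].
    rewrite inE mulr1 => xN; have <- // : f x = g x.
    by apply: contrapT => fg; apply: xN; exact: sN.
  by rewrite mulr0.
rewrite -!integralT_nnsfun; apply: ge0_ae_eq_integral => //.
- exact/measurable_EFinP.
- exact/measurable_EFinP.
- by move=> x _; rewrite lee_fin.
- by move=> x _; rewrite lee_fin.
exists N; split => // x /=; apply: contra_notP => xN _.
by rewrite mindicE mem_set// mulr1.
Qed.

(* No measurability is needed: the lower integral ignores null sets. *)
Lemma ae_eq_Rintegral_nomeas (f g : T -> R) : {ae mu, forall x, f x = g x} ->
  \int[mu]_x f x = \int[mu]_x g x.
Proof.
have ge0 (p q : T -> \bar R) : (forall x, 0 <= p x)%E -> (forall x, 0 <= q x)%E ->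
    {ae mu, forall x, p x = q x} -> (\int[mu]_x p x = \int[mu]_x q x)%E.
  move=> p0 q0 pq; apply/eqP; rewrite eq_le !ge0_ae_le_integral_nomeas//.
  by apply: filterS pq.
move=> fg; congr fine; rewrite integralE [RHS]integralE.
by congr (_ - _)%E; apply: ge0 => //; apply: filterS fg => x fgx;
  rewrite ?funeposE ?funenegE fgx.
Qed.

End ae_integral.

Section hilbert_skew.
Variable R : realType.
Local Notation leb := (@lebesgue_measure R).
Local Notation leb2 := (leb \x leb)%E.
Local Notation L2 := (Lfun leb2 2%:E).
Local Notation Rm := (measurableTypeR R).
Local Notation refl := (@reflect_coord R).
Local Notation S := (@sgn_reflect R).
Implicit Types (h k : Rm * Rm -> R).

Lemma axis_refl l f : axis l (refl l f) = - axis l f :> R.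
Proof. by case: l f => -[]. Qed.

Lemma ae_axis_neq0 l : {ae leb2, forall f, axis l f != 0 :> R}.
Proof.
have m0 : leb [set 0] = 0%E by exact: lebesgue_measure_set1.
case: l.
- exists ([set 0] `*` setT); split.
  + by apply: measurableX => //; exact: measurable_set1.
  + apply: etrans (product_measure1E leb leb (measurable_set1 0) measurableT) _.
    by rewrite [X in (X * _)%E]m0 mul0e.
  + by move=> [x y] /= /negP/negPn/eqP ->.
- exists (setT `*` [set 0]); split.
  + by apply: measurableX => //; exact: measurable_set1.
  + apply: etrans (product_measure1E leb leb measurableT (measurable_set1 0)) _.
    by rewrite [X in (_ * X)%E]m0 mule0.
  + by move=> [x y] /= /negP/negPn/eqP ->.
Qed.

(** Change variables by the reflection: it preserves the measure and flips the sign of the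
    coordinate on [axis l]. *)
Lemma sgn_reflect_skew l h k : h \in L2 -> k \in L2 ->
  ip leb2 (S l h) k = - ip leb2 h (S l k).
Proof.
move=> h2 k2; have i := integrable_L2M (sgn_reflect_L2 l h2) k2.
have := scales_Rintegral (scales_refl R l) i; rewrite mul1r => {i} E.
apply: etrans (esym E) _.
rewrite -mulN1r -RintegralZl//; last exact: integrable_L2M h2 (sgn_reflect_L2 l k2).
apply: eq_Rintegral => f _; rewrite /sgn_reflect reflK axis_refl sgrN; ring.
Qed.

(** The identity may fail where the coordinate vanishes and [Num.sg] is 0; that line is a null
    set. *)
Lemma sgn_reflectK l k : {ae leb2, forall f, S l (S l k) f = - k f}.
Proof.
apply: filterS (ae_axis_neq0 l) => f f0.
rewrite /sgn_reflect reflK axis_refl sgrN mulrA mulrN -expr2 sqr_sg f0.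
by rewrite mulN1r.
Qed.

Lemma sgn_reflectC l l' k : S l (S l' k) = S l' (S l k).
Proof.
apply/funext => -[x y]; rewrite /sgn_reflect.
by case: l l' => -[]; rewrite //= mulrCA.
Qed.

Lemma sgn_reflect_isometry l h k : h \in L2 -> k \in L2 ->
  ip leb2 (S l h) (S l k) = ip leb2 h k.
Proof.
move=> h2 k2; have Sk2 := sgn_reflect_L2 l k2; have SSk2 := sgn_reflect_L2 l Sk2.
rewrite sgn_reflect_skew//.
rewrite (ip_ae h2 h2 SSk2 (L2N k2) (aeW _ (fun=> erefl)) (sgn_reflectK l k)).
by rewrite ip_C ipNl// opprK ip_C.
Qed.

End hilbert_skew.

(** * Phase shifts and the wavelet transform *)

Section phase_shift_theorem.
Variable R : realType.
Local Notation leb := (@lebesgue_measure R).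
Local Notation leb2 := (leb \x leb)%E.
Local Notation L2 := (Lfun leb2 2%:E).
Local Notation Rm := (measurableTypeR R).
Local Notation S := (@sgn_reflect R).
Local Notation V := (is_transform leb (@cas_ker R)).
Implicit Types (h k : Rm * Rm -> R).

Definition sgn_opp (k : Rm -> R) (y : Rm) : R := Num.sg y * k (- y).

Lemma sgn_opp_L2 (k : Rm -> R) : k \in Lfun leb 2%:E ->
  sgn_opp k \in Lfun leb 2%:E.
Proof.
move=> k2; apply: (@L2_bounded _ _ _ leb (fun y => Num.sg y) (k \o -%R) 1).
- exact: measurable_sgr.
- by move=> f; exact: sgr_le1.
- exact: (scales_L2 (scales_opp R)).
Qed.

(* [G] is the one-dimensional Hilbert transform of [g]. *)
Lemma hilbert1D_exists (g : Rm -> R) : g \in Lfun leb 2%:E ->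
  exists (k' G : Rm -> R), V g k' /\ V G (sgn_opp k').
Proof.
move=> g2; have K := cas_kernel_contractive R.
have [k gk] := is_transform_exists K g2; have [_ k2 _] := gk.
have [G kG] := is_transform_exists K (sgn_opp_L2 k2).
by exists k, G; split => //; exact: cas_transform_involutive.
Qed.

Lemma sgn_reflect_tensor_fst (k1 k2 : Rm -> R) :
  S true (tensor k1 k2) = tensor (sgn_opp k1) k2.
Proof. by apply/funext => z; rewrite /sgn_reflect /tensor /sgn_opp/= mulrA. Qed.

Lemma sgn_reflect_tensor_snd (k1 k2 : Rm -> R) :
  S false (tensor k1 k2) = tensor k1 (sgn_opp k2).
Proof. by apply/funext => z; rewrite /sgn_reflect /tensor /sgn_opp/= mulrCA. Qed.

Lemma is_W_unique h h' k : is_W h k -> is_W h' k ->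
  {ae leb2, forall x, h x = h' x}.
Proof.
move=> /is_W_inv kh /is_W_inv kh'.
by apply: (is_transform_unique (cas2_contractive R) kh kh'); exact: aeW.
Qed.

Lemma ip_W h h' k k' : is_W h k -> is_W h' k' -> ip leb2 h h' = ip leb2 k k'.
Proof.
by move=> hk /is_W_inv kh'; rewrite -(is_transform_sym (cas2_contractive R) hk kh').
Qed.

(** Both sides of each equation have the same W-transform, because on tensor products [S] acts on a
    single factor, through [sgn_opp]. *)
Lemma hilbert_tensor (g1 g2 G1 G2 k1 k2 : Rm -> R) :
  V g1 k1 -> V g2 k2 -> V G1 (sgn_opp k1) -> V G2 (sgn_opp k2) ->
  {ae leb2, forall z, [/\ hilbert1 (tensor g1 g2) z = tensor G1 g2 z,
    hilbert2 (tensor g1 g2) z = tensor g1 G2 z &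
    hilbert1 (hilbert2 (tensor g1 g2)) z = tensor G1 G2 z]}.
Proof.
move=> v1 v2 V1 V2; have w := is_W_tensor v1 v2.
have e1 := hilbert_W true w; rewrite sgn_reflect_tensor_fst in e1.
have e2 := hilbert_W false w; rewrite sgn_reflect_tensor_snd in e2.
have e3 := hilbert_W true e2; rewrite sgn_reflect_tensor_fst in e3.
have h1 := is_W_unique e1 (is_W_tensor V1 v2).
have h2 := is_W_unique e2 (is_W_tensor v1 V2).
have h3 := is_W_unique e3 (is_W_tensor V1 V2).
by apply: filterS3 h1 h2 h3 => z a1 a2 a3; split.
Qed.

Definition wavelet_coordinates (a theta : R) (b x : R * R) : R * R :=
  let y := rotation (- theta) (x.1 - b.1, x.2 - b.2) in (y.1 / a, y.2 / a).

Lemma scales_wavelet_coordinates (a theta : R) (b : R * R) : 0 < a ->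
  scales_measure leb2 (wavelet_coordinates a theta b : Rm * Rm -> Rm * Rm) (a * a).
Proof.
move=> a0; have ai0 : 0 < a^-1 by rewrite invr_gt0.
have d := scales_prod (scales_affine 0 ai0) (scales_affine 0 ai0).
have t := scales_prod (scales_affine (- b.1) (@ltr01 R)) (scales_affine (- b.2) (@ltr01 R)).
have := scales_comp d (scales_comp (scales_rotation (- theta)) t).
rewrite invrK invr1 !mul1r; congr (scales_measure _ _ _).
apply/funext => x; rewrite /wavelet_coordinates/= !mul1r !addr0.
by rewrite !(mulrC a^-1).
Qed.

Lemma wavelet_coordinatesK (a theta : R) (b x : R * R) : a != 0 ->
  rotation (- theta) x =
  (a * (wavelet_coordinates a theta b x).1 + (rotation (- theta) b).1,
   a * (wavelet_coordinates a theta b x).2 + (rotation (- theta) b).2).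
Proof. by move=> a0; rewrite /wavelet_coordinates /rotation/=; congr pair; field. Qed.

(** The normalization [a^-1] of the atom against the factor [a * a] of the change of coordinates
    leaves [a]. *)
Lemma Rintegral_wavelet (a theta : R) (b : R * R) (h : R * R -> R) U P : 0 < a ->
  U \in L2 -> P \in L2 ->
  {ae leb2, forall x, h x = U (wavelet_coordinates a theta b x)} ->
  \int[leb2]_x (h x * (a^-1 * P (wavelet_coordinates a theta b x))) =
  a * ip leb2 U P.
Proof.
move=> a0 U2 P2 hU; have an0 : a != 0 by rewrite gt_eqF.
have iF := integrableZl_EFin a^-1 (integrable_L2M U2 P2).
transitivity (\int[leb2]_x (a^-1 * (U (wavelet_coordinates a theta b x) *
    P (wavelet_coordinates a theta b x)))).
  (* [h] is only known to agree almost everywhere with a measurable function; for the phase-shifted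
     signal the values on the exceptional null set are uncontrolled. *)
  by apply: ae_eq_Rintegral_nomeas; apply: filterS hU => x ->; rewrite mulrCA.
rewrite (scales_Rintegral (scales_wavelet_coordinates theta b a0) iF).
rewrite RintegralZl//; last exact: integrable_L2M.
by rewrite -mulrA (mulrA a a^-1) mulfV// mul1r.
Qed.

Lemma qreal_unitsE (p p1 p2 p3 : R) :
  qreal p + qi * qreal p1 + qj * qreal p2 + qk * qreal p3 = Quat p p1 p2 p3.
Proof.
have ei : qi * qreal p1 = Quat 0 p1 0 0 by congr Quat => /=; ring.
have ej : qj * qreal p2 = Quat 0 0 p2 0 by congr Quat => /=; ring.
have ek : qk * qreal p3 = Quat 0 0 0 p3 by congr Quat => /=; ring.
by rewrite ei ej ek; congr Quat => /=; ring.
Qed.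

Lemma qreal_qconj_wavelet (x s p p1 p2 p3 : R) :
  qreal x * qconj (qreal s * (qreal p + qi * qreal p1 + qj * qreal p2 - qk * qreal p3)) =
  Quat (x * (s * p)) (x * (s * - p1)) (x * (s * - p2)) (x * (s * p3)).
Proof.
have -> : - (qk * qreal p3) = qk * qreal (- p3) :> quaternion R.
  by congr Quat => /=; ring.
rewrite qreal_unitsE.
have -> : qreal s * Quat p p1 p2 (- p3) = Quat (s * p) (s * p1) (s * p2) (- (s * p3)).
  by congr Quat => /=; ring.
rewrite /qconj/=; by congr Quat => /=; ring.
Qed.

(** Conjugation negates the [qi] and [qj] components and turns the minus sign of the [qk] component
    of the wavelet into a plus. *)
Lemma wavelet_transform_ip psi psiee (a theta : R) (b : R * R) (h : R * R -> R) U :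
  psiee \in L2 ->
  (forall x, psi x = qreal (psiee x)
        + qi * qreal (hilbert1 psiee x) + qj * qreal (hilbert2 psiee x)
        - qk * qreal (hilbert2 (hilbert1 psiee) x)) ->
  0 < a -> U \in L2 ->
  {ae leb2, forall x, h x = U (wavelet_coordinates a theta b x)} ->
  wavelet_transform psi a theta b h =
  Quat (a * ip leb2 U psiee) (- (a * ip leb2 U (hilbert1 psiee)))
    (- (a * ip leb2 U (hilbert2 psiee))) (a * ip leb2 U (hilbert2 (hilbert1 psiee))).
Proof.
move=> p2 psiE a0 U2 hU.
have [k pk] := is_transform_exists (cas2_contractive R) p2.
have w1 := hilbert_W true pk; have w2 := hilbert_W false pk.
have w21 := hilbert_W false w1.
have [h1 _ _] := w1; have [h2 _ _] := w2; have [h21 _ _] := w21.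
have ipNr P : P \in L2 -> a * ip leb2 U (fun x => - P x) = - (a * ip leb2 U P).
  by move=> P2; rewrite ip_C [in RHS]ip_C ipNl// mulrN.
have E x : qreal (h x) * qconj (wavelet_atom psi a theta b x) =
    Quat (h x * (a^-1 * psiee (wavelet_coordinates a theta b x)))
     (h x * (a^-1 * - hilbert1 psiee (wavelet_coordinates a theta b x)))
     (h x * (a^-1 * - hilbert2 psiee (wavelet_coordinates a theta b x)))
     (h x * (a^-1 * hilbert2 (hilbert1 psiee) (wavelet_coordinates a theta b x))).
  by rewrite /wavelet_atom psiE; exact: qreal_qconj_wavelet.
have r0 := Rintegral_wavelet a0 U2 p2 hU.
have r1 := Rintegral_wavelet a0 U2 (L2N h1) hU.
have r2 := Rintegral_wavelet a0 U2 (L2N h2) hU.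
have r3 := Rintegral_wavelet a0 U2 h21 hU.
have s1 := etrans r1 (ipNr _ h1).
have s2 := etrans r2 (ipNr _ h2).
rewrite /wavelet_transform /qintegral; congr Quat.
- by apply: etrans r0; apply: eq_Rintegral => x _; exact: (congr1 (@q0 R) (E x)).
- by apply: etrans s1; apply: eq_Rintegral => x _; exact: (congr1 (@q1 R) (E x)).
- by apply: etrans s2; apply: eq_Rintegral => x _; exact: (congr1 (@q2 R) (E x)).
- by apply: etrans r3; apply: eq_Rintegral => x _; exact: (congr1 (@q3 R) (E x)).
Qed.

(* Up to the factor [a], the wavelet transform of a signal whose pullback to
   the coordinates of the atom has W-transform [K]; [k] is the W-transform of
   the generating wavelet. *)
Definition spectral_product (K k : Rm * Rm -> R) : quaternion R :=
  Quat (ip leb2 K k) (ip leb2 (S true K) k) (ip leb2 (S false K) k)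
    (ip leb2 (S true (S false K)) k).

Lemma qrealM_Quat (x y0 y1 y2 y3 : R) :
  qreal x * Quat y0 y1 y2 y3 = Quat (x * y0) (x * y1) (x * y2) (x * y3).
Proof. by congr Quat => /=; ring. Qed.

(** The minus signs from conjugation are absorbed when the skew operators move from [k] to [K];
    moving two of them costs no sign. Since [k] depends on the wavelet alone, it serves both for [g]
    and for its phase shift. *)
Lemma wavelet_transform_spectral psi (a theta : R) (b : R * R) : 0 < a ->
  hypercomplexing_wavelet psi -> exists2 k, k \in L2 & forall h U K,
  is_W U K -> {ae leb2, forall x, h x = U (wavelet_coordinates a theta b x)} ->
  wavelet_transform psi a theta b h = qreal a * spectral_product K k.
Proof.
move=> a0 [p [p2 _ _ _ psiE]].
have [k pk] := is_transform_exists (cas2_contractive R) p2.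
have [_ k2 _] := pk; exists k => // h U K UK hU.
have [U2 K2 _] := UK.
have w1 := hilbert_W true pk; have w2 := hilbert_W false pk.
have w21 := hilbert_W false w1.
rewrite (wavelet_transform_ip p2 psiE a0 U2 hU).
have s1 := sgn_reflect_L2 true k2; have s2 := sgn_reflect_L2 false k2.
have e0 := ip_W UK pk; have e1 := ip_W UK w1; have e2 := ip_W UK w2.
have e3 := ip_W UK w21.
have f1 := sgn_reflect_skew true K2 k2; have f2 := sgn_reflect_skew false K2 k2.
have f3 : ip leb2 (S true (S false K)) k = ip leb2 K (S false (S true k)).
  rewrite sgn_reflect_skew// ?sgn_reflect_L2//.
  by rewrite sgn_reflect_skew// opprK.
apply: etrans (esym (qrealM_Quat _ _ _ _ _)); congr Quat.
- by rewrite e0.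
- by rewrite e1 -mulrN; congr (_ * _); exact: (esym f1).
- by rewrite e2 -mulrN; congr (_ * _); exact: (esym f2).
- by rewrite e3; congr (_ * _); exact: (esym f3).
Qed.

Lemma ip_sgn_reflect_lin (c s : R) l K k : K \in L2 -> k \in L2 ->
  ip leb2 (fun z => c * K z + s * S l K z) k = c * ip leb2 K k + s * ip leb2 (S l K) k.
Proof.
move=> K2 k2; have S2 := sgn_reflect_L2 l K2.
rewrite ipDl//; [|exact: L2Z|exact: L2Z].
by rewrite !ipZl.
Qed.

Lemma sgn_reflect_lin (c s : R) l l' K :
  S l' (fun z => c * K z + s * S l K z) =
  (fun z => c * S l' K z + s * S l (S l' K) z).
Proof.
rewrite -sgn_reflectC; apply/funext => z; rewrite /sgn_reflect; ring.
Qed.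

Lemma ip_sgn_reflectK l K k : K \in L2 -> k \in L2 ->
  ip leb2 (S l (S l K)) k = - ip leb2 K k.
Proof.
move=> K2 k2; rewrite sgn_reflect_skew ?sgn_reflect_isometry//.
exact: sgn_reflect_L2.
Qed.

(** Passing from [K] to [S true K] sends the components [(c0, c1, c2, c3)] to
    [(c1, - c0, c3, - c2)], by commutation and [S true] squaring to -1. *)
Lemma spectral_product_fst (t : R) K k : K \in L2 -> k \in L2 ->
  spectral_product (fun z => cos t * K z + sin t * S true K z) k =
  qexp qi (- t) * spectral_product K k.
Proof.
move=> K2 k2; have S2 := sgn_reflect_L2 false K2.
rewrite /spectral_product !sgn_reflect_lin !ip_sgn_reflect_lin ?sgn_reflect_L2//.
rewrite !ip_sgn_reflectK//.
rewrite /qexp cosN sinN; congr Quat => /=; ring.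
Qed.

(** Here the components become [(c2, c3, - c0, - c1)]; with [qk = qi * qj] this is multiplication by
    [- qj] on the right, not on the left. *)
Lemma spectral_product_snd (t : R) K k : K \in L2 -> k \in L2 ->
  spectral_product (fun z => cos t * K z + sin t * S false K z) k =
  spectral_product K k * qexp qj (- t).
Proof.
move=> K2 k2; have S2 := sgn_reflect_L2 true K2.
rewrite /spectral_product !sgn_reflect_lin !ip_sgn_reflect_lin ?sgn_reflect_L2//.
rewrite (sgn_reflectC true false K) !ip_sgn_reflectK//.
rewrite /qexp cosN sinN; congr Quat => /=; ring.
Qed.

Lemma is_transform_rot t (h H q : Rm -> R) : V h q -> V H (sgn_opp q) ->
  V (fun x => cos t * h x + sin t * H x) (fun y => cos t * q y + sin t * sgn_opp q y).
Proof.
have K := cas_kernel_contractive R.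
move=> hq Hq; have c := is_transformZ K (cos t) hq; have s := is_transformZ K (sin t) Hq.
exact: is_transformD c s.
Qed.

Lemma tensor_rot_fst (t : R) (q u : Rm -> R) :
  tensor (fun y => cos t * q y + sin t * sgn_opp q y) u =
  (fun z => cos t * tensor q u z + sin t * S true (tensor q u) z).
Proof.
by rewrite sgn_reflect_tensor_fst; apply/funext => z; rewrite /tensor; ring.
Qed.

Lemma tensor_rot_snd (t : R) (q u : Rm -> R) :
  tensor u (fun y => cos t * q y + sin t * sgn_opp q y) =
  (fun z => cos t * tensor u q z + sin t * S false (tensor u q) z).
Proof.
by rewrite sgn_reflect_tensor_snd; apply/funext => z; rewrite /tensor; ring.
Qed.

Lemma qrealC (x : R) (q : quaternion R) : qreal x * q = q * qreal x.
Proof. by congr Quat => /=; ring. Qed.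

Lemma rotationK (theta : R) (x : R * R) : rotation (- theta) (rotation theta x) = x.
Proof.
by rewrite rotationD addNr /rotation cos0 sin0; case: x => y z /=; congr pair; ring.
Qed.

(** In the rotated frame [g] is exactly [tensor g1 g2], so almost everywhere its hypercomplex signal
    is a quaternion of the form treated by [phase_of_product]; the rotation keeps the exceptional
    set null. *)
Lemma phase_shift_separable (ts : R * R) (theta : R) (g : R * R -> R)
    (g1 g2 G1 G2 k1 k2 : Rm -> R) :
  (forall x, g x = g1 (rotation (- theta) x).1 * g2 (rotation (- theta) x).2) ->
  V g1 k1 -> V g2 k2 -> V G1 (sgn_opp k1) -> V G2 (sgn_opp k2) ->
  {ae leb2, forall x, let y := rotation (- theta) x in
    phase_shift ts theta g x = (cos ts.1 * g1 y.1 + sin ts.1 * G1 y.1) *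
      (cos ts.2 * g2 y.2 + sin ts.2 * G2 y.2)}.
Proof.
move=> hg v1 v2 V1 V2.
have h := scales_ae (scales_rotation (- theta)) (hilbert_tensor v1 v2 V1 V2).
apply: filterS h => x [e1 e2 e3].
have E : (fun x => g (rotation theta x)) = tensor g1 g2.
  by apply/funext => z; rewrite hg rotationK.
rewrite -phase_of_product /phase_shift /hypercomplex_tilde /hypercomplex E.
by rewrite qreal_unitsE /rotate_fun e1 e2 e3.
Qed.

End phase_shift_theorem.

Theorem theorem6 (R : realType) (theta : R) (htheta : 0 <= theta < 2 * pi)
    (g1 g2 : R -> R)
    (hg1 : g1 \in Lfun (@lebesgue_measure R) 2%:E)
    (hg2 : g2 \in Lfun (@lebesgue_measure R) 2%:E)
    (g : R * R -> R)
    (hg : forall x : R * R,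
      g x = g1 (rotation (- theta) x).1 * g2 (rotation (- theta) x).2)
    (psi : R * R -> quaternion R) (hpsi : hypercomplexing_wavelet psi)
    (ts : R * R) (a : R) (ha : 0 < a) (b : R * R) :
  wavelet_transform psi a theta b (phase_shift ts theta g) =
  qexp qi (- ts.1) * wavelet_transform psi a theta b g * qexp qj (- ts.2).
Proof.
have an0 : a != 0 by rewrite gt_eqF.
have [k1 [G1 [v1 V1]]] := hilbert1D_exists hg1.
have [k2 [G2 [v2 V2]]] := hilbert1D_exists hg2.
have [k k_L2 wavE] := wavelet_transform_spectral theta b ha hpsi.
(* Each coordinate in the rotated frame is [a] times that of the atom plus one of [b'], so the
   one-dimensional factors are pulled back by these affine maps. *)
pose b' := rotation (- theta) b.
have u1 := is_transform_affine b'.1 ha v1; have u2 := is_transform_affine b'.2 ha v2.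
have := is_transform_affine b'.1 ha V1; rewrite affine_transform_sgn// => U1.
have := is_transform_affine b'.2 ha V2; rewrite affine_transform_sgn// => U2.
move: u1 u2 U1 U2; set q1 := affine_transform _ _ _; set q2 := affine_transform _ _ _.
move=> u1 u2 U1 U2.
have w := is_W_tensor u1 u2.
(* The two shifts are removed in turn, the first coordinate first; [ws2] supplies the L2 membership
   of the intermediate W-transform. *)
have ws2 := is_W_tensor u1 (is_transform_rot ts.2 u2 U2).
have ws := is_W_tensor (is_transform_rot ts.1 u1 U1) (is_transform_rot ts.2 u2 U2).
have [_ w_L2 _] := w; have [_ ws2_L2 _] := ws2.
rewrite (wavE g _ _ w); last first.
  by apply: aeW => x; rewrite hg (wavelet_coordinatesK theta b x an0).
rewrite (wavE (phase_shift ts theta g) _ _ ws); last first.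
  apply: filterS (phase_shift_separable ts hg v1 v2 V1 V2) => x ->.
  by rewrite (wavelet_coordinatesK theta b x an0).
rewrite tensor_rot_fst spectral_product_fst// tensor_rot_snd spectral_product_snd//.
(* The real factor [a] commutes past the exponential on the left. *)
by rewrite !mulrA qrealC.
Qed.
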